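(* Every involutive commutative two-valued group is isomorphic to one of the two-valued groups (1) $X^{\mathbf a}_A$, where $A$ is an abelian group; (2) $X^{\mathbf u}_V\times W$, where $V$ and $W$ are Boolean groups and $\dim V\ge 3$; (3) $Y_V\times W$, where $V$ and $W$ are Boolean groups and $\dim V\ge 2$. Two-valued groups from different series (1), (2), (3) are never isomorphic to each other. Two two-valued groups, both in series (2) or both in series (3), are isomorphic to each other if and only if the corresponding Boolean groups $V$ are isomorphic and simultaneously the corresponding Boolean groups $W$ are isomorphic.
   Context: For a set $X$, $\mathrm{Sym}^2(X)$ is the set of two-element multisets $[x,y]$ of elements of $X$. A two-valued group is a set $X$ with a map $*\colon X\times X\to \mathrm{Sym}^2(X)$, an element $e\in X$ and a map $x\mapsto x^{-1}$ such that: (associativity) $x*(y*z)=(x*y)*z$ as four-element multisets, where $x*[u,v]$ is the multiset union of $x*u$ and $x*v$, and similarly for $[u,v]*z$; (strong identity) $e*x=x*e=[x,x]$; (existence and uniqueness of inverse) $e$ belongs to each of $x*x^{-1}$ and $x^{-1}*x$, and if $e$ belongs to $x*y$ or to $y*x$ then $y=x^{-1}$. It is commutative if $x*y=y*x$ for all $x,y$, and involutive if $x^{-1}=x$ for all $x$. An isomorphism is a bijection $f$ such that $x*y=[z_1,z_2]$ implies $f(x)*f(y)=[f(z_1),f(z_2)]$. No finite generation and no topology is assumed. Coset construction: if $G$ is a group and $\iota$ an automorphism of $G$ with $\iota^2=\mathrm{id}$, then $G/\iota$ denotes the set of orbits of $\iota$ with $\pi(g)*\pi(h)=[\pi(gh),\pi(g\iota(h))]$,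 identity $\pi(e)$ and inverse $\pi(g)^{-1}=\pi(g^{-1})$, where $\pi\colon G\to G/\iota$ is the projection. For an abelian group $A$ (written multiplicatively), $X^{\mathbf a}_A=A/\iota_{\mathbf a}$ with $\iota_{\mathbf a}(a)=a^{-1}$. A Boolean group is a group all of whose non-identity elements have order 2 (a vector space over $\mathbb F_2$, possibly infinite-dimensional, written multiplicatively); $\dim$ is its dimension over $\mathbb F_2$. For a Boolean group $V$, $X^{\mathbf u}_V=(V\times V)/\iota_{\mathbf u}$ with $\iota_{\mathbf u}(a,b)=(a,ab)$. For a Boolean group $V$ with identity $e$, $Y_V=V\cup\{s\}$ ($s$ an extra element) with commutative operation: $x*y=[xy,xy]$ for $x,y\in V$, $x\neq y$; $x*x=[e,s]$ for $x\in V\setminus\{e\}$; $s*x=[x,x]$ for $x\in V\setminus\{e\}$; $e*x=[x,x]$ for $x\in V\cup\{s\}$; $s*s=[e,e]$. For a two-valued group $X$ and a Boolean group $W$, $X\times W$ has multiplication $(x_1,w_1)*(x_2,w_2)=[(z_1,w_1w_2),(z_2,w_1w_2)]$ where $x_1*x_2=[z_1,z_2]$. *)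

(* Defs.v *)
From HB Require Import structures.
From mathcomp Require Import all_boot all_order all_algebra.
From mathcomp Require Import finmap multiset.
From mathcomp Require Import boolp classical_sets functions cardinality.

Set Implicit Arguments.
Unset Strict Implicit.
Unset Printing Implicit Defensive.

Local Open Scope quotient_scope.
Local Open Scope mset_scope.
Local Open Scope group_scope.

Section MsetSum.
Variable T : choiceType.

Fact msetDA_ : associative (@msetD T).
Proof. by move=> A B C; rewrite msetDA. Qed.
Fact msetDC_ : commutative (@msetD T).
Proof. by move=> A B; rewrite msetDC. Qed.
Fact mset0D_ : left_id (@mset0 T) (@msetD T).
Proof. by move=> A; rewrite mset0D. Qed.

HB.instance Definition _ :=
  Monoid.isComLaw.Build {mset T} mset0 (@msetD T) msetDA_ msetDC_ mset0D_.

End MsetSum.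

Lemma perm_mset2 (T : choiceType) (a b : T) : perm_eq [mset a; b] [:: a; b].
Proof.
by apply/permP => p; apply/permP: p; rewrite perm_sym; apply/allP => x _ /=;
   rewrite count_mem_mset mset1DE msetnE addn0 [x == a]eq_sym [x == b]eq_sym;
   case: (b == x).
Qed.

Section Mset2.
Variable T : choiceType.

Lemma big_mset2 (S : choiceType) (F : T -> {mset S}) (a b : T) :
  \big[msetD/mset0]_(u <- [mset a; b]) F u = F a `+` F b.
Proof.
by rewrite (perm_big _ (perm_mset2 a b)) /= big_cons big_seq1.
Qed.

Lemma map_mset2 (S : choiceType) (F : T -> S) (a b : T) :
  seq_mset [seq F u | u <- [mset a; b]] = [mset F a; F b].
Proof.
rewrite -[RHS]seq_mset_id; apply/eq_seq_msetP.
apply: perm_trans (perm_map F (perm_mset2 a b)) _.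
by rewrite perm_sym perm_mset2.
Qed.

Lemma size_mset2 (a b : T) : size [mset a; b] = 2.
Proof. by rewrite (perm_size (perm_mset2 a b)). Qed.

Lemma in_mset2 (x a b : T) : (x \in [mset a; b]) = (x == a) || (x == b).
Proof. by rewrite (perm_mem (perm_mset2 a b)) !inE. Qed.

Lemma mset2C (a b : T) : [mset a; b] = [mset b; a].
Proof. by rewrite msetDC. Qed.

Lemma mset2P (M : {mset T}) : size M = 2 -> exists a b, M = [mset a; b].
Proof.
move=> sM; have : seq_mset M = M by exact: seq_mset_id.
case: (enum_mset M) sM => [|a [|b [|]]] //= _ <-; exists a, b.
rewrite -[RHS]seq_mset_id; apply/eq_seq_msetP.
by rewrite perm_sym perm_mset2.
Qed.

End Mset2.

(* Sym^2 of a set T is the set of multisets M : {mset T} with size M = 2.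
   The iterated products are sums of multisets with multiplicities (`+`, not
   the pointwise maximum `|`). *)
Record twoValuedGroup := TwoValuedGroup {
  tv_sort :> choiceType;
  tv_mul : tv_sort -> tv_sort -> {mset tv_sort};
  tv_one : tv_sort;
  tv_inv : tv_sort -> tv_sort;
  tv_mul_size : forall x y, size (tv_mul x y) = 2;
  tv_mulA : forall x y z,
    \big[msetD/mset0]_(u <- tv_mul y z) tv_mul x u
      = \big[msetD/mset0]_(u <- tv_mul x y) tv_mul u z;
  tv_mul1x : forall x, tv_mul tv_one x = [mset x; x];
  tv_mulx1 : forall x, tv_mul x tv_one = [mset x; x];
  tv_mulxV : forall x, tv_one \in tv_mul x (tv_inv x);
  tv_mulVx : forall x, tv_one \in tv_mul (tv_inv x) x;
  tv_inv_uniq : forall x y,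
    tv_one \in tv_mul x y \/ tv_one \in tv_mul y x -> y = tv_inv x
}.

Definition tv_commutative (X : twoValuedGroup) : Prop :=
  commutative (@tv_mul X).

Definition tv_involutive (X : twoValuedGroup) : Prop :=
  forall x : X, tv_inv x = x.

Definition tv_isomorphic (X Y : twoValuedGroup) : Prop :=
  exists f : X -> Y, bijective f /\
    forall x y z1 z2 : X, tv_mul x y = [mset z1; z2] ->
      tv_mul (f x) (f y) = [mset f z1; f z2].

Section CosetConstruction.
Variables (G : groupType) (iota : G -> G).
Hypothesis iotaM : {morph iota : g h / g * h}.
Hypothesis iotaK : involutive iota.

Definition orbit_rel : rel G := fun g h => (h == g) || (h == iota g).

Fact orbit_rel_refl : reflexive orbit_rel.
Proof. by move=> g; rewrite /orbit_rel eqxx. Qed.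

Fact orbit_rel_sym : symmetric orbit_rel.
Proof.
move=> g h; rewrite /orbit_rel [h == g]eq_sym; congr (_ || _).
by apply/eqP/eqP => ->; rewrite iotaK.
Qed.

Fact orbit_rel_trans : transitive orbit_rel.
Proof.
move=> h g k /orP[]/eqP-> /orP[]/eqP->; rewrite /orbit_rel ?iotaK ?eqxx ?orbT //.
Qed.

Canonical orbit_equiv :=
  EquivRel orbit_rel orbit_rel_refl orbit_rel_sym orbit_rel_trans.

Definition orbits : choiceType := {eq_quot orbit_equiv}.

Definition orbit_proj (g : G) : orbits := \pi_{eq_quot orbit_equiv} g.
Definition orbit_repr (x : orbits) : G := repr (x : {eq_quot orbit_equiv}).

(* The two-valued product is independent of the representatives: see
   [coset_mulE]. *)
Definition coset_mul (x y : orbits) : {mset orbits} :=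
  let g := orbit_repr x in let h := orbit_repr y in
  [mset orbit_proj (g * h); orbit_proj (g * iota h)].
Definition coset_inv (x : orbits) : orbits := orbit_proj (orbit_repr x)^-1.

Lemma orbit_projP g h : orbit_proj g = orbit_proj h <-> h = g \/ h = iota g.
Proof.
split=> [/eqmodP /orP[]/eqP|gh]; [by left|by right|].
by apply/eqmodP; rewrite /= /orbit_rel; case: gh => ->; rewrite eqxx ?orbT.
Qed.

Lemma orbit_reprK x : orbit_proj (orbit_repr x) = x.
Proof. exact: reprK. Qed.

Lemma orbit_proj_iota g : orbit_proj (iota g) = orbit_proj g.
Proof. by apply/orbit_projP; right; rewrite iotaK. Qed.

Lemma orbit_reprP g :
  orbit_repr (orbit_proj g) = g \/ orbit_repr (orbit_proj g) = iota g.
Proof. by apply/orbit_projP; rewrite orbit_reprK. Qed.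

Lemma coset_mulE g h :
  coset_mul (orbit_proj g) (orbit_proj h)
    = [mset orbit_proj (g * h); orbit_proj (g * iota h)].
Proof.
rewrite /coset_mul.
have E a b : orbit_proj (iota a * b) = orbit_proj (a * iota b).
  by rewrite -orbit_proj_iota iotaM iotaK.
case: (orbit_reprP g) => ->; case: (orbit_reprP h) => -> //;
  by rewrite ?E ?iotaK // mset2C.
Qed.

Lemma iota1 : iota 1 = 1.
Proof. by apply: (mulgI (iota 1)); rewrite -iotaM !mulg1. Qed.

Lemma iotaV g : iota g^-1 = (iota g)^-1.
Proof. by apply: (mulgI (iota g)); rewrite -iotaM !mulgV iota1. Qed.

Lemma coset_invE g : coset_inv (orbit_proj g) = orbit_proj g^-1.
Proof.
rewrite /coset_inv; case: (orbit_reprP g) => -> //.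
by rewrite -iotaV orbit_proj_iota.
Qed.

Fact coset_mul_size x y : size (coset_mul x y) = 2.
Proof. exact: size_mset2. Qed.

Fact coset_mulA x y z :
  \big[msetD/mset0]_(u <- coset_mul y z) coset_mul x u
    = \big[msetD/mset0]_(u <- coset_mul x y) coset_mul u z.
Proof.
rewrite -(orbit_reprK x) -(orbit_reprK y) -(orbit_reprK z).
move: (orbit_repr x) (orbit_repr y) (orbit_repr z) => a b c.
rewrite !coset_mulE !big_mset2 !coset_mulE !iotaM iotaK !mulgA.
apply/msetP => t; rewrite !msetE2 addnACA; congr addn.
by rewrite addnC.
Qed.

Fact coset_mul1x x : coset_mul (orbit_proj 1) x = [mset x; x].
Proof.
by rewrite -(orbit_reprK x) coset_mulE !mul1g orbit_proj_iota.
Qed.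

Fact coset_mulx1 x : coset_mul x (orbit_proj 1) = [mset x; x].
Proof. by rewrite -(orbit_reprK x) coset_mulE iota1 !mulg1. Qed.

Fact coset_mulxV x : orbit_proj 1 \in coset_mul x (coset_inv x).
Proof.
by rewrite -(orbit_reprK x) coset_invE coset_mulE mulgV in_mset2 eqxx.
Qed.

Fact coset_mulVx x : orbit_proj 1 \in coset_mul (coset_inv x) x.
Proof.
by rewrite -(orbit_reprK x) coset_invE coset_mulE mulVg in_mset2 eqxx.
Qed.

Fact coset_inv_uniq x y :
  orbit_proj 1 \in coset_mul x y \/ orbit_proj 1 \in coset_mul y x ->
  y = coset_inv x.
Proof.
have P1 g : orbit_proj 1 = orbit_proj g -> g = 1.
  by move/orbit_projP; rewrite iota1 => -[].
rewrite -(orbit_reprK x) -(orbit_reprK y).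
move: (orbit_repr x) (orbit_repr y) => a b.
rewrite !coset_mulE coset_invE !in_mset2.
case=> /orP[] /eqP/P1 => [/mulg1_eq->|/mulg1_eq|/mulg1_eq|/mulg1_eq] //.
- by move=> ->; rewrite orbit_proj_iota.
- by move=> <-; rewrite invgK.
- by move/(congr1 iota); rewrite iotaK iotaV => <-; rewrite invgK orbit_proj_iota.
Qed.

Definition cosetTV : twoValuedGroup :=
  TwoValuedGroup coset_mul_size coset_mulA coset_mul1x coset_mulx1
    coset_mulxV coset_mulVx coset_inv_uniq.

End CosetConstruction.

Record abelianGroup := AbelianGroup {
  ab_sort :> groupType;
  ab_mulC : forall a b : ab_sort, a * b = b * a
}.

Record booleanGroup := BooleanGroup {
  bool_sort :> groupType;
  bool_sqr : forall a : bool_sort, a ^+ 2 = 1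
}.

Definition group_isomorphic (G H : groupType) : Prop :=
  exists f : G -> H, bijective f /\ {morph f : a b / a * b}.

(* A Boolean group as a multiplicatively written vector space over 'F_2:
   the scalar c acts by a |-> a ^+ c. *)
Definition F2_comb (V : booleanGroup) (s : seq V) (c : V -> 'F_2) : V :=
  \prod_(a <- s) a ^+ (nat_of_ord (c a)).

(* B may be infinite; s ranges over finite lists of elements of B. *)
Definition F2_basis (V : booleanGroup) (B : set V) : Prop :=
  (forall (s : seq V) (c : V -> 'F_2), uniq s -> {in s, forall a, B a} ->
     F2_comb s c = 1 -> {in s, forall a, c a = 0%R}) /\
  (forall v : V, exists (s : seq V) (c : V -> 'F_2),
     {in s, forall a, B a} /\ v = F2_comb s c).

Definition F2_dim_ge (V : booleanGroup) (n : nat) : Prop :=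
  exists B : set V, F2_basis B /\ (`I_n #<= B)%card.

Lemma bool_mulaa (V : booleanGroup) (a : V) : a * a = 1.
Proof. by rewrite -[RHS](bool_sqr a) expgS expg1. Qed.

Lemma bool_mulC (V : booleanGroup) (a b : V) : a * b = b * a.
Proof.
have E (c : V) : c^-1 = c by apply: mulg1_eq; rewrite bool_mulaa.
by rewrite -[LHS]E invgM !E.
Qed.

Definition iota_a (A : abelianGroup) (a : A) : A := a^-1.

Fact iota_aM (A : abelianGroup) : {morph @iota_a A : a b / a * b}.
Proof. by move=> a b; rewrite /iota_a invgM ab_mulC. Qed.

Fact iota_aK (A : abelianGroup) : involutive (@iota_a A).
Proof. exact: invgK. Qed.

Definition Xa (A : abelianGroup) : twoValuedGroup :=
  cosetTV (@iota_aM A) (@iota_aK A).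

Definition iota_u (V : booleanGroup) (p : V * V) : V * V := (p.1, p.1 * p.2).

Fact iota_uM (V : booleanGroup) : {morph @iota_u V : p q / p * q}.
Proof.
move=> [a b] [c d]; congr pair => /=.
by rewrite -!mulgA; congr (_ * _); rewrite !mulgA (bool_mulC c b).
Qed.

Fact iota_uK (V : booleanGroup) : involutive (@iota_u V).
Proof. by move=> [a b]; rewrite /iota_u /= mulgA bool_mulaa mul1g. Qed.

Definition Xu (V : booleanGroup) : twoValuedGroup :=
  cosetTV (@iota_uM V) (@iota_uK V).

Section YConstruction.
Variable V : booleanGroup.

(* [None] is the extra element s. *)
Definition Y_mul (x y : option V) : {mset option V} :=
  match x, y with
  | Some a, Some b =>
      if a != b then [mset Some (a * b); Some (a * b)]
      else if a != 1 then [mset Some 1; None]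
      else [mset Some 1; Some 1]
  | None, Some a | Some a, None =>
      if a != 1 then [mset Some a; Some a] else [mset None; None]
  | None, None => [mset Some 1; Some 1]
  end.

Definition Y_inv (x : option V) : option V := x.

Lemma Y_mulC : commutative Y_mul.
Proof.
move=> [a|] [b|] //=; rewrite [b == a]eq_sym bool_mulC.
by case: eqP => // ->.
Qed.

Fact Y_mul_size x y : size (Y_mul x y) = 2.
Proof. by case: x y => [a|] [b|] /=; do ?case: ifP => _; rewrite size_mset2. Qed.

Fact Y_mul1x x : Y_mul (Some 1) x = [mset x; x].
Proof.
case: x => [a|] /=; last by rewrite eqxx.
by rewrite mul1g eqxx /=; case: eqP => // <-.
Qed.

Fact Y_mulx1 x : Y_mul x (Some 1) = [mset x; x].
Proof. by rewrite Y_mulC Y_mul1x. Qed.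

Fact Y_mulA x y z :
  \big[msetD/mset0]_(u <- Y_mul y z) Y_mul x u
    = \big[msetD/mset0]_(u <- Y_mul x y) Y_mul u z.
Proof.
have [->|x1] := eqVneq x (Some 1).
  have [a [b E]] := mset2P (Y_mul_size y z).
  by rewrite E !Y_mul1x !big_mset2 !Y_mul1x E; apply/msetP => t;
     rewrite !msetE2 addnACA.
have [->|z1] := eqVneq z (Some 1).
  have [a [b E]] := mset2P (Y_mul_size x y).
  by rewrite E !Y_mulx1 !big_mset2 !Y_mulx1 E; apply/msetP => t;
     rewrite !msetE2 addnACA.
have [->|y1] := eqVneq y (Some 1).
  by rewrite Y_mul1x Y_mulx1 !big_mset2.
have nt (a : V) : Some a != Some 1 -> (a == 1) = false.
  by move=> a1; apply/eqP => e; rewrite e eqxx in a1.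
have K (a b : V) : a * (a * b) = b by rewrite mulgA bool_mulaa mul1g.
have K' (a b : V) : a * b * b = a by rewrite -mulgA bool_mulaa mulg1.
have ne (a b : V) : (a * b == 1) = (a == b).
  by apply/eqP/eqP => [ab|->]; rewrite ?bool_mulaa // -[LHS](K' _ b) ab mul1g.
have el (a b : V) : (a == a * b) = (b == 1).
  by apply/eqP/eqP => [e|->]; rewrite ?mulg1 // -[LHS](K a) -e bool_mulaa.
have er (a b : V) : (b == a * b) = (a == 1) by rewrite bool_mulC el.
have Y11 (a b : V) : (a == b) = false ->
    Y_mul (Some a) (Some b) = [mset Some (a * b); Some (a * b)].
  by move=> /= ->.
have Yaa (a : V) : (a == 1) = false -> Y_mul (Some a) (Some a) = [mset Some 1; None].
  by move=> /= ->; rewrite eqxx.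
have Ysa (a : V) : (a == 1) = false -> Y_mul None (Some a) = [mset Some a; Some a].
  by move=> /= ->.
have Yas (a : V) : (a == 1) = false -> Y_mul (Some a) None = [mset Some a; Some a].
  by move=> /= ->.
have dup (p q : option V) : [mset p; q] `+` [mset p; q] = [mset p; p] `+` [mset q; q].
  by apply/msetP => t; rewrite !msetE2 addnACA.
have Yss : Y_mul None None = [mset Some 1; Some 1] by [].
case: x y z x1 y1 z1 => [a|] [b|] [c|]; do ?[move=> /nt ?|move=> _].
- have [<-|/negbTE ab] := eqVneq a b.
    have [<-|/negbTE ac] := eqVneq a c.
      by rewrite Yaa // !big_mset2 Y_mul1x Y_mulx1 Yas ?Ysa.
    by rewrite Yaa // Y11 // !big_mset2 Y_mul1x Ysa // Y11 ?el ?K.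
  have [<-|/negbTE bc] := eqVneq b c.
    by rewrite Yaa // (Y11 a b) // !big_mset2 Y_mulx1 Yas // Y11 ?K' // eq_sym er.
  rewrite !Y11 // !big_mset2.
  have [->|/negbTE abc] := eqVneq a (b * c); last first.
    rewrite !Y11 // ?mulgA //; apply/eqP => e; case/eqP: abc.
    by rewrite -e bool_mulC K'.
  have -> : b * c * b = c by rewrite bool_mulC K.
  by rewrite !Yaa // ne.
- have [<-|/negbTE ab] := eqVneq a b.
    by rewrite Yas // Yaa // !big_mset2 Yaa // Y_mul1x Yss dup msetDC.
  by rewrite Y11 ?Yas // !big_mset2 Y11 // !Yas ?ne.
- have [<-|/negbTE ac] := eqVneq a c.
    by rewrite Yas ?Ysa // !big_mset2 Yaa.
  by rewrite Yas ?Ysa // !big_mset2 Y11.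
- by rewrite Yss Yas // !big_mset2 Y_mulx1 Yas.
- have [<-|/negbTE bc] := eqVneq b c.
    by rewrite Yaa // Ysa // !big_mset2 Yaa // Y_mulx1 Yss dup msetDC.
  by rewrite Y11 ?Ysa // !big_mset2 Y11 // !Ysa ?ne.
- by rewrite Yas ?Ysa // !big_mset2 Yas ?Ysa.
- by rewrite Yss Ysa // !big_mset2 Y_mul1x Ysa.
- by rewrite Yss !big_mset2.
Qed.

Fact Y_mulxV x : Some 1 \in Y_mul x (Y_inv x).
Proof.
case: x => [a|] /=; last by rewrite in_mset2 eqxx.
by rewrite eqxx /=; case: ifP => _; rewrite in_mset2 eqxx.
Qed.

Fact Y_mulVx x : Some 1 \in Y_mul (Y_inv x) x.
Proof. by rewrite Y_mulC Y_mulxV. Qed.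

Fact Y_inv_uniq x y :
  Some 1 \in Y_mul x y \/ Some 1 \in Y_mul y x -> y = Y_inv x.
Proof.
rewrite (Y_mulC y x) => H; have {H} : Some 1 \in Y_mul x y by case: H.
rewrite /Y_inv; case: x y => [a|] [b|] //=.
- case: (eqVneq a b) => [-> //|nab] /=; rewrite in_mset2 orbb => /eqP[] /esym.
  move=> ab1; case/eqP: nab; rewrite -[LHS]mulg1 -(bool_mulaa b) mulgA ab1.
  by rewrite mul1g.
- case: (eqVneq a 1) => [_|n1] /=; rewrite in_mset2 orbb // => /eqP[] a1.
  by rewrite -a1 eqxx in n1.
- case: (eqVneq b 1) => [_|n1] /=; rewrite in_mset2 orbb // => /eqP[] a1.
  by rewrite -a1 eqxx in n1.
Qed.

Definition YTV : twoValuedGroup :=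
  TwoValuedGroup Y_mul_size Y_mulA Y_mul1x Y_mulx1
    Y_mulxV Y_mulVx Y_inv_uniq.

End YConstruction.

Section ProductConstruction.
Variables (X : twoValuedGroup) (W : booleanGroup).

Definition prod_mul (p q : X * W) : {mset (X * W)} :=
  seq_mset [seq (z, p.2 * q.2) | z <- tv_mul p.1 q.1].

Definition prod_inv (p : X * W) : X * W := (tv_inv p.1, p.2^-1).

Lemma prod_mulE (x y z1 z2 : X) (v w : W) : tv_mul x y = [mset z1; z2] ->
  prod_mul (x, v) (y, w) = [mset (z1, v * w); (z2, v * w)].
Proof. by move=> E; rewrite /prod_mul /= E map_mset2. Qed.

Lemma in_prod_mul (x y z : X) (v w t : W) :
  ((z, t) \in prod_mul (x, v) (y, w)) = (z \in tv_mul x y) && (t == v * w).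
Proof.
have [a [b E]] := mset2P (tv_mul_size x y).
by rewrite (prod_mulE _ _ E) E !in_mset2 !xpair_eqE andb_orl.
Qed.

Fact prod_mul_size p q : size (prod_mul p q) = 2.
Proof.
case: p q => [x v] [y w]; have [a [b E]] := mset2P (tv_mul_size x y).
by rewrite (prod_mulE _ _ E) size_mset2.
Qed.

Fact prod_mulA p q r :
  \big[msetD/mset0]_(u <- prod_mul q r) prod_mul p u
    = \big[msetD/mset0]_(u <- prod_mul p q) prod_mul u r.
Proof.
case: p q r => [x u] [y v] [z w].
have [a [b yz]] := mset2P (tv_mul_size y z).
have [c [d xy]] := mset2P (tv_mul_size x y).
have [a1 [a2 xa]] := mset2P (tv_mul_size x a).
have [b1 [b2 xb]] := mset2P (tv_mul_size x b).
have [c1 [c2 cz]] := mset2P (tv_mul_size c z).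
have [d1 [d2 dz]] := mset2P (tv_mul_size d z).
have := tv_mulA x y z; rewrite yz xy !big_mset2 xa xb cz dz => E.
rewrite (prod_mulE _ _ yz) (prod_mulE _ _ xy) !big_mset2.
rewrite (prod_mulE _ _ xa) (prod_mulE _ _ xb).
rewrite (prod_mulE _ _ cz) (prod_mulE _ _ dz) !mulgA.
have F (s1 s2 t1 t2 : X) (h : W) :
    [mset (s1, h); (s2, h)] `+` [mset (t1, h); (t2, h)]
      = seq_mset [seq (s, h) | s <- [mset s1; s2] `+` [mset t1; t2]].
  rewrite -[LHS]seq_mset_id; apply/eq_seq_msetP.
  have P (T : choiceType) (e1 e2 e3 e4 : T) :
      perm_eq ([mset e1; e2] `+` [mset e3; e4]) [:: e1; e2; e3; e4].
    apply/allP => e _ /=; rewrite count_mem_mset !msetE2 !msetnE.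
    rewrite (eq_sym e1) (eq_sym e2) (eq_sym e3) (eq_sym e4).
    by case: (e == e1); case: (e == e2); case: (e == e3); case: (e == e4).
  by rewrite perm_sym; apply: perm_trans (perm_map _ (P _ _ _ _ _)) _;
     rewrite perm_sym P.
by rewrite !F E.
Qed.

Fact prod_mul1x p : prod_mul (tv_one X, 1) p = [mset p; p].
Proof. by case: p => x v; rewrite (prod_mulE _ _ (tv_mul1x x)) mul1g. Qed.

Fact prod_mulx1 p : prod_mul p (tv_one X, 1) = [mset p; p].
Proof. by case: p => x v; rewrite (prod_mulE _ _ (tv_mulx1 x)) mulg1. Qed.

Fact prod_mulxV p : (tv_one X, 1) \in prod_mul p (prod_inv p).
Proof. by case: p => x v; rewrite in_prod_mul tv_mulxV mulgV eqxx. Qed.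

Fact prod_mulVx p : (tv_one X, 1) \in prod_mul (prod_inv p) p.
Proof. by case: p => x v; rewrite in_prod_mul tv_mulVx mulVg eqxx. Qed.

Fact prod_inv_uniq p q :
  (tv_one X, 1) \in prod_mul p q \/ (tv_one X, 1) \in prod_mul q p ->
  q = prod_inv p.
Proof.
case: p q => [x v] [y w]; rewrite !in_prod_mul /prod_inv /=.
case=> /andP[xy /eqP/esym vw]; congr pair.
- by apply: tv_inv_uniq; left.
- by rewrite (mulg1_eq vw).
- by apply: tv_inv_uniq; right.
- by rewrite -(mulg1_eq vw) invgK.
Qed.

Definition prodTV : twoValuedGroup :=
  TwoValuedGroup prod_mul_size prod_mulA prod_mul1x prod_mulx1
    prod_mulxV prod_mulVx prod_inv_uniq.

End ProductConstruction.

(* Main.v *)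
(* Embed an involutive commutative two-valued group X into the Q-algebra R with
   basis X and [x][y] = ([z1] + [z2]) / 2 for x * y = [z1, z2]; then [x] behaves like
   the cosine of an angle, R is reduced, and 2 [x]^2 = 1 + [sq x].  The elements b with
   sq b = e form a Boolean group B that acts on X.

   Either every pair is normal, i.e. z1 * z2 = [sq x, sq y], or there are x, y, z and
   t <> e in B with x * y = [z, z] and sq x = sq y = sq z = t.  In the latter case all
   squares lie in {e, t} and X is Y_V x W.  In the former case fix g; the pairs (y, z)
   with z in g * y stand for the elements a of the sought group with y = [a] and
   z = [g a], and the addition formulas for cosine and sine define their product up to
   a sign sigma.  If sq g is not in B, comparing the two-sided sequences [g^i a] and
   [g^j b] gives sigma = -1.  If all squares lie in B, sigma is decided by whether
   X contains a Fano configuration; sigma = -1 yields X^a_A, and sigma = 1 a Boolean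
   group with an involution, that is X^u_V x W.

   V and W are recovered from the elements of order at most two and from the squares.
   The series (3) is the one in which x * y = [z, z] does not force x or y to have order
   at most two, and the Fano configuration separates (2) from (1). *)

From HB Require Import structures.
From mathcomp Require Import all_boot all_order all_algebra.
From mathcomp Require Import multiset.
From mathcomp Require Import boolp classical_sets functions cardinality.
From mathcomp Require Import freeg ring zify.
Require Import Defs.

Set Implicit Arguments.
Unset Strict Implicit.
Unset Printing Implicit Defensive.

Import Order.TTheory GRing.Theory Num.Theory.
Local Open Scope mset_scope.
Local Open Scope ring_scope.

(** In the group ring of A the class [a] becomes (a + iota a)/2, which explains the cosines. The
    obstacle is that the ring of X contains no sines, and that [a] * [b] is only an unordered pair.
    A reference element g supplies sines up to a common factor: with cos a = (a + iota a)/2 and sin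
    a = (a - iota a)/2 one has [g a] - [g][a] = sin g sin a. Moreover sin^2 g = sigma (1 - [g]^2),
    with sigma = -1 if iota is inversion and sigma = 1 if the group is Boolean and iota any
    involution. This is the origin of the formulas in [edge_law]. The factor 1 - [g]^2 can be a zero
    divisor, so it is cancelled only between basis elements, and the existence of a product needs an
    argument of its own. Normality of a pair is what ab and ab^-1 satisfy in an abelian group: their
    product and quotient are a^2 and b^2. Throughout, equations between sums of basis elements are
    read as equalities of multisets. *)

Lemma perm2P (T : eqType) (a b c d : T) :
  perm_eq [:: a; b] [:: c; d] -> (a = c /\ b = d) \/ (a = d /\ b = c).
Proof.
move=> P; have /orP[/eqP ac|/eqP ad] : (a == c) || (a == d).
- by have := perm_mem P a; rewrite !inE eqxx.
- left; split => //; move: P; rewrite ac perm_cons.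
  by move/perm_mem/(_ b); rewrite !inE eqxx => /esym/eqP.
- right; split => //; move: P; rewrite ad perm_sym (perm_catC [:: c] [:: d]) /= perm_cons.
  by move/perm_mem/(_ b); rewrite !inE eqxx => /eqP.
Qed.

Lemma mset2_inj (T : choiceType) (a b c d : T) :
  [mset a; b]%mset = [mset c; d]%mset -> (a = c /\ b = d) \/ (a = d /\ b = c).
Proof.
by move=> E; apply: perm2P; rewrite -(permPl (perm_mset2 a b)) E perm_mset2.
Qed.

(** * The ring of a two-valued group *)

Section FreeModule.
Variables (K : choiceType) (M : lmodType rat) (f : K -> M).
Implicit Type D : {freeg K / rat}.

Lemma freegUZ (k : rat) (x : K) : << k *g x >> = k *: << 1 *g x >> :> {freeg K / rat}.
Proof. by apply/eqP/freeg_eqP => t; rewrite coeffZ !coeffU mul1r. Qed.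

Lemma fgliftZ k D : fglift f (k *: D) = k *: fglift f D.
Proof.
have fD := lift_is_additive f.
have f0 : fglift f 0 = 0 by rewrite -[0](subrr 0) fD subrr.
have fA a b : fglift f (a + b) = fglift f a + fglift f b.
  by rewrite -{1}[b]opprK fD -[- b]sub0r fD f0 sub0r opprK.
rewrite -[D]freeg_sumE; elim: (dom D) => [|x s IH].
  by rewrite !big_nil scaler0 f0 scaler0.
rewrite !big_cons scalerDr !fA IH scalerDr; congr (_ + _).
by rewrite freegUZ scalerA -!freegUZ !liftU scalerA.
Qed.

Lemma freeg_linear_ind (P : {freeg K / rat} -> Prop) :
  P 0 -> (forall k x D, P D -> P (k *: << 1 *g x >> + D)) -> forall D, P D.
Proof.
move=> P0 PS D; rewrite -[D]freeg_sumE.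
by elim: (dom D) => [|x s IH]; rewrite ?big_nil // big_cons freegUZ; apply: PS.
Qed.

End FreeModule.

Record icGroup := ICGroup {
  ic_tv :> twoValuedGroup;
  ic_mulC : tv_commutative ic_tv;
  ic_inv : tv_involutive ic_tv
}.

Section Ring.
Variable X : icGroup.

(** A separate name, so that the ring structure built below is attached to it and not to the free
    module itself. *)
Definition fring : Type := {freeg X / rat}.
HB.instance Definition _ := GRing.Lmodule.copy fring {freeg X / rat}.

Definition femb (x : X) : fring := << 1 *g x >>.
Definition lin (f : X -> fring) (r : fring) : fring := fglift f r.

Lemma lin_is_additive f : additive (lin f).
Proof. exact: lift_is_additive. Qed.
HB.instance Definition _ f :=
  GRing.isAdditive.Build fring fring (lin f) (lin_is_additive f).

Lemma linZ f k r : lin f (k *: r) = k *: lin f r.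
Proof. exact: fgliftZ. Qed.

Lemma linE f x : lin f (femb x) = f x.
Proof. by rewrite /lin /femb liftU scale1r. Qed.

Lemma femb_ind (P : fring -> Prop) :
  P 0 -> (forall k x r, P r -> P (k *: femb x + r)) -> forall r, P r.
Proof. exact: freeg_linear_ind. Qed.

Lemma eq_lin_femb (f g : fring -> fring) :
  additive f -> additive g ->
  (forall k r, f (k *: r) = k *: f r) -> (forall k r, g (k *: r) = k *: g r) ->
  (forall x, f (femb x) = g (femb x)) -> f =1 g.
Proof.
move=> fB gB fZ gZ fg; have f0 : f 0 = 0 by have := fZ 0 0; rewrite !scale0r.
have g0 : g 0 = 0 by have := gZ 0 0; rewrite !scale0r.
have fD a b : f (a + b) = f a + f b by rewrite -{1}[b]opprK fB -[- b]sub0r fB f0 sub0r opprK.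
have gD a b : g (a + b) = g a + g b by rewrite -{1}[b]opprK gB -[- b]sub0r gB g0 sub0r opprK.
elim/femb_ind => [|k x r IH]; first by rewrite f0 g0.
by rewrite fD gD fZ gZ fg IH.
Qed.

Definition msum (M : {mset X}) : fring := \sum_(z <- M) femb z.
Definition prb (x y : X) : fring := 2^-1 *: msum (tv_mul x y).
Definition mulr_ (r s : fring) : fring := lin (fun x => lin (prb x) s) r.
Definition oner_ : fring := femb (tv_one X).

Lemma msum2 a b : msum [mset a; b]%mset = femb a + femb b.
Proof. by rewrite /msum (perm_big _ (perm_mset2 a b)) /= big_cons big_seq1. Qed.

Lemma mulr_fembE x y : mulr_ (femb x) (femb y) = prb x y.
Proof. by rewrite /mulr_ !linE. Qed.

Lemma mulr_Bl s : additive (mulr_^~ s).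
Proof. by move=> a b; rewrite /mulr_ raddfB. Qed.

Lemma mulr_Zl s k r : mulr_ (k *: r) s = k *: mulr_ r s.
Proof. by rewrite /mulr_ linZ. Qed.

Lemma mulr_C : commutative mulr_.
Proof.
have Br r : additive (mulr_ r).
  move=> a b; move: r; apply: eq_lin_femb => [||k r|k r|x].
  - exact: mulr_Bl.
  - by move=> r r' /=; rewrite !mulr_Bl !opprD !opprK addrACA.
  - by rewrite mulr_Zl.
  - by rewrite !mulr_Zl scalerBr.
  - by rewrite /mulr_ !linE raddfB.
have Zr r k s : mulr_ r (k *: s) = k *: mulr_ r s.
  move: r; apply: eq_lin_femb => [|||k' r|x].
  - exact: mulr_Bl.
  - by move=> r r'; rewrite mulr_Bl scalerBr.
  - by move=> k' r; rewrite mulr_Zl.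
  - by rewrite mulr_Zl !scalerA mulrC.
  - by rewrite /mulr_ !linE linZ.
move=> r s; move: r; apply: eq_lin_femb => //.
- exact: mulr_Bl.
- by move=> k r; rewrite mulr_Zl.
move=> x; move: s; apply: eq_lin_femb => //.
- exact: mulr_Bl.
- by move=> k r; rewrite mulr_Zl.
by move=> y; rewrite !mulr_fembE /prb ic_mulC.
Qed.

Lemma mulr_Br r : additive (mulr_ r).
Proof. by move=> a b; rewrite !(mulr_C r) mulr_Bl. Qed.
Lemma mulr_Zr r k s : mulr_ r (k *: s) = k *: mulr_ r s.
Proof. by rewrite !(mulr_C r) mulr_Zl. Qed.

Lemma mulr_Dl r s t : mulr_ (r + s) t = mulr_ r t + mulr_ s t.
Proof. by rewrite /mulr_ raddfD. Qed.
Lemma mulr_Dr r s t : mulr_ t (r + s) = mulr_ t r + mulr_ t s.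
Proof. by rewrite !(mulr_C t) mulr_Dl. Qed.

Lemma msumD M N : msum (M `+` N)%mset = msum M + msum N.
Proof.
rewrite /msum -big_cat; apply: perm_big; apply/allP => x _ /=.
by rewrite count_cat !count_mem_mset msetE2.
Qed.

Lemma mulr_A : associative mulr_.
Proof.
move=> r s t; move: r; apply: eq_lin_femb => [||k r|k r|x]; rewrite ?mulr_Zl //.
- exact: mulr_Bl.
- by move=> a b; rewrite !mulr_Bl.
move: s; apply: eq_lin_femb => [a b|a b|k r|k r|y]; rewrite ?mulr_Bl ?mulr_Br ?mulr_Bl //.
- by rewrite mulr_Zl mulr_Zr.
- by rewrite mulr_Zr mulr_Zl.
move: t; apply: eq_lin_femb => [a b|a b|k r|k r|z]; rewrite ?mulr_Br ?mulr_Br //.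
- by rewrite !mulr_Zr.
- by rewrite !mulr_Zr.
rewrite !mulr_fembE.
have [a [b xy]] := mset2P (tv_mul_size x y); have [c [d yz]] := mset2P (tv_mul_size y z).
rewrite /prb xy yz mulr_Zr mulr_Zl !msum2 mulr_Dl mulr_Dr !mulr_fembE /prb -!scalerDr -!msumD.
by congr (_ *: (_ *: msum _)); have := tv_mulA x y z; rewrite xy yz !big_mset2.
Qed.

Lemma mulr_1l : left_id oner_ mulr_.
Proof.
apply: eq_lin_femb => // [a b|k r|x]; rewrite ?mulr_Br ?mulr_Zr //.
rewrite mulr_fembE /prb tv_mul1x msum2.
by rewrite -mulr2n -scaler_nat scalerA mulVf ?scale1r.
Qed.

Lemma coeff_femb (t x : X) : coeff t (femb x) = (x == t)%:R.
Proof. by rewrite coeffU mul1r. Qed.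

Lemma oner_neq0_ : oner_ != 0.
Proof.
apply/eqP => /(congr1 (coeff (tv_one X))).
by rewrite coeff_femb coeff0 eqxx.
Qed.

HB.instance Definition _ := GRing.Zmodule_isComNzRing.Build fring
  mulr_A mulr_C mulr_1l mulr_Dl oner_neq0_.

Lemma fring_half (r : fring) : 2 * (2^-1 *: r) = r.
Proof. by rewrite -[2]/(1 + 1) mulrDl mul1r -mulr2n -scaler_nat scalerA mulfV ?scale1r. Qed.

Lemma fring_2I (r s : fring) : 2 * r = 2 * s -> r = s.
Proof.
rewrite -[2]/(1 + 1) !mulrDl !mul1r -!mulr2n -!scaler_nat => /(congr1 ( *:%R 2^-1)).
by rewrite !scalerA mulVf ?scale1r.
Qed.

Lemma mul_femb (x y a b : X) : tv_mul x y = [mset a; b] ->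
  2 * (femb x * femb y) = femb a + femb b.
Proof.
move=> E; rewrite -[X in 2 * X]/(mulr_ _ _) mulr_fembE /prb E msum2.
exact: fring_half.
Qed.

Lemma sum_femb_perm (s t : seq X) :
  \sum_(x <- s) femb x = \sum_(x <- t) femb x -> perm_eq s t.
Proof.
move=> E; apply/allP => x _ /=; apply/eqP.
have C u : coeff x (\sum_(x <- u) femb x) = (count_mem x u)%:R.
  elim: u => [|y u IH]; first by rewrite big_nil coeff0.
  by rewrite big_cons coeffD IH coeff_femb natrD.
by apply/eqP; rewrite -(eqr_nat rat) -!C E.
Qed.

Notation e := (tv_one X).
Definition sq_weight x : rat := coeff e (femb x * femb x).

(** The basis is orthogonal for the form [coeff e (r * s)]: by uniqueness of the inverse, e occurs
    in x * y only if y = x^-1 = x. *)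
Lemma coeff1_fembM x (r : fring) : coeff e (femb x * r) = sq_weight x * coeff x r.
Proof.
elim/femb_ind: r => [|k y r IH]; first by rewrite mulr0 !coeff0 mulr0.
rewrite mulrDr !coeffD IH mulrDr; congr (_ + _).
have -> : femb x * (k *: femb y) = k *: (femb x * femb y) by exact: mulr_Zr.
rewrite !coeffZ coeff_femb mulrC (mulrCA (sq_weight x)) [RHS]mulrC; congr (_ * _).
have [<-|yx] := eqVneq y x; first by rewrite mulr1.
have [a [b E]] := mset2P (tv_mul_size x y).
have E2 := congr1 (coeff e) (mul_femb E).
rewrite (mulr_natl _ 2) mulr2n !coeffD !coeff_femb in E2.
have N c : (c == a) || (c == b) -> (c == e) = false.
  move=> cab; apply: contraNF yx => /eqP ce; apply/eqP; rewrite -(ic_inv x).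
  by apply: tv_inv_uniq; left; rewrite E in_mset2 -ce.
move: E2; rewrite !N ?eqxx ?orbT // addr0 mulr0 => /eqP.
by rewrite -mulr2n mulrn_eq0 => /eqP.
Qed.

Lemma sq_weight_gt0 x : 0 < sq_weight x.
Proof.
have [a [b E]] := mset2P (tv_mul_size x x).
have E2 := congr1 (coeff e) (mul_femb E).
rewrite (mulr_natl _ 2) mulr2n !coeffD !coeff_femb -mulr2n in E2.
rewrite /sq_weight -(pmulrn_lgt0 _ (isT : 0 < 2)%N) E2.
have := tv_mulxV x; rewrite ic_inv E in_mset2 !(eq_sym e).
by case/orP => /eqP ->; rewrite eqxx; [rewrite ltr_wpDr|rewrite ltr_wpDl].
Qed.

(* The form [(r, s) |-> coeff e (r * s)] is diagonal and positive definite, which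
   is why the ring is reduced. *)
Lemma coeff1_mul (r s : fring) :
  coeff e (r * s) = \sum_(x <- dom r) sq_weight x * coeff x r * coeff x s.
Proof.
have E (D : seq X) (c : X -> rat) : coeff e ((\sum_(x <- D) << c x *g x >> : fring) * s)
    = \sum_(x <- D) sq_weight x * c x * coeff x s.
  elim: D => [|x D IH]; first by rewrite !big_nil mul0r coeff0.
  rewrite !big_cons mulrDl coeffD IH; congr (_ + _).
  rewrite freegUZ.
  have -> : (c x *: << 1 *g x >> : fring) * s = c x *: (femb x * s) by exact: mulr_Zl.
  by rewrite coeffZ coeff1_fembM mulrA (mulrC (c x)).
by rewrite -E freeg_sumE.
Qed.

Lemma fring_reduced (r : fring) : r * r = 0 -> r = 0.
Proof.
move=> E; apply/eqP; rewrite -dom_eq0.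
have := coeff1_mul r r; rewrite E coeff0 => /esym/eqP.
have F x : 0 <= sq_weight x * coeff x r * coeff x r.
  by rewrite -mulrA; apply: mulr_ge0; rewrite ?(ltW (sq_weight_gt0 x)) // -expr2 sqr_ge0.
rewrite psumr_eq0 // => /allP H; case D: (dom r) => [//|x l].
have xr : x \in dom r by rewrite D inE eqxx.
have := H x xr; rewrite /= -mulrA mulf_eq0 -expr2 sqrf_eq0 mem_dom in xr *.
by rewrite (negbTE xr) orbF gt_eqF ?sq_weight_gt0.
Qed.

End Ring.

(** The interface through which the sequel sees the ring. [rm_perm] is the independence of the
    basis, in the form in which multisets are read off from equations. *)
Record ring_model (X : icGroup) := RingModel {
  rm_ring : comNzRingType;
  rm_emb : X -> rm_ring;
  rm_emb1 : rm_emb (tv_one X) = 1;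
  rm_mul : forall x y a b, tv_mul x y = [mset a; b] ->
    2 * (rm_emb x * rm_emb y) = rm_emb a + rm_emb b;
  rm_perm : forall s t : seq X,
    \sum_(x <- s) rm_emb x = \sum_(x <- t) rm_emb x -> perm_eq s t;
  rm_2I : forall r s : rm_ring, 2 * r = 2 * s -> r = s;
  rm_reduced : forall r : rm_ring, r * r = 0 -> r = 0
}.

(* Opaque on purpose: the ring tactic is confused by the several convertible
   structures carried by the concrete type [fring X]. *)
Lemma free_ring_model (X : icGroup) : ring_model X.
Proof.
exact: (@RingModel X (fring X) (@femb X) erefl (@mul_femb X)
          (@sum_femb_perm X) (@fring_2I X) (@fring_reduced X)).
Qed.

Definition tvring (X : icGroup) : comNzRingType := rm_ring (free_ring_model X).
Definition emb (X : icGroup) : X -> tvring X := rm_emb (free_ring_model X).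

Notation "x %:b" := (emb x) (at level 2, left associativity, format "x %:b").

Section RingTheory.
Variable X : icGroup.
Implicit Types (x y z : X) (r : tvring X).

Lemma emb1 : (tv_one X)%:b = 1. Proof. exact: rm_emb1. Qed.

Lemma tvring_2I r s : 2 * r = 2 * s -> r = s.
Proof. exact: rm_2I. Qed.

Lemma tvring_reduced r : r * r = 0 -> r = 0.
Proof. exact: rm_reduced. Qed.

Lemma mul_emb x y a b : tv_mul x y = [mset a; b]%mset ->
  2 * (x%:b * y%:b) = a%:b + b%:b.
Proof. exact: rm_mul. Qed.

Lemma mul_ex x y : exists a b, tv_mul x y = [mset a; b]%mset.
Proof. exact: mset2P (tv_mul_size x y). Qed.

Definition esum (s : seq X) : tvring X := \sum_(x <- s) x%:b.

Lemma esum_perm s t : esum s = esum t -> perm_eq s t.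
Proof. exact: rm_perm. Qed.

Lemma esumE2 a b : esum [:: a; b] = a%:b + b%:b.
Proof. by rewrite /esum !big_cons big_nil addr0. Qed.

Lemma emb_inj : injective (@emb X).
Proof.
move=> x y E; have : perm_eq [:: x] [:: y] by apply: esum_perm; rewrite /esum !big_seq1.
by move/perm_mem/(_ x); rewrite !inE eqxx => /esym/eqP.
Qed.

Lemma emb2_inj (a b c d : X) : a%:b + b%:b = c%:b + d%:b ->
  (a = c /\ b = d) \/ (a = d /\ b = c).
Proof.
move=> E; apply: mset2_inj; have /esum_perm P : esum [:: a; b] = esum [:: c; d] by rewrite !esumE2.
rewrite -[LHS]seq_mset_id -[RHS]seq_mset_id; apply/eq_seq_msetP.
by rewrite (permPl (perm_mset2 a b)) perm_sym (permPl (perm_mset2 c d)) perm_sym.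
Qed.

Lemma embM_mset x y (a b : X) : 2 * (x%:b * y%:b) = a%:b + b%:b ->
  tv_mul x y = [mset a; b]%mset.
Proof.
have [c [d E]] := mul_ex x y; rewrite (mul_emb E) => /emb2_inj[] [<- <-] //.
by rewrite E mset2C.
Qed.

End RingTheory.

Lemma eq_addE (R : comNzRingType) (a b c d : R) : a = b -> c = d -> a + c = b + d.
Proof. by move=> -> ->. Qed.
Lemma eq_mulE (R : comNzRingType) (k a b : R) : a = b -> k * a = k * b.
Proof. by move=> ->. Qed.
(** Basis of the tactic [lc]: the goal is an explicit linear combination of known equations, written
    with [+e] and [*e], and [ring] checks this certificate. *)
Lemma eq_lc (R : comNzRingType) (a b c d : R) : c = d -> a - b = c - d -> a = b.
Proof. by move=> ->; rewrite subrr => /subr0_eq. Qed.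
Notation "H +e K" := (eq_addE H K) (at level 50, left associativity).
Notation "k *e H" := (eq_mulE k H) (at level 40, left associativity).
Tactic Notation "lc" uconstr(H) := refine (eq_lc H _); ring.

(** * Squares, lines x, y, z, and the action of the elements of order at most two *)

Section Basic.
Variable X : icGroup.
Implicit Types (x y z u v w b : X) (r s : tvring X).

Notation e := (tv_one X).

Lemma sq_ex x : exists y, tv_mul x x = [mset e; y].
Proof.
have [a [b E]] := mul_ex x x; have := tv_mulxV x; rewrite ic_inv E in_mset2.
by case/orP => /eqP <-; [exists b|exists a; rewrite mset2C].
Qed.

Definition sq x : X := sval (cid (sq_ex x)).

Lemma sq_mset x : tv_mul x x = [mset e; sq x].
Proof. exact: svalP (cid (sq_ex x)). Qed.

Lemma sqE x : (sq x)%:b = 2 * (x%:b * x%:b) - 1.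
Proof. by rewrite (mul_emb (sq_mset x)) emb1 addrC addKr. Qed.

Definition mem3 z x y := exists z', 2 * (x%:b * y%:b) = z%:b + z'%:b.

Lemma mem3P z x y : z \in tv_mul x y <-> mem3 z x y.
Proof.
have [a [b E]] := mul_ex x y; rewrite E in_mset2; split.
  case/orP => /eqP ->; [exists b|exists a]; rewrite (mul_emb E) //.
  by rewrite addrC.
case=> z'; rewrite (mul_emb E) => /emb2_inj[] [-> ->]; by rewrite eqxx ?orbT.
Qed.

Lemma mem3_ex x y : exists z, mem3 z x y.
Proof. by have [a [b E]] := mul_ex x y; exists a, b; apply: mul_emb. Qed.

Lemma mem3C z x y : mem3 z x y -> mem3 z y x.
Proof. by case=> z' E; exists z'; rewrite (mulrC y%:b). Qed.

Lemma mem3_one x y : mem3 e x y -> y = x.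
Proof.
by move/mem3P => H; rewrite -(ic_inv x); apply: tv_inv_uniq; left.
Qed.

(** Since e lies in z * z, it occurs in (x * y) * z = x * (y * z), hence in x * u for some u in y *
    z; then u = x by uniqueness of the inverse. *)
Lemma mem3_sym z x y : mem3 z x y -> mem3 x z y.
Proof.
case=> z' E; have [u [u' Eu]] := mul_ex y z.
have [a [b Ea]] := mul_ex z' z.
have [c [d Ec]] := mul_ex x u; have [c' [d' Ed]] := mul_ex x u'.
have /esum_perm P : esum [:: e; sq z; a; b] = esum [:: c; d; c'; d'].
  rewrite /esum !big_cons !big_nil sqE emb1.
  lc ((-1) *e mul_emb Ea +e mul_emb Ec +e mul_emb Ed +e (-2 * z%:b) *e E
      +e (2 * x%:b) *e mul_emb Eu).
have : e \in [:: c; d; c'; d'] by rewrite -(perm_mem P) !inE eqxx.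
have X1 c1 d1 u1 : tv_mul x u1 = [mset c1; d1] -> (e == c1) || (e == d1) -> u1 = x.
  by move=> E1 H; apply: mem3_one; apply/mem3P; rewrite E1 in_mset2.
rewrite !inE orbA => /orP[/(X1 _ _ _ Ec)|/(X1 _ _ _ Ed)] <-; apply/mem3P;
  by rewrite ic_mulC Eu in_mset2 eqxx ?orbT.
Qed.

Lemma mem3_sym2 z x y : mem3 z x y -> mem3 y x z.
Proof. by move=> H; apply/mem3C/mem3_sym/mem3C. Qed.

Definition isB b := b%:b * b%:b = 1.

Lemma isBP b : isB b <-> sq b = e.
Proof.
split => [E|E]; first by apply: emb_inj; rewrite sqE E emb1; ring.
apply: tvring_2I; have := sqE b; rewrite E emb1 => H; lc ((-1) *e H).
Qed.

Lemma isB1 : isB e. Proof. by rewrite /isB emb1 mulr1. Qed.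

(** All four entries of b * (b * x) are x, so b y = x for y in b * x, and multiplying by b gives y =
    b x. The implication sits inside the existential so that [act] is total. *)
Lemma act_ex b x : exists y, isB b -> y%:b = b%:b * x%:b.
Proof.
have [y [z /mul_emb E]] := mul_ex b x; exists y => Bb.
have [p [p' /mul_emb Ep]] := mul_ex b y; have [q [q' /mul_emb Eq]] := mul_ex b z.
have /esum_perm P : esum [:: p; p'; q; q'] = esum [:: x; x; x; x].
  rewrite /esum !big_cons !big_nil.
  lc ((-1) *e Ep +e (-1) *e Eq +e (-2 * b%:b) *e E +e (4 * x%:b) *e Bb).
have px t : t \in [:: p; p'; q; q'] -> t = x.
  by rewrite (perm_mem P) !inE !orbb => /eqP.
have Ex : p = x by apply: px; rewrite inE eqxx.
have Ex' : p' = x by apply: px; rewrite !inE eqxx orbT.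
rewrite Ex Ex' in Ep.
by apply: tvring_2I; lc (b%:b *e Ep +e (-2 * y%:b) *e Bb).
Qed.

Definition act b x : X := sval (cid (act_ex b x)).

Lemma actE b x : isB b -> (act b x)%:b = b%:b * x%:b.
Proof. exact: svalP (cid (act_ex b x)). Qed.

Lemma mem3_act b z x : isB b -> mem3 z b x -> z = act b x.
Proof.
move=> Bb [z' E]; have := E; rewrite -actE // => E'.
have /emb2_inj : (act b x)%:b + (act b x)%:b = z%:b + z'%:b by rewrite -E'; ring.
by case=> [] [].
Qed.

Lemma mem3_actE b z x : isB b -> mem3 z b x -> z%:b = b%:b * x%:b.
Proof. by move=> Bb /(mem3_act Bb) ->; apply: actE. Qed.

Lemma isBM b c a : isB b -> isB c -> a%:b = b%:b * c%:b -> isB a.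
Proof. by move=> Bb Bc E; rewrite /isB E; lc ((c%:b * c%:b) *e Bb +e 1 *e Bc). Qed.

Lemma isB_act b c : isB b -> isB c -> isB (act b c).
Proof. by move=> Bb Bc; apply: (isBM Bb Bc); apply: actE. Qed.

(** Multiplication by b fixes 2 x^2 = e + sq x, so it permutes e and sq x. *)
Lemma stabP b x : isB b -> b%:b * x%:b = x%:b -> b = e \/ b = sq x.
Proof.
move=> Bb E; have : (act b e)%:b + (act b (sq x))%:b = e%:b + (sq x)%:b.
  rewrite !actE // emb1 !sqE; lc ((2 * x%:b) *e E).
have -> : act b e = b by apply: emb_inj; rewrite actE // emb1 mulr1.
by case/emb2_inj => [] [-> _]; [left|right].
Qed.

Lemma sq_stab x : isB (sq x) -> (sq x)%:b * x%:b = x%:b.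
Proof.
move=> Bs; symmetry; apply: mem3_actE => //; apply: mem3_sym.
by exists e; rewrite sqE emb1; ring.
Qed.

Lemma sq_memB x y b : mem3 b x y -> isB b -> y%:b = b%:b * x%:b.
Proof. by move=> H Bb; apply: mem3_actE => //; apply: mem3C; apply: mem3_sym2. Qed.

Lemma sq_act b x y : isB b -> y%:b = b%:b * x%:b -> sq y = sq x.
Proof.
by move=> Bb E; apply: emb_inj; rewrite !sqE E; lc ((2 * x%:b * x%:b) *e Bb).
Qed.

End Basic.

(* Applied to the multisets of [square_relation]: the entries that occur an odd
   number of times have to match. *)
Lemma perm6_parity (T : eqType) (a b p p' q q' r r' : T) :
  perm_eq [:: a; a; b; b; p; p'] [:: q; q'; r; r; r'; r'] ->
  (perm_eq [:: p; p'] [:: q; q'] /\ perm_eq [:: a; b] [:: r; r']) \/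
  [/\ p = p', q = q', p != q &
    (q = a /\ perm_eq [:: b; p] [:: r; r']) \/ (q = b /\ perm_eq [:: a; p] [:: r; r'])].
Proof.
move/permP => P.
have C t : ((a == t) * 2 + (b == t) * 2 + (p == t) + (p' == t) =
            (q == t) + (q' == t) + (r == t) * 2 + (r' == t) * 2)%N.
  by have /= := P (pred1 t); lia.
have perm_of (s1 s2 : seq T) :
    (forall t, count_mem t s1 = count_mem t s2) -> perm_eq s1 s2.
  by move=> H; apply/allP => t _; apply/eqP.
have [pp'|pp'] := eqVneq p p'; last first.
  left; have Q : perm_eq [:: p; p'] [:: q; q'].
    have Cp := C p; have Cp' := C p'.
    rewrite eqxx [p' == p]eq_sym (negbTE pp') in Cp.
    rewrite eqxx (negbTE pp') in Cp'.
    have [qp|qp] := eqVneq q p.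
      have [q'p|q'p] := eqVneq q' p'; first by rewrite qp q'p.
      exfalso; move: Cp'; rewrite qp (negbTE pp') (negbTE q'p).
      by case: (a == p'); case: (b == p'); case: (r == p'); case: (r' == p').
    have [q'p|q'p] := eqVneq q' p; last first.
      exfalso; move: Cp; rewrite (negbTE qp) (negbTE q'p).
      by case: (a == p); case: (b == p); case: (r == p); case: (r' == p).
    have [qp'|qp'] := eqVneq q p'; first by rewrite qp' q'p (perm_catC [:: p] [:: p']).
    exfalso; move: Cp'; rewrite (negbTE qp') q'p (negbTE pp').
    by case: (a == p'); case: (b == p'); case: (r == p'); case: (r' == p').
  split=> //; apply: perm_of => t /=; have := C t.
  by have /permP/(_ (pred1 t)) /= := Q; clear; lia.
have qq' : q = q'.
  by apply/eqP; rewrite eq_sym; have := C q; rewrite -pp' eqxx; case: eqP => // _; lia.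
have [pq|pq] := eqVneq p q.
  left; split; first by rewrite -pp' -qq' pq.
  by apply: perm_of => t /=; have := C t; rewrite -pp' -qq' pq; lia.
right; split=> //.
have [qa|qa] := eqVneq q a.
  by left; split=> //; apply: perm_of => t /=; have := C t; rewrite -pp' -qq' qa; lia.
have [qb|qb] := eqVneq q b.
  by right; split=> //; apply: perm_of => t /=; have := C t; rewrite -pp' -qq' qb; lia.
exfalso; have := C q; rewrite -pp' -qq' eqxx (negbTE pq) eq_sym (negbTE qa).
by rewrite eq_sym (negbTE qb); lia.
Qed.

(** * The dichotomy between normal pairs and quaternionic triples *)

Section Normality.
Variable X : icGroup.
Implicit Types (x y z u v w b t p : X) (r s : tvring X).

Notation e := (tv_one X).

Definition normal_pair x y := forall z z',
  2 * (x%:b * y%:b) = z%:b + z'%:b -> 2 * (z%:b * z'%:b) = (sq x)%:b + (sq y)%:b.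

(** The relations between the classes {i,-i}, {j,-j}, {k,-k} of the quaternion group, with t =
    -1. *)
Definition quat_triple x y z t :=
  [/\ x%:b * y%:b = z%:b, [/\ sq x = t, sq y = t & sq z = t], isB t & t <> e].

Lemma mulE_ex x y : exists z z', 2 * (x%:b * y%:b) = z%:b + z'%:b :> tvring X.
Proof. by have [a [b /mul_emb E]] := mul_ex x y; exists a, b. Qed.

Lemma mem3_in z x y a b : mem3 z x y -> 2 * (x%:b * y%:b) = a%:b + b%:b -> z = a \/ z = b.
Proof. by case=> z' -> /emb2_inj [] [-> _]; [left|right]. Qed.

Lemma mem3_mull z x y a : mem3 z x y -> x%:b * y%:b = a%:b -> z = a.
Proof.
move=> zxy E; have E2 : 2 * (x%:b * y%:b) = a%:b + a%:b by rewrite E; ring.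
by case: (mem3_in zxy E2).
Qed.

Lemma mem3_l x y z z' : 2 * (x%:b * y%:b) = z%:b + z'%:b :> tvring X -> mem3 z x y.
Proof. by move=> E; exists z'. Qed.

Lemma mem3_r x y z z' : 2 * (x%:b * y%:b) = z%:b + z'%:b :> tvring X -> mem3 z' x y.
Proof. by move=> E; exists z; rewrite E addrC. Qed.

(** Square 2 x y = z + z' and replace each 2 u^2 by 1 + sq u. *)
Lemma square_relation x y z z' a a' p p' :
  2 * (x%:b * y%:b) = z%:b + z'%:b -> 2 * (z%:b * z'%:b) = a%:b + a'%:b ->
  2 * ((sq x)%:b * (sq y)%:b) = p%:b + p'%:b ->
  perm_eq [:: sq x; sq x; sq y; sq y; p; p'] [:: sq z; sq z'; a; a; a'; a'].
Proof.
move=> Ez Ea Ep; apply: esum_perm; rewrite /esum !big_cons !big_nil.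
rewrite !sqE in Ep *.
lc ((-1) *e Ep +e 2 *e Ea +e (2 * (2 * (x%:b * y%:b) + z%:b + z'%:b)) *e Ez).
Qed.

(** An entry of u * v with square e lies in B and carries u to v. If there is none, parity in
    [square_relation] makes the two entries a, b of u * v have the square sq u and puts e into a *
    b, so a = b. *)
Lemma sq_eqP u v : sq u = sq v ->
  (exists2 b, isB b & v%:b = b%:b * u%:b) \/
  [/\ isB (sq u), sq u <> e & exists2 a, u%:b * v%:b = a%:b & sq a = sq u].
Proof.
move=> suv; have [a [b Ea]] := mulE_ex u v; have [c [d Ec]] := mulE_ex a b.
have Es : 2 * ((sq u)%:b * (sq v)%:b) = e%:b + (sq (sq u))%:b.
  by rewrite -suv (sqE (sq u)) emb1; ring.
have Bcase x : mem3 x u v -> sq x = e -> exists2 b, isB b & v%:b = b%:b * u%:b.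
  by move=> xuv /isBP Bx; exists x => //; apply: sq_memB.
case/perm6_parity: (square_relation Ea Ec Es).
  case=> /perm2P [] [E _] _; left; apply: (Bcase _ _ (esym E)).
  - exact: mem3_l Ea.
  - exact: mem3_r Ea.
case=> E1 E2 E3 E4; right.
have Bt : isB (sq u) by apply/isBP.
have sa : sq a = sq u by case: E4 => [] [-> _].
have P : perm_eq [:: sq u; e] [:: c; d] by case: E4 => [] [_ H] //; rewrite suv.
have ab : b = a.
  by apply: mem3_one; case/perm2P: P => [] [_ ->]; [exact: mem3_r Ec | exact: mem3_l Ec].
split=> //; first by move=> H; case/eqP: E3; rewrite sa H.
by exists a => //; apply: tvring_2I; rewrite Ea ab; ring.
Qed.

Lemma normal_pairB x y : isB y -> normal_pair x y.
Proof.
move=> By z z' E.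
have zE : z%:b = y%:b * x%:b by apply: mem3_actE => //; apply: mem3C; exists z'.
have z'E : z'%:b = y%:b * x%:b by apply: mem3_actE => //; apply: mem3C; apply: mem3_r E.
by rewrite zE z'E !sqE; lc ((2 * x%:b * x%:b - 2) *e By).
Qed.

(** The exceptional branch of [perm6_parity] for [square_relation]: z and z' have the same square as
    x, so [sq_eqP] compares each of them with x. *)
Lemma normal_or_quat_aux x y z z' p :
  2 * (x%:b * y%:b) = z%:b + z'%:b -> sq z = sq x -> sq z' = sq x ->
  (sq x)%:b * (sq y)%:b = p%:b -> p <> sq x -> 2 * (z%:b * z'%:b) = (sq y)%:b + p%:b ->
  2 * (z%:b * z'%:b) = (sq x)%:b + (sq y)%:b \/ quat_triple x y z (sq x).
Proof.
move=> E sz sz' Ep px Ezz; set t := sq x in sz sz' Ep px *.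
have [By|nBy] := pselect (isB y); first by left; apply: (normal_pairB By E).
have half w : mem3 w x y -> sq w = t ->
    (isB t /\ quat_triple x y z t) \/
    (exists b, [/\ isB b, w%:b = b%:b * x%:b & y%:b = b%:b * t%:b]).
  move=> wxy sw; have ywx : mem3 y x w by exact: mem3_sym2.
  case: (sq_eqP (u := x) (v := w)) => [|[b Bb wE]|[Bt tn [a Ea sa]]]; first by rewrite sw.
    right; exists b; split=> //.
    have := mem3_in (a := b) (b := act b t) ywx.
    rewrite wE actE // sqE => /(_ _)[|yb|->]; [ring|by case: nBy; rewrite yb|].
    by rewrite actE // sqE.
  left; split=> //; have ya := mem3_mull ywx Ea; have sy : sq y = t by rewrite ya sa.
  have pe : p = e by apply: emb_inj; rewrite -Ep sy emb1.
  have zz' : z' = z by apply: mem3_one; exists (sq y); rewrite Ezz pe addrC.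
  split=> //; apply: tvring_2I; rewrite E zz'; ring.
case: (half z (mem3_l E) sz) => [[_]|[b [Bb zE yE]]]; first by right.
case: (half z' (mem3_r E) sz') => [[_]|[b' [Bb' z'E yE']]]; first by right.
have [Bt|nBt] := pselect (isB t); first by case: nBy; apply: isBM yE.
(* Here z = b x, z' = b' x and y = b t = b' t, so b b' fixes t and is e or sq t. The first value
   forces t into B, the second forces p = t; both are excluded. *)
have St : (act b b')%:b * t%:b = t%:b.
  by rewrite actE //; lc ((-1) * b%:b *e yE' +e b%:b *e yE +e t%:b *e Bb).
case: (stabP (isB_act Bb Bb') St) => [E1|E1].
  have bb' : b'%:b = b%:b.
    move: (actE b' Bb); rewrite E1 emb1 => E2; lc ((-1) * b%:b *e E2 +e (-1) * b'%:b *e Bb).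
  have zz' : z' = z by apply: emb_inj; rewrite zE z'E bb'.
  have /emb2_inj : (sq y)%:b + p%:b = e%:b + t%:b.
    by rewrite -Ezz zz' emb1 -sz sqE; ring.
  case=> [] [E2 E3] //; case: nBt; by move: Ep; rewrite E2 E3 emb1.
have Bs : isB (sq t) by rewrite -E1; apply: isB_act.
case: px; apply: emb_inj; rewrite -Ep (sq_act Bb yE) mulrC; exact: sq_stab.
Qed.

(** The regular branch of [perm6_parity] is normality; the exceptional one is [normal_or_quat_aux],
    applied to (x, y) or to (y, x). *)
Lemma normal_or_quat x y : normal_pair x y \/ exists z, quat_triple x y z (sq x).
Proof.
have [|NQ] := pselect (exists z, quat_triple x y z (sq x)); first by right.
left=> z z' Ez; have [a [a' Ea]] := mulE_ex z z'.
have [p [p' Ep]] := mulE_ex (sq x) (sq y).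
case/perm6_parity: (square_relation Ez Ea Ep) => [[_ P]|[E1 E2 E3]].
  by rewrite Ea; case/perm2P: P => [] [-> ->] //; rewrite addrC.
have Ep' : (sq x)%:b * (sq y)%:b = p%:b by apply: tvring_2I; rewrite Ep E1; ring.
have pz : p <> sq z by move=> pz; case/eqP: E3.
rewrite Ea => -[[Q P]|[Q P]].
  have Es : 2 * (z%:b * z'%:b) = (sq y)%:b + p%:b.
    by rewrite Ea; case/perm2P: P => [] [-> ->] //; rewrite addrC.
  rewrite Q in pz; rewrite -Ea.
  case: (normal_or_quat_aux Ez Q _ Ep' pz Es); rewrite -?E2 // => Qt.
  by case: NQ; exists z.
have Es : 2 * (z%:b * z'%:b) = (sq x)%:b + p%:b.
  by rewrite Ea; case/perm2P: P => [] [-> ->] //; rewrite addrC.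
have Ez' : 2 * (y%:b * x%:b) = z%:b + z'%:b by rewrite (mulrC y%:b).
rewrite Q in pz; rewrite -Ea; rewrite (mulrC (sq x)%:b) in Ep'.
case: (normal_or_quat_aux Ez' Q _ Ep' pz Es) => [|N|Qt].
- by rewrite -E2.
- by rewrite N addrC.
case: Qt => xy [s1 s2 s3] Bt tn; case: NQ; exists z.
by rewrite s2; split=> //; rewrite mulrC.
Qed.

Lemma normal_pair_sq x y z z' : normal_pair x y ->
  2 * (x%:b * y%:b) = z%:b + z'%:b ->
  2 * ((sq x)%:b * (sq y)%:b) = (sq z)%:b + (sq z')%:b.
Proof.
move=> N E; have := N _ _ E; rewrite !sqE => E'.
lc (2 * (2 * (x%:b * y%:b) + z%:b + z'%:b) *e E +e 2 *e E').
Qed.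

(** The pair is normal, as a quaternionic triple would need sq w = t. Since t x = x, multiplication
    by t permutes the two entries of x * w; if it fixed them, then t sq w = t and sq w = e. *)
Lemma quat_other x t w : sq x = t -> isB t -> t <> e -> sq w <> e -> sq w <> t ->
  exists2 a, 2 * (x%:b * w%:b) = a%:b + t%:b * a%:b & (sq a)%:b = t%:b * (sq w)%:b.
Proof.
move=> sx Bt tn wn wt; have [a [a' Ea]] := mulE_ex x w.
have N : normal_pair x w.
  case: (normal_or_quat x w) => [//|[z [_ [_ s2 _] _ _]]].
  by case: wt; rewrite s2 sx.
have tx : t%:b * x%:b = x%:b by rewrite -sx sq_stab // sx.
have Ta : (act t a)%:b + (act t a')%:b = a%:b + a'%:b.
  by rewrite !actE //; lc ((1 - t%:b) *e Ea +e 2 * w%:b *e tx).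
have E := N _ _ Ea; rewrite sx in E.
case/emb2_inj: Ta => [] [ta ta'].
  have : t%:b * a%:b = a%:b by rewrite -actE ?ta.
  case/(stabP Bt) => [//|sa].
  have : (act t (sq w))%:b + (act t (sq w))%:b = t%:b + (sq a')%:b.
    have E2 := normal_pair_sq N Ea; rewrite sx -sa in E2.
    by rewrite actE // -E2; ring.
  move=> H; have {H}tr : act t (sq w) = t by case/emb2_inj: H => [] [].
  case: wn; apply: emb_inj; move: (actE (sq w) Bt).
  by rewrite tr emb1 => H; lc ((-1) * t%:b *e H +e (1 - (sq w)%:b) *e Bt).
have a'E : a'%:b = t%:b * a%:b by rewrite -actE ?ta.
exists a; first by rewrite Ea a'E.
by rewrite sqE; lc (t%:b *e E +e (-2 * t%:b * a%:b) *e a'E +e (1 - 2 * a%:b * a%:b) *e Bt).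
Qed.

(** Expanding (x w)(y w) = z w^2 puts z into a * b, with a in x * w and b in y * w of equal square t
    sq w; [sq_eqP] then leaves few possibilities for a * b. *)
Lemma quat_sqB x y z t w : quat_triple x y z t -> sq w <> e -> sq w <> t ->
  exists2 b, isB b & z%:b = b%:b * (sq w)%:b.
Proof.
case=> xy [sx sy sz] Bt tn wn wt.
have [a Ea sa] := quat_other sx Bt tn wn wt.
have [b Eb sb] := quat_other sy Bt tn wn wt.
have tz : t%:b * z%:b = z%:b by rewrite -sz sq_stab // sz.
have [m [m' Em]] := mulE_ex a b; have [n [n' En]] := mulE_ex z (sq w).
have /esum_perm P : esum [:: z; z; n; n'] = esum [:: m; act t m; m'; act t m'].
  rewrite /esum !big_cons !big_nil !actE //.
  have Ew := sqE w.
  lc ((-1) *e En +e (1 + t%:b) *e Em +e (2 * z%:b) *e Ew +e (-4 * w%:b * w%:b) *e xy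
     +e 2 * y%:b * w%:b *e Ea +e (1 + t%:b) * a%:b *e Eb +e (a%:b * b%:b) *e Bt).
have tI c : z = act t c -> z = c.
  by move=> zc; apply: emb_inj; rewrite -tz zc actE //; lc (c%:b *e Bt).
have zab : mem3 z a b.
  have : z \in [:: m; act t m; m'; act t m'] by rewrite -(perm_mem P) inE eqxx.
  by rewrite !inE => /or4P[] /eqP => [->|/tI->|->|/tI->];
    [exact: mem3_l Em|exact: mem3_l Em|exact: mem3_r Em|exact: mem3_r Em].
have sab : sq a = sq b by apply: emb_inj; rewrite sa sb.
case: (sq_eqP sab) => [[c Bc bE]|[_ _ [d abd sd]]].
  have Eab : 2 * (a%:b * b%:b) = c%:b + (act c (sq a))%:b.
    by rewrite actE // sqE bE; ring.
  case: (mem3_in zab Eab) => [zc|->].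
    case: tn; rewrite -sz; apply/isBP; rewrite zc //.
  exists (act c t); first exact: isB_act.
  by rewrite !actE // sa mulrA.
exfalso; move: sa; rewrite -sd -(mem3_mull zab abd) sz => tr.
apply: wn; apply: emb_inj; rewrite emb1; lc ((-1) * t%:b *e tr +e (1 - (sq w)%:b) *e Bt).
Qed.

(** Another square sq w would put z, and by symmetry y, into B sq w. Then z = b c y with b, c in B,
    and x = y z = b c y^2 would force x into B. *)
Lemma quat_sq x y z t : quat_triple x y z t -> forall w, sq w = e \/ sq w = t.
Proof.
move=> Q w; have [|wn] := pselect (sq w = e); first by left.
have [|wt] := pselect (sq w = t); first by right.
have [b Bb zE] := quat_sqB Q wn wt.
case: Q => xy [sx sy sz] Bt tn.
have tyy : t%:b * y%:b = y%:b by rewrite -sy sq_stab // sy.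
have Q' : quat_triple x z y t.
  split=> //; have Ex := sqE x; rewrite sx in Ex; apply: tvring_2I.
  by lc ((-2) * x%:b *e xy +e (- y%:b) *e Ex +e 1 *e tyy).
have [c Bc yE] := quat_sqB Q' wn wt.
exfalso; apply: tn; rewrite -sx; apply/isBP.
have E : x%:b + x%:b = (act b c)%:b + (act (act b c) t)%:b.
  have Ey := sqE y; rewrite sy in Ey.
  have tx : t%:b * x%:b = x%:b by rewrite -sx sq_stab // sx.
  rewrite !actE //; last exact: isB_act.
  have zy : z%:b = b%:b * c%:b * y%:b.
    by rewrite yE zE; lc ((- b%:b * (sq w)%:b) *e Bc).
  lc ((-1) *e tx +e x%:b *e Ey +e (2 * y%:b) *e xy +e 2 * y%:b *e zy +e (- b%:b * c%:b) *e Ey).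
case/emb2_inj: E => [] [-> _]; first exact: isB_act.
by apply: isB_act => //; apply: isB_act.
Qed.

End Normality.

(** * Coset models *)

(** Allows a group to be assembled inside a proof from operations obtained there by choice. *)
Record abelian_data := AbelianData {
  ad_T : choiceType;
  ad_mul : ad_T -> ad_T -> ad_T;
  ad_one : ad_T;
  ad_inv : ad_T -> ad_T;
  ad_mulA : associative ad_mul;
  ad_mulC : commutative ad_mul;
  ad_mul1 : left_id ad_one ad_mul;
  ad_mulV : left_inverse ad_one ad_inv ad_mul
}.

Section AbelianOf.
Variable D : abelian_data.

Definition ad_sort : Type := ad_T D.
HB.instance Definition _ := Choice.on ad_sort.

Fact ad_mulr1 : right_id (ad_one D) (@ad_mul D).
Proof. by move=> x; rewrite ad_mulC ad_mul1. Qed.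
Fact ad_mulrV : right_inverse (ad_one D) (@ad_inv D) (@ad_mul D).
Proof. by move=> x; rewrite ad_mulC ad_mulV. Qed.

HB.instance Definition _ :=
  isGroup.Build ad_sort (@ad_mulA D) (@ad_mul1 D) ad_mulr1 (@ad_mulV D) ad_mulrV.

Definition abelian_of : abelianGroup := @AbelianGroup ad_sort (@ad_mulC D).

End AbelianOf.

Definition coset_model (X : twoValuedGroup) (G : groupType) (iota : G -> G)
    (p : G -> X) : Prop :=
  [/\ forall x, exists a, p a = x,
      forall a b, p a = p b <-> b = a \/ b = iota a &
      forall a b, tv_mul (p a) (p b) = [mset p (a * b)%g; p (a * iota b)%g]].

Lemma coset_model_iso (X : twoValuedGroup) (G : groupType) (iota : G -> G)
    (iotaM : {morph iota : g h / (g * h)%g}) (iotaK : involutive iota) (p : G -> X) :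
  coset_model iota p -> tv_isomorphic X (cosetTV iotaM iotaK).
Proof.
case=> p_surj p_eq pM.
pose lift x := sval (cid (p_surj x)); have liftK x : p (lift x) = x by exact: svalP (cid (p_surj x)).
pose f (x : X) : cosetTV iotaM iotaK := orbit_proj iotaK (lift x).
have fp a : f (p a) = orbit_proj iotaK a by apply/orbit_projP/p_eq; rewrite liftK.
exists f; split.
  exists (fun o => p (orbit_repr o)) => [x|o].
    by rewrite -{2}[x]liftK; apply/p_eq; case: (orbit_reprP iotaK (lift x)) => ->;
      [left|right; rewrite iotaK].
  by rewrite fp orbit_reprK.
move=> x y z1 z2; rewrite -(liftK x) -(liftK y) pM !fp => /mset2_inj H.
by rewrite /= (coset_mulE iotaM); case: H => [] [<- <-]; rewrite !fp // mset2C.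
Qed.

(** * Reconstruction of the covering group from the addition formulas *)

Section Reconstruction.
Variable X : icGroup.
Implicit Types (x y z u v w b t p : X).
Variables (g : X) (sigma : tvring X).

Notation e := (tv_one X).
Local Notation G := (1 - g%:b * g%:b).

(* The pair (y, z) encodes the element a of the sought group with y = [a] and
   z = [g a]; its "sine" z - g y recovers a up to the factor sin g. *)
Definition edge (P : X * X) : Prop := mem3 P.2 g P.1.

(* The addition formulas for cosine and sine, [sigma] being [-1] in the abelian
   case and [1] in the Boolean one; the first is multiplied by [G = sin^2 g]. *)
Definition edge_law (P Q R : X * X) : Prop :=
  G * R.1%:b = G * (P.1%:b * Q.1%:b)
     + sigma * ((P.2%:b - g%:b * P.1%:b) * (Q.2%:b - g%:b * Q.1%:b)) /\
  R.2%:b - g%:b * R.1%:b = P.1%:b * (Q.2%:b - g%:b * Q.1%:b)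
     + Q.1%:b * (P.2%:b - g%:b * P.1%:b).

Hypothesis edge_inj : forall P Q, edge P -> edge Q ->
  G * P.1%:b = G * Q.1%:b -> G * P.2%:b = G * Q.2%:b -> P = Q.

Hypothesis normal_g : forall y, normal_pair g y.

(** For sigma = 1 the extra condition is the vanishing of the double-angle sine 2 cos a sin a, which
    makes a its own inverse. *)
Hypothesis sigma_cases : sigma = -1 \/
  sigma = 1 /\ forall P, edge P -> P.1%:b * (P.2%:b - g%:b * P.1%:b) = 0.

(** Q' stands for iota b when Q stands for b. Besides the existence of products, this says that ab
    and a iota(b) lie over the two entries of [a] * [b]. *)
Hypothesis edge_law_ex : forall P Q Q', edge P -> edge Q -> edge Q' ->
  Q'.1 = Q.1 -> 2 * (g%:b * Q.1%:b) = Q.2%:b + Q'.2%:b ->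
  exists R R', [/\ edge R, edge R', 2 * (P.1%:b * Q.1%:b) = R.1%:b + R'.1%:b,
    edge_law P Q R & edge_law P Q' R'].

Lemma edge_sine P : edge P ->
  (P.2%:b - g%:b * P.1%:b) * (P.2%:b - g%:b * P.1%:b) = G * (1 - P.1%:b * P.1%:b).
Proof.
case=> z' E; have := normal_g E; rewrite !sqE => E'; apply: tvring_2I.
lc ((-2 * P.2%:b) *e E +e (-1) *e E').
Qed.

Lemma edge_law_uniq P Q R R' : edge R -> edge R' ->
  edge_law P Q R -> edge_law P Q R' -> R = R'.
Proof.
move=> eR eR' [E1 E2] [F1 F2]; apply: edge_inj => //; first by rewrite E1 F1.
have E : R.2%:b - g%:b * R.1%:b = R'.2%:b - g%:b * R'.1%:b by rewrite E2 F2.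
have F : G * R.1%:b = G * R'.1%:b by rewrite E1 F1.
lc (G *e E +e g%:b *e F).
Qed.

Let T : choiceType := {P : X * X | `[< edge P >]}.
Let edgeT (P : T) : edge (val P). Proof. by apply/asboolP; case: P. Qed.
Let Tof (P : X * X) (eP : edge P) : T := exist _ P (asboolT eP).

Lemma Tconj_ex (P : T) : exists Q : T,
  (val Q).1 = (val P).1 /\
  2 * (g%:b * (val P).1%:b) = (val P).2%:b + (val Q).2%:b.
Proof.
have [z' E] := edgeT P; have eQ : edge ((val P).1, z') by apply: mem3_r E.
by exists (Tof eQ).
Qed.
Let conj P : T := sval (cid (Tconj_ex P)).
Let conj1 P : (val (conj P)).1 = (val P).1.
Proof. by case: (svalP (cid (Tconj_ex P))). Qed.
Let conj2 P : 2 * (g%:b * (val P).1%:b) = (val P).2%:b + (val (conj P)).2%:b.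
Proof. by case: (svalP (cid (Tconj_ex P))). Qed.

Lemma Tmul_ex (P Q : T) : exists R : T, edge_law (val P) (val Q) (val R).
Proof.
have [R [R' [eR _ _ H _]]] :=
  edge_law_ex (edgeT P) (edgeT Q) (edgeT (conj Q)) (conj1 Q) (conj2 Q).
by exists (Tof eR).
Qed.
Let mul P Q : T := sval (cid (Tmul_ex P Q)).
Let mulP P Q : edge_law (val P) (val Q) (val (mul P Q)).
Proof. exact: svalP (cid (Tmul_ex P Q)). Qed.

Let mul_uniq P Q R : edge_law (val P) (val Q) (val R) -> mul P Q = R.
Proof. by move=> H; apply: val_inj; apply: edge_law_uniq (mulP P Q) H => //; apply: edgeT. Qed.

Let one_edge : edge (e, g). Proof. by exists g; rewrite emb1; ring. Qed.
Let one : T := Tof one_edge.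
Let inv P : T := if `[< sigma = -1 >] then conj P else P.

Let mulC : commutative mul.
Proof.
move=> P Q; apply: mul_uniq; have [E1 E2] := mulP Q P.
by split; [rewrite E1|rewrite E2]; ring.
Qed.

Let mul1 : left_id one mul.
Proof. by move=> P; apply: mul_uniq; split; rewrite /= emb1; ring. Qed.

Let mulV : left_inverse one inv mul.
Proof.
move=> P; have sP := edge_sine (edgeT P); rewrite mulC; apply: mul_uniq.
rewrite /edge_law /inv; case: asboolP => [->|sN] /=.
  rewrite conj1; have E := conj2 P; rewrite emb1; split; last first.
    by lc ((val P).1%:b *e E).
  by lc ((-1) *e sP +e (g%:b * (val P).1%:b - (val P).2%:b) *e E).
case: sigma_cases => [//|[-> Z]]; rewrite emb1; split.
  by lc ((-1) *e sP).
by have E := Z _ (edgeT P); lc ((-2) *e E).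
Qed.

Let mulA : associative mul.
Proof.
(* Addition formulas are associative: after multiplication by G, each coordinate follows from the
   laws for P Q and Q R. *)
move=> P Q R; apply: val_inj; apply: edge_inj; try exact: edgeT.
  have [E1 E2] := mulP P (mul Q R); have [F1 F2] := mulP (mul P Q) R.
  have [A1 A2] := mulP P Q; have [B1 B2] := mulP Q R.
  rewrite E1 F1 A2 B2.
  lc ((val P).1%:b *e B1 +e (- (val R).1%:b) *e A1).
have [E1 E2] := mulP P (mul Q R); have [F1 F2] := mulP (mul P Q) R.
have [A1 A2] := mulP P Q; have [B1 B2] := mulP Q R.
set p := (val (mul P (mul Q R))) in E1 E2 *; set q := (val (mul (mul P Q) R)) in F1 F2 *.
rewrite A2 in F1 F2; rewrite B2 in E1 E2.
lc (G *e E2 +e (- G) *e F2 +e g%:b *e E1 +e (- g%:b) *e F1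
   +e ((val P).2%:b - g%:b * (val P).1%:b + g%:b * (val P).1%:b) *e B1
   +e (- ((val R).2%:b - g%:b * (val R).1%:b) - g%:b * (val R).1%:b) *e A1).
Qed.

Let A : abelianGroup := abelian_of (AbelianData mulA mulC mul1 mulV).
Let p (a : A) : X := (val (a : T)).1.
Let iota (a : A) : A := conj a.

Let conjE (P Q : T) : (val Q).1 = (val P).1 ->
  2 * (g%:b * (val P).1%:b) = (val P).2%:b + (val Q).2%:b -> Q = conj P.
Proof.
move=> E1 E2; apply: val_inj; move: (conj1 P) (conj2 P) E1 E2.
case: (val Q) (val (conj P)) => [a b] [c d] /= -> -> -> /addrI/emb_inj -> //.
Qed.

Let conjK : involutive conj.
Proof. by move=> P; symmetry; apply: conjE; rewrite ?conj1 // addrC. Qed.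

Let conjS P : (val (conj P)).2%:b = 2 * (g%:b * (val P).1%:b) - (val P).2%:b.
Proof. by rewrite conj2 addrC addKr. Qed.

(** The group is the set of edges, p the first projection, and iota exchanges the two edges (y,
    [g a]) and (y, [g iota a]) over the same y. *)
Lemma reconstruction : exists (A : abelianGroup) (iota : A -> A) (p : A -> X),
  [/\ {morph iota : a b / (a * b)%g}, involutive iota, coset_model iota p,
      sigma = -1 -> forall a : A, iota a = (a^-1)%g &
      sigma <> -1 -> forall a : A, (a * a = 1)%g].
Proof.
exists A, iota, p; split.
- move=> P Q; symmetry; apply: mul_uniq; have [E1 E2] := mulP P Q.
  split; rewrite !conjS !conj1; last by lc ((-1) *e E2).
  by rewrite E1; ring.
- exact: conjK.
- split.
  + by move=> x; have [z xz] := mem3_ex g x; exists (Tof (P := (x, z)) xz).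
  + move=> P Q; split; last by case=> ->; rewrite /p ?conj1.
    rewrite /p => PQ; have := edgeT Q; rewrite /edge -PQ => /mem3_in/(_ (conj2 P)).
    move=> H; case: H => H; [left|right]; apply: val_inj; last first.
      by move: (conj1 P) H; rewrite PQ /iota; case: (val Q) (val (conj P)) => [? ?] [? ?] /= -> ->.
    by move: PQ H; case: (val Q) (val P) => [? ?] [? ?] /= -> ->.
  + move=> P Q; apply: embM_mset.
    have [R [R' [eR eR' -> L L']]] :=
      edge_law_ex (edgeT P) (edgeT Q) (edgeT (conj Q)) (conj1 Q) (conj2 Q).
    congr (_ + _); rewrite /p.
      by rewrite -[R]/(val (Tof eR)) -(mul_uniq (R := Tof eR) L).
    by rewrite -[R']/(val (Tof eR')) -(mul_uniq (R := Tof eR') L').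
- by move=> s P; rewrite -[(_^-1)%g]/(inv P) /inv asboolT.
- move=> s P; rewrite -{2}[P]/(if false then conj P else P).
  have := mulV P; rewrite /inv; case: asboolP => //.
Qed.

End Reconstruction.

(** * An element whose square has order greater than two *)

Lemma int_shift_const (T : Type) (h : int -> T) :
  (forall i, h (i + 1) = h i) -> forall i j, h i = h j.
Proof.
move=> H; have H0 i : h i = h 0.
  elim: i => [//|n IH|n IH]; first by rewrite -IH -(H n%:Z); congr h; lia.
  by rewrite -IH -(H (- n.+1%:Z)); congr h; lia.
by move=> i j; rewrite (H0 i) (H0 j).
Qed.

Section NormalTheory.
Variable X : icGroup.
Implicit Types (x y z u v w b t p : X).
Hypothesis normalX : forall x y : X, normal_pair x y.

Notation e := (tv_one X).

Lemma normal_sq_eq u v : sq u = sq v -> exists2 b, isB b & v%:b = b%:b * u%:b.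
Proof.
move=> suv; case: (sq_eqP suv) => [//|[Bt tn [a uva sa]]]; case: tn.
have E2 : 2 * (u%:b * v%:b) = a%:b + a%:b by rewrite uva; ring.
have := normalX E2; rewrite -suv => E3; apply: emb_inj.
by have := sqE a; rewrite sa emb1 => E4; lc ((-1) *e E4 +e (-1) *e E3).
Qed.

Lemma sine_sq x y z z' : 2 * (x%:b * y%:b) = z%:b + z'%:b ->
  (z%:b - z'%:b) * (z%:b - z'%:b) = 4 * ((1 - x%:b * x%:b) * (1 - y%:b * y%:b)).
Proof.
move=> E; have := normalX E; rewrite !sqE => E'.
lc ((-1) * (2 * (x%:b * y%:b) + z%:b + z'%:b) *e E +e (-2) *e E').
Qed.

Lemma mem3_pair x y z z' : mem3 z x y -> mem3 z' x y -> z <> z' ->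
  2 * (x%:b * y%:b) = z%:b + z'%:b.
Proof. by move=> [w E] /mem3_in/(_ E) [->//|->]. Qed.

Variable g : X.
Hypothesis gamma_nB : ~ isB (sq g).
Local Notation gamma := (sq g).

Lemma gamma_single x y : gamma%:b * x%:b = y%:b -> isB x.
Proof.
move=> E; have E2 : 2 * (gamma%:b * x%:b) = y%:b + y%:b by rewrite E; ring.
have := normalX E2 => E3.
have /emb2_inj : e%:b + (sq y)%:b = (sq gamma)%:b + (sq x)%:b.
  by rewrite -E3 (sqE y) emb1; ring.
by case=> [] [E4 E5]; [case: gamma_nB|]; apply/isBP.
Qed.

(** In [x, x] + gamma * y = [y, y] + gamma * x with x <> y, both entries of gamma * x must be x.
    Then x lies in B, and normality gives sq gamma = e. *)
Lemma cogamma_inj x y : (1 - gamma%:b) * x%:b = (1 - gamma%:b) * y%:b -> x = y.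
Proof.
move=> E; have [m [m' Em]] := mulE_ex gamma x; have [n [n' En]] := mulE_ex gamma y.
have [//|nxy] := pselect (x = y); exfalso.
have /esum_perm P : esum [:: x; x; n; n'] = esum [:: y; y; m; m'].
  by rewrite /esum !big_cons !big_nil; lc (2 *e E +e (-1) *e En +e Em).
have xy : (x == y) = false by apply/eqP.
have /permP/(_ (pred1 x)) /= := P; rewrite eqxx (eq_sym y) xy /= => C.
have [mx m'x] : m = x /\ m' = x.
  by move: C; case: (m =P x); case: (m' =P x) => //=; lia.
move: (Em); rewrite mx m'x => Ex.
have Bx : isB x by apply: (gamma_single (y := x)); apply: tvring_2I; rewrite Ex; ring.
apply: gamma_nB; have := normalX Ex => E3.
by move/isBP: Bx => Bx; apply/isBP; apply: emb_inj; move: E3; rewrite Bx emb1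
  => E3; have := sqE x; rewrite Bx emb1 => E4; lc ((-1) *e E3 +e (-1) *e E4).
Qed.

(** If g * x = g * x' = [p, p'] with x <> x', then x' = b x, and normality of (g, p) and (g, p')
    gives sq p = sq p' = b. So p' = c p with c in B, both entries of p * p' lie in B, yet gamma is
    one of them. *)
Lemma mul_g_inj x x' : g%:b * x%:b = g%:b * x'%:b -> x = x'.
Proof.
move=> E; have [//|nx] := pselect (x = x'); exfalso.
have [p [p' Ep]] := mulE_ex g x.
have Ep' : 2 * (g%:b * x'%:b) = p%:b + p'%:b by rewrite -E.
have sx : sq x = sq x'.
  by apply: emb_inj; apply: (addrI gamma%:b); rewrite -(normalX Ep) -(normalX Ep').
have [b Bb x'E] := normal_sq_eq sx.
have nb c : isB c -> gamma <> c by move=> Bc H; apply: gamma_nB; rewrite H.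
have sqb q : mem3 q g x -> mem3 q g x' -> gamma = act b (sq x) /\ sq q = b.
  move=> /mem3_sym2/mem3C qx /mem3_sym2/mem3C qx'.
  have := normalX (mem3_pair (mem3C qx) (mem3C qx') nx).
  have -> : 2 * (x%:b * x'%:b) = b%:b + (act b (sq x))%:b.
    by rewrite actE // sqE x'E; ring.
  by case/emb2_inj => [] [H1 H2] //; case: (nb b).
have [gE sp] := sqb p (mem3_l Ep) (mem3_l Ep').
have [_ sp'] := sqb p' (mem3_r Ep) (mem3_r Ep').
have [c Bc p'E] : exists2 c, isB c & p'%:b = c%:b * p%:b.
  by apply: normal_sq_eq; rewrite sp sp'.
have : c%:b + (act c b)%:b = gamma%:b + (sq x)%:b.
  rewrite -(normalX Ep) p'E actE // -sp sqE; ring.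
by case/emb2_inj => [] [H1 H2]; [case: (nb c)|case: (nb (act c b))] => //; apply: isB_act.
Qed.

(* The classes [Y i = [g^i a]] for a fixed [a]. *)
Definition g_string (Y : int -> X) :=
  forall i, 2 * (g%:b * (Y i)%:b) = (Y (i + 1))%:b + (Y (i - 1))%:b.

Lemma g_stringE Y i j k : g_string Y -> j = i + 1 -> k = i - 1 ->
  2 * (g%:b * (Y i)%:b) = (Y j)%:b + (Y k)%:b.
Proof. by move=> sY -> ->. Qed.

Lemma g_string_ex y z : mem3 z g y -> exists Y, [/\ g_string Y, Y 0 = y & Y 1 = z].
Proof.
have other_ex (P : X * X) : exists w, mem3 P.2 g P.1 ->
    2 * (g%:b * P.2%:b) = P.1%:b + w%:b.
  have [H|H] := pselect (mem3 P.2 g P.1); last by exists P.1.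
  by have [w Ew] := mem3_sym2 H; exists w.
have [nxt nxtP] : exists nxt : X * X -> X * X, forall P, (nxt P).1 = P.2 /\
    (mem3 P.2 g P.1 -> 2 * (g%:b * P.2%:b) = P.1%:b + (nxt P).2%:b).
  exists (fun P => (P.2, sval (cid (other_ex P)))) => P; split=> //.
  exact: svalP (cid (other_ex P)).
have nxt1 P : (nxt P).1 = P.2 by case: (nxtP P).
have nxtE P : mem3 P.2 g P.1 -> 2 * (g%:b * P.2%:b) = P.1%:b + (nxt P).2%:b.
  by case: (nxtP P).
have nxt_mem P : mem3 P.2 g P.1 -> mem3 (nxt P).2 g (nxt P).1.
  by move=> H; rewrite nxt1; apply: mem3_r (nxtE P H).
move=> zgy; pose F n := iter n nxt (y, z); pose H n := iter n nxt (z, y).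
have mF n : mem3 (F n).2 g (F n).1 by elim: n => [//|n IH]; apply: nxt_mem.
have mH n : mem3 (H n).2 g (H n).1.
  elim: n => [/=|n IH]; last exact: nxt_mem.
  exact: mem3_sym2.
have F1 n : (F n.+1).1 = (F n).2 by rewrite -nxt1.
have H1 n : (H n.+1).1 = (H n).2 by rewrite -nxt1.
(* (F n).1 is the term at n and (H n).2 the term at -n; [Negz n] is -(n+1), whence the successor. *)
exists (fun i => match i with Posz n => (F n).1 | Negz n => (H n.+1).2 end); split=> //; last exact: F1.
move=> [n|n].
- have -> : n%:Z + 1 = n.+1%:Z by lia.
  case: n => [|n].
    have -> : 0%N%:Z - 1 = Negz 0 by [].
    by rewrite F1; apply: (nxtE _ (mH 0%N)).
  have -> : n.+1%:Z - 1 = n%:Z by lia.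
  by rewrite addrC !F1; apply: (nxtE _ (mF n)).
- have -> : Negz n - 1 = Negz n.+1 by lia.
  case: n => [|n].
    have -> : Negz 0 + 1 = 0%N%:Z by lia.
    by have := nxtE _ (mH 1%N); rewrite H1.
  have -> : Negz n.+1 + 1 = Negz n by lia.
  by have := nxtE _ (mH n.+2); rewrite H1.
Qed.

Lemma g_string_shift Y k : g_string Y -> g_string (fun i => Y (i + k)).
Proof. by move=> sY i; apply: (g_stringE sY); lia. Qed.

Lemma g_string_opp Y : g_string Y -> g_string (fun i => Y (- i)).
Proof. by move=> sY i; rewrite (addrC (Y _)%:b); apply: (g_stringE sY); lia. Qed.

Lemma gamma_string Y i j k : g_string Y -> j = i + 2 -> k = i - 2 ->
  2 * (gamma%:b * (Y i)%:b) = (Y j)%:b + (Y k)%:b.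
Proof.
move=> sY -> ->; rewrite sqE.
have E0 := sY i; have E1 := g_stringE (i := i + 1) (j := i + 2) (k := i) sY.
have E2 := g_stringE (i := i - 1) (j := i) (k := i - 2) sY.
by lc ((2 * g%:b) *e E0 +e E1 ltac:(lia) ltac:(lia) +e E2 ltac:(lia) ltac:(lia)).
Qed.

(** With Y (i+2) = b Y i, normality identifies [gamma, sq (Y (i+1))] with [b, b sq (Y i)]; gamma
    cannot be b. *)
Lemma string_period Y i : g_string Y -> sq (Y i) = sq (Y (i + 2)) -> isB (sq (Y (i + 1))).
Proof.
move=> sY /normal_sq_eq [b Bb YE].
have E := g_stringE (i := i + 1) (j := i + 2) (k := i) sY.
have {E} E : 2 * (g%:b * (Y (i + 1))%:b) = (Y (i + 2))%:b + (Y i)%:b by apply: E; lia.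
have : b%:b + (act b (sq (Y i)))%:b = gamma%:b + (sq (Y (i + 1)))%:b.
  by rewrite -(normalX E) actE // YE sqE; ring.
by case/emb2_inj => [] [H1 H2]; [case: gamma_nB|]; rewrite -?H1 -?H2.
Qed.

(* The product of the classes of [g^(p+q) a] and [g^(p-q) b], expected to be
   [phi p + chi q] with [phi p = [g^(2p) a b]] and [chi q = [g^(2q) a b^-1]]. *)
Definition wave Y U (p q : int) : tvring X := 2 * ((Y (p + q))%:b * (U (p - q))%:b).

(** By normality a product determines the unordered pair of squares of its factors. Constancy in p
    then gives Y period two on squares, and [string_period] leads to gamma in B. *)
Lemma wave_nonconst Y U : g_string Y -> g_string U ->
  ~ (forall p p' q : int, wave Y U p q = wave Y U p' q).
Proof.
move=> sY sU H.
have S i j k l (p p' q : int) : i = p + q -> j = p - q -> k = p' + q -> l = p' - q ->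
    (sq (Y i))%:b + (sq (U j))%:b = (sq (Y k))%:b + (sq (U l))%:b.
  move=> -> -> -> ->; have E := H p p' q; rewrite /wave in E.
  have [a [b Ea]] := mulE_ex (Y (p + q)) (U (p - q)).
  by rewrite -(normalX Ea); rewrite E in Ea; rewrite -(normalX Ea).
have P i : sq (Y i) = sq (Y (i + 2)).
  have E1 : (sq (Y i))%:b + (sq (U i))%:b = (sq (Y (i + 2)))%:b + (sq (U (i + 2)))%:b.
    by apply: (S _ _ _ _ i (i + 2) 0); lia.
  have E2 : (sq (Y (i + 2)))%:b + (sq (U i))%:b = (sq (Y i))%:b + (sq (U (i - 2)))%:b.
    by apply: (S _ _ _ _ (i + 1) (i - 1) 1); lia.
  case/emb2_inj: E1 => [] [] // E3 E4; move: E2; rewrite E4.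
  by case/emb2_inj => [] [] // _ ->.
have B1 := string_period sY (P 0); have := normal_sq_eq (P 1).
have E := g_stringE (i := 2) (j := 1 + 2) (k := 1) sY.
case=> b Bb YE; have {E} E : 2 * (g%:b * (Y 2)%:b) = (Y (1 + 2))%:b + (Y 1)%:b by apply: E.
have : b%:b + (act b (sq (Y 1)))%:b = gamma%:b + (sq (Y 2))%:b.
  by rewrite -(normalX E) actE // YE sqE; ring.
by case/emb2_inj => [] [H1 H2]; apply: gamma_nB; rewrite -?H1 -?H2 //; apply: isB_act.
Qed.

End NormalTheory.

(** * Splitting an additive array of two-element multisets *)

Section PairGrid.
Variable X : icGroup.
Implicit Types a b c d : X.

Lemma pair_cancel (b c n n' m m' : X) :
  n%:b + n'%:b + c%:b = b%:b + (m%:b + m'%:b) -> c <> b ->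
  b = n \/ b = n'.
Proof.
move=> E cb; have /esum_perm P : esum [:: n; n'; c] = esum [:: b; m; m'].
  by rewrite /esum !big_cons !big_nil; lc E.
have := perm_mem P b; rewrite !inE eqxx /= => /or3P[] /eqP; [by left|by right|].
by move=> bc; case: cb.
Qed.

(** An array depending on one index only may consist of disjoint pairs, which do not split; this is
    why both non-constancy hypotheses appear. *)
Lemma pair_grid (N : int -> int -> tvring X) :
  (forall p q, exists a b, N p q = a%:b + b%:b) ->
  (forall p q p' q', N p q + N p' q' = N p q' + N p' q) ->
  ~ (forall p p' q, N p q = N p' q) -> ~ (forall p q q', N p q = N p q') ->
  exists phi chi : int -> X, forall p q, N p q = (phi p)%:b + (chi q)%:b.
Proof.
move=> N2 Nadd /existsNP[p0 /existsNP[p1 /existsNP[q0 Np]]].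
move=> /existsNP[p2 /existsNP[r0 /existsNP[r1 Nq]]].
have [q1 {p2 r0 r1} Nq] : exists q1, N p0 q1 <> N p0 q0.
  have [E0|] := pselect (N p0 r0 = N p0 q0); last by exists r0.
  have [E1|] := pselect (N p0 r1 = N p0 q0); last by exists r1.
  case: Nq; apply: (addrI (N p0 q0)); have := Nadd p0 q0 p2 r0; have := Nadd p0 q0 p2 r1.
  by rewrite E0 E1 => -> ->.
(* If two distinct entries of the row p0 share a, additivity forces b into every entry of the column
   q0; a non-constant column then forces a into every entry of the row p0. *)
have corner a b : N p0 q0 = a%:b + b%:b -> (exists c, N p0 q1 = a%:b + c%:b) ->
    exists phi chi : int -> X, forall p q, N p q = (phi p)%:b + (chi q)%:b.
  move=> N00 [c N01]; have cb : c <> b by move=> cb; case: Nq; rewrite N01 cb.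
  have [d N10] : exists d, N p1 q0 = b%:b + d%:b.
    have [m [m' Em]] := N2 p1 q1; have [n [n' En]] := N2 p1 q0.
    have := pair_cancel (n := n) (n' := n') (m := m) (m' := m') _ cb; case.
    - by have := Nadd p1 q0 p0 q1; rewrite En Em N01 N00 => E; lc E.
    - by move=> ->; exists n'.
    - by move=> ->; exists n; rewrite En addrC.
  have da : d <> a by move=> da; case: Np; rewrite N10 N00 da addrC.
  have /choice [phi phiE] p : exists f, N p q0 = b%:b + f%:b.
    have [m [m' Em]] := N2 p q1; have [n [n' En]] := N2 p q0.
    have := pair_cancel (n := n) (n' := n') (m := m) (m' := m') _ cb; case.
    - by have := Nadd p q0 p0 q1; rewrite En Em N01 N00 => E; lc E.
    - by move=> ->; exists n'.
    - by move=> ->; exists n; rewrite En addrC.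
  have /choice [chi chiE] q : exists f, N p0 q = a%:b + f%:b.
    have [m [m' Em]] := N2 p1 q; have [n [n' En]] := N2 p0 q.
    have := pair_cancel (n := n) (n' := n') (m := m) (m' := m') _ da; case.
    - by have := Nadd p0 q p1 q0; rewrite En Em N10 N00 => E; lc E.
    - by move=> ->; exists n'.
    - by move=> ->; exists n; rewrite En addrC.
  exists phi, chi => p q; have := Nadd p q p0 q0; rewrite N00 (phiE p) (chiE q) => E; lc E.
have [a [b N00]] := N2 p0 q0; have [c [d N01]] := N2 p0 q1.
have [n [n' N10]] := N2 p1 q0; have [m [m' N11]] := N2 p1 q1.
have /esum_perm P : esum [:: a; b; m; m'] = esum [:: c; d; n; n'].
  by rewrite /esum !big_cons !big_nil; have := Nadd p0 q0 p1 q1; rewrite N00 N01 N10 N11 => E; lc E.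
have [ac|ac] := pselect (a = c); first by apply: (corner a b) => //; exists d; rewrite ac.
have [ad|ad] := pselect (a = d); first by apply: (corner a b) => //; exists c; rewrite ad N01 addrC.
apply: (corner b a); first by rewrite N00 addrC.
suff [->|->] : b = c \/ b = d; first by exists d.
  by exists c; rewrite N01 addrC.
have an : n%:b + n'%:b <> a%:b + b%:b by move=> E; case: Np; rewrite N10 N00 E.
have := perm_mem P a; rewrite !inE eqxx /= => /esym/or4P[] /eqP // aE.
- have /esum_perm Q : esum [:: b; m; m'] = esum [:: c; d; n'].
    rewrite /esum !big_cons !big_nil; have := Nadd p0 q0 p1 q1.
    by rewrite N00 N01 N10 N11 aE => E; lc E.
  have := perm_mem Q b; rewrite !inE eqxx /= => /esym/or3P[] /eqP; [by left|by right|].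
  by move=> bE; case: an; rewrite aE bE.
- have /esum_perm Q : esum [:: b; m; m'] = esum [:: c; d; n].
    rewrite /esum !big_cons !big_nil; have := Nadd p0 q0 p1 q1.
    by rewrite N00 N01 N10 N11 aE => E; lc E.
  have := perm_mem Q b; rewrite !inE eqxx /= => /esym/or3P[] /eqP; [by left|by right|].
  by move=> bE; case: an; rewrite aE bE addrC.
Qed.

End PairGrid.

(* An algebraic form of the fact that a bounded sequence with constant second
   difference is constant: the error term C of the two recurrences vanishes. *)
Lemma reduced_error0 (R : comNzRingType) (C E : R) (f h : int -> R) :
  (forall r : R, r * r = 0 -> r = 0) ->
  (forall p, (2 + E) * f p = f (p + 1) + f (p - 1) + C) ->
  (forall q, (2 + E) * h q = h (q + 1) + h (q - 1) - C) ->
  (forall p q, C * C = C * (E * (f p - h q))) -> C = 0.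
Proof.
move=> red Hf Hh HC.
(* HC makes C E f and C E h constant. The recurrences times C E then give C^2 E = 0, so C E is
   nilpotent, hence 0, and HC leaves C^2 = 0. *)
have F p : C * E * f p = C * E * f 0 by have := HC p 0; rewrite (HC 0 0) => H; lc ((-1) *e H).
have K q : C * E * h q = C * E * h 0 by have := HC 0 q; rewrite (HC 0 0) => H; lc H.
have F2 : C * E * (E * f 0) = C * E * C.
  lc ((C * E) *e Hf 0 +e F (0 + 1) +e F (0 - 1)).
have K2 : C * E * (E * h 0) = - (C * E * C).
  lc ((C * E) *e Hh 0 +e K (0 + 1) +e K (0 - 1)).
have CCE : C * C * E = 0 by lc ((-1) * E *e HC 0 0 +e (-1) *e F2 +e K2).
have CE : C * E = 0 by apply: red; lc (E *e CCE).
by apply: red; lc (HC 0 0 +e (f 0 - h 0) *e CE).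
Qed.

(** * Products of two g-strings *)

Section Decomposition.
Variable X : icGroup.
Implicit Types (x y z u v w b t : X).
Hypothesis normalX : forall x y : X, normal_pair x y.
Variable g : X.
Hypothesis gamma_nB : ~ isB (sq g).
Local Notation gamma := (sq g).

(** On a unit square both sides are 4 g Y(p+q+1) U(p-q), expanded once by the recurrence of Y and
    once by that of U. *)
Lemma wave_add Y U : g_string g Y -> g_string g U -> forall p q p' q' : int,
  wave Y U p q + wave Y U p' q' = wave Y U p q' + wave Y U p' q.
Proof.
move=> sY sU.
have L (p q : int) : wave Y U (p + 1) (q + 1) + wave Y U p q = wave Y U (p + 1) q + wave Y U p (q + 1).
  have EY := g_stringE (i := p + q + 1) (j := p + 1 + (q + 1)) (k := p + q) sY.
  have EU := g_stringE (i := p - q) (j := p + 1 - q) (k := p - (q + 1)) sU.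
  rewrite /wave.
  have -> : p + 1 - (q + 1) = p - q by lia.
  have -> : p + (q + 1) = p + q + 1 by lia.
  have -> : p + 1 + q = p + q + 1 by lia.
  by lc ((-2 * (U (p - q))%:b) *e EY ltac:(lia) ltac:(lia)
     +e (2 * (Y (p + q + 1))%:b) *e EU ltac:(lia) ltac:(lia)).
have L1 (p q q' : int) : wave Y U (p + 1) q - wave Y U p q = wave Y U (p + 1) q' - wave Y U p q'.
  apply: (int_shift_const (h := fun q => wave Y U (p + 1) q - wave Y U p q)) => i.
  by lc (L p i).
move=> p q p' q'.
have E : wave Y U p q - wave Y U p q' = wave Y U p' q - wave Y U p' q'.
  apply: (int_shift_const (h := fun p => wave Y U p q - wave Y U p q')) => i.
  by lc (L1 i q q').
by lc E.
Qed.

(** Multiplication by gamma shifts p and q together, so the recurrences of phi and chi follow only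
    up to constants C and -C. Computing the product of the sine differences of Y and U in two ways
    gives the quadratic relation from which [reduced_error0] concludes C = 0. *)
Lemma wave_decomp Y U : g_string g Y -> g_string g U ->
  exists phi chi : int -> X, [/\
    forall p q, wave Y U p q = (phi p)%:b + (chi q)%:b,
    forall p, 2 * (gamma%:b * (phi p)%:b) = (phi (p + 1))%:b + (phi (p - 1))%:b,
    forall q, 2 * (gamma%:b * (chi q)%:b) = (chi (q + 1))%:b + (chi (q - 1))%:b &
    exists p, phi p <> phi 0].
Proof.
move=> sY sU; have nY := wave_nonconst normalX gamma_nB sY sU.
have nU : ~ (forall p q q' : int, wave Y U p q = wave Y U p q').
  move=> H; apply: (wave_nonconst normalX gamma_nB sY (g_string_opp sU)) => p p' q.
  have flip r : wave Y (fun i => U (- i)) r q = wave Y U q r.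
    by rewrite /wave; congr (2 * ((Y _)%:b * (U _)%:b)); lia.
  by rewrite !flip.
have [phi [chi D]] : exists phi chi : int -> X, forall p q, wave Y U p q = (phi p)%:b + (chi q)%:b.
  by apply: (pair_grid _ (wave_add sY sU) nY nU) => p q; apply: mulE_ex.
exists phi, chi.
have D' (i j p q : int) : i = p + q -> j = p - q ->
    2 * ((Y i)%:b * (U j)%:b) = (phi p)%:b + (chi q)%:b by move=> -> ->; apply: D.
pose C := 2 * (gamma%:b * (phi 0)%:b) - (phi (0 + 1))%:b - (phi (0 - 1))%:b.
have Dg (p q : int) : 2 * (gamma%:b * ((phi p)%:b + (chi q)%:b)) =
    (phi (p + 1))%:b + (chi (q + 1))%:b + ((phi (p - 1))%:b + (chi (q - 1))%:b).
  have EY := gamma_string (i := p + q) (j := p + q + 2) (k := p + q - 2) sY erefl erefl.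
  rewrite -(D' (p + q + 2) (p - q) (p + 1) (q + 1)); try lia.
  rewrite -(D' (p + q - 2) (p - q) (p - 1) (q - 1)); try lia.
  by rewrite -(D' (p + q) (p - q) p q) //; lc ((2 * (U (p - q))%:b) *e EY).
have Hc q : 2 * (gamma%:b * (chi q)%:b) = (chi (q + 1))%:b + (chi (q - 1))%:b - C.
  by rewrite /C; lc (Dg 0 q).
have Hf p : 2 * (gamma%:b * (phi p)%:b) = (phi (p + 1))%:b + (phi (p - 1))%:b + C.
  by lc (Dg p 0 +e (-1) *e Hc 0).
have HC p q : C * C = C * (2 * (gamma%:b - 1) * ((phi p)%:b - (chi q)%:b)).
  pose i := p + q; pose j := p - q.
  have W : 2 * (((Y (i + 1))%:b - (Y (i - 1))%:b) * ((U (j + 1))%:b - (U (j - 1))%:b)) =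
      2 * (gamma%:b - 1) * ((phi p)%:b - (chi q)%:b) - 2 * C.
    have E1 := D' (i + 1) (j + 1) (p + 1) q ltac:(lia) ltac:(lia).
    have E2 := D' (i - 1) (j - 1) (p - 1) q ltac:(lia) ltac:(lia).
    have E3 := D' (i + 1) (j - 1) p (q + 1) ltac:(lia) ltac:(lia).
    have E4 := D' (i - 1) (j + 1) p (q - 1) ltac:(lia) ltac:(lia).
    by lc (E1 +e E2 +e (-1) *e E3 +e (-1) *e E4 +e (-1) *e Hf p +e Hc q).
  have SY := sine_sq normalX (sY i); have SU := sine_sq normalX (sU j).
  have SD := sine_sq normalX (D p q).
  set a := (Y (i + 1))%:b - _ in W SY; set b := (U (j + 1))%:b - _ in W SU.
  set d := (phi p)%:b - _ in W SD *.
  have gE := sqE g.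
  do 2!apply: tvring_2I.
  rewrite -/i -/j in SD.
  have W2 : (2 * (a * b)) * (2 * (a * b)) =
      (2 * (gamma%:b - 1) * d - 2 * C) * (2 * (gamma%:b - 1) * d - 2 * C) by rewrite W.
  have : (2 * (a * b)) * (2 * (a * b)) = (2 * (gamma%:b - 1) * d) * (2 * (gamma%:b - 1) * d).
    transitivity (4 * (a * a) * (b * b)); first by ring.
    rewrite SY SU; transitivity (4 * ((gamma%:b - 1) * (gamma%:b - 1)) * (d * d)); last by ring.
    by rewrite SD gE; ring.
  by rewrite W2 => E; lc E.
have C0 : C = 0.
  apply: (reduced_error0 (E := 2 * (gamma%:b - 1)) (@tvring_reduced X) _ _ HC) => p.
  - by lc (Hf p).
  - by lc (Hc p).
rewrite C0 in Hc Hf; split=> // [p|q|]; first by rewrite Hf addr0.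
  by rewrite Hc subr0.
apply: contrapT => /forallNP nphi; apply: nY => p p' q; rewrite !D.
have H r : phi r = phi 0 by apply: contrapT; apply: nphi.
by rewrite (H p) (H p').
Qed.

End Decomposition.

(** * The addition law when sq g is not in B *)

Section LargeOrder.
Variable X : icGroup.
Implicit Types (x y z u v w b t : X).
Hypothesis normalX : forall x y : X, normal_pair x y.
Variable g : X.
Hypothesis gamma_nB : ~ isB (sq g).
Local Notation gamma := (sq g).

(** phi p and phi' p should be [g^(2p) a b] and [g^(2p+1) a b], consecutive terms of one g-string.
    The splittings give this up to errors c and c', which satisfy c' = - g c and c = - g c', hence
    (1 - gamma) c = 0. *)
Lemma wave_interleave Y U : g_string g Y -> g_string g U ->
  exists phi chi phi' chi' : int -> X, [/\
    forall p q, wave Y U p q = (phi p)%:b + (chi q)%:b,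
    forall p q, wave (fun i => Y (i + 1)) U p q = (phi' p)%:b + (chi' q)%:b,
    forall p, 2 * (gamma%:b * (phi p)%:b) = (phi (p + 1))%:b + (phi (p - 1))%:b /\
              2 * (gamma%:b * (chi p)%:b) = (chi (p + 1))%:b + (chi (p - 1))%:b &
    forall p, 2 * (g%:b * (phi p)%:b) = (phi' p)%:b + (phi' (p - 1))%:b /\
              2 * (g%:b * (chi p)%:b) = (chi' p)%:b + (chi' (p - 1))%:b].
Proof.
move=> sY sU; have sY1 := g_string_shift 1 sY.
have [phi [chi [D Hf Hc [p1 np1]]]] := wave_decomp normalX gamma_nB sY sU.
have [phi' [chi' [D' Hf' Hc' _]]] := wave_decomp normalX gamma_nB sY1 sU.
exists phi, chi, phi', chi'.
have DE (i j p q : int) : i = p + q -> j = p - q ->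
    2 * ((Y i)%:b * (U j)%:b) = (phi p)%:b + (chi q)%:b by move=> -> ->; apply: D.
have DE' (i j p q : int) : i = p + q + 1 -> j = p - q ->
    2 * ((Y i)%:b * (U j)%:b) = (phi' p)%:b + (chi' q)%:b by move=> -> ->; apply: D'.
have Dg (p q : int) : 2 * (g%:b * ((phi p)%:b + (chi q)%:b)) =
    (phi' p)%:b + (chi' q)%:b + ((phi' (p - 1))%:b + (chi' (q - 1))%:b).
  rewrite -(DE (p + q) (p - q) p q) // -(DE' (p + q + 1) (p - q) p q) //.
  rewrite -(DE' (p + q - 1) (p - q) (p - 1) (q - 1)); try lia.
  by lc ((2 * (U (p - q))%:b) *e sY (p + q)).
have Dg' (p q : int) : 2 * (g%:b * ((phi' p)%:b + (chi' q)%:b)) =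
    (phi (p + 1))%:b + (chi (q + 1))%:b + ((phi p)%:b + (chi q)%:b).
  rewrite -(DE' (p + q + 1) (p - q) p q) // -(DE (p + q + 2) (p - q) (p + 1) (q + 1)); try lia.
  rewrite -(DE (p + q) (p - q) p q) //.
  by lc ((2 * (U (p - q))%:b) *e g_stringE (i := p + q + 1) (j := p + q + 2) (k := p + q) sY ltac:(lia) ltac:(lia)).
pose c := 2 * (g%:b * (phi 0)%:b) - (phi' 0)%:b - (phi' (0 - 1))%:b.
pose c' := 2 * (g%:b * (phi' 0)%:b) - (phi (0 + 1))%:b - (phi 0)%:b.
have Ec q : 2 * (g%:b * (chi q)%:b) = (chi' q)%:b + (chi' (q - 1))%:b - c.
  by rewrite /c; lc (Dg 0 q).
have Ef p : 2 * (g%:b * (phi p)%:b) = (phi' p)%:b + (phi' (p - 1))%:b + c.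
  by lc (Dg p 0 +e (-1) *e Ec 0).
have Ec' q : 2 * (g%:b * (chi' q)%:b) = (chi (q + 1))%:b + (chi q)%:b - c'.
  by rewrite /c'; lc (Dg' 0 q).
have Ef' p : 2 * (g%:b * (phi' p)%:b) = (phi (p + 1))%:b + (phi p)%:b + c'.
  by lc (Dg' p 0 +e (-1) *e Ec' 0).
have cc' : c' + g%:b * c = 0.
  have E1 := Ef 0; have E2 := Ef' 0; have E3 := Ef' (0 - 1); have E4 := Hf 0.
  rewrite (_ : 0 - 1 + 1 = 0 :> int) // in E3; rewrite sqE in E4.
  by apply: tvring_2I; lc ((-2 * g%:b) *e E1 +e (-1) *e E2 +e (-1) *e E3 +e E4).
have c'c : c + g%:b * c' = 0.
  have E1 := Ef' 0; have E2 := Ef 0; have E3 := Ef (0 + 1); have E4 := Hf' 0.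
  rewrite (_ : 0 + 1 - 1 = 0 :> int) // in E3; rewrite sqE in E4.
  by apply: tvring_2I; lc ((-2 * g%:b) *e E1 +e (-1) *e E2 +e (-1) *e E3 +e E4).
have gc : (1 - gamma%:b) * c = 0.
  by rewrite sqE; lc (2 *e c'c +e (-2 * g%:b) *e cc').
(* c is a difference of two pairs. If they share an element, [cogamma_inj] gives c = 0; if they are
   disjoint, comparing c at 0 and at p1 gives g phi(p1) = g phi(0), against the choice of p1. *)
have diff0 x y : c = x%:b - y%:b -> c = 0.
  move=> cE; suff -> : c = x%:b - x%:b by rewrite subrr.
  rewrite {1}cE; congr (_ - _%:b).
  by apply/esym/(cogamma_inj normalX gamma_nB); rewrite cE in gc; lc gc.
have c0 : c = 0.
  have [x1 [x2 Ex]] := mulE_ex g (phi 0).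
  have cE : c = x1%:b + x2%:b - (phi' 0)%:b - (phi' (0 - 1))%:b by rewrite /c Ex.
  have [x1a|n1a] := pselect (x1 = phi' 0).
    by apply: (diff0 x2 (phi' (0 - 1))); rewrite cE x1a; ring.
  have [x1b|n1b] := pselect (x1 = phi' (0 - 1)).
    by apply: (diff0 x2 (phi' 0)); rewrite cE x1b; ring.
  have [x2a|n2a] := pselect (x2 = phi' 0).
    by apply: (diff0 x1 (phi' (0 - 1))); rewrite cE x2a; ring.
  have [x2b|n2b] := pselect (x2 = phi' (0 - 1)).
    by apply: (diff0 x1 (phi' 0)); rewrite cE x2b; ring.
  exfalso; apply: np1; apply: (mul_g_inj normalX gamma_nB).
  have [m [m' Em]] := mulE_ex g (phi p1).
  have /esum_perm P : esum [:: m; m'; phi' 0; phi' (0 - 1)] = esum [:: x1; x2; phi' p1; phi' (p1 - 1)].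
    rewrite /esum !big_cons !big_nil; have := Ef p1; rewrite cE => E.
    by lc (E +e (-1) *e Em).
  apply: tvring_2I; rewrite Em Ex.
  have x1m := perm_mem P x1; rewrite !inE eqxx /= in x1m.
  move/eqP: n1a n1b => /negbTE n1a /eqP/negbTE n1b.
  move/eqP: n2a n2b => /negbTE n2a /eqP/negbTE n2b.
  rewrite n1a n1b !orbF in x1m; case/orP: x1m => /eqP x1m.
    have /esum_perm Q : esum [:: m'; phi' 0; phi' (0 - 1)] = esum [:: x2; phi' p1; phi' (p1 - 1)].
      rewrite /esum !big_cons !big_nil; have := Ef p1; rewrite cE x1m => E.
      by lc (E +e (-1) *e Em).
    have := perm_mem Q x2; rewrite !inE eqxx /= n2a n2b !orbF => /eqP <-.
    by rewrite x1m.
  have /esum_perm Q : esum [:: m; phi' 0; phi' (0 - 1)] = esum [:: x2; phi' p1; phi' (p1 - 1)].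
    rewrite /esum !big_cons !big_nil; have := Ef p1; rewrite cE x1m => E.
    by lc (E +e (-1) *e Em).
  have := perm_mem Q x2; rewrite !inE eqxx /= n2a n2b !orbF => /eqP <-.
  by rewrite x1m addrC.
rewrite c0 in Ef Ec; split=> // p; by rewrite Ef Ec addr0 subr0.
Qed.

(** With strings Y through P = (a) and U through Q = (b), the pairs (phi 0, phi' 0) and (chi 0, chi'
    0) stand for ab and ab^-1; the law only involves the indices -1, 0, 1. *)
Lemma large_order_law P Q Q' : edge g P -> edge g Q -> edge g Q' ->
  Q'.1 = Q.1 -> 2 * (g%:b * Q.1%:b) = Q.2%:b + Q'.2%:b ->
  exists R R', [/\ edge g R, edge g R', 2 * (P.1%:b * Q.1%:b) = R.1%:b + R'.1%:b,
    edge_law g (-1) P Q R & edge_law g (-1) P Q' R'].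
Proof.
case: P Q Q' => [y z] [u v] [u' v'] /= eP eQ eQ' -> {u' eQ'} vv'.
have [Y [sY /= Y0 Y1]] := g_string_ex eP; have [U [sU /= U0 U1]] := g_string_ex eQ.
have [phi [chi [phi' [chi' [D D' Hf Hfc]]]]] := wave_interleave sY sU.
have DE (i j p q : int) : i = p + q -> j = p - q ->
    2 * ((Y i)%:b * (U j)%:b) = (phi p)%:b + (chi q)%:b by move=> -> ->; apply: D.
have DE' (i j p q : int) : i = p + q + 1 -> j = p - q ->
    2 * ((Y i)%:b * (U j)%:b) = (phi' p)%:b + (chi' q)%:b by move=> -> ->; apply: D'.
have [Hp Hq] := Hfc 0.
have [Hf0 Hc0] := Hf 0.
have EY := sY 0; have EU := sU 0; rewrite Y0 in EY; rewrite U0 in EU.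
have v'E : v' = U (0 - 1) by apply: emb_inj; apply: (addrI v%:b); rewrite -vv' EU -U1.
rewrite add0r in Hp Hq EY EU v'E; rewrite add0r Y1 in EY; rewrite add0r U1 in EU.
rewrite -v'E in EU.
have E00 := DE 0 0 0 0 ltac:(lia) ltac:(lia).
have E10 := DE' 1 0 0 0 ltac:(lia) ltac:(lia).
have E01 := DE' 0 1 0 (-1) ltac:(lia) ltac:(lia).
have E0m := DE' 0 (-1) (-1) 0 ltac:(lia) ltac:(lia).
have Em0 := DE' (-1) 0 (-1) (-1) ltac:(lia) ltac:(lia).
have E11 := DE 1 1 1 0 ltac:(lia) ltac:(lia).
have Emm := DE (-1) (-1) (-1) 0 ltac:(lia) ltac:(lia).
have E1m := DE 1 (-1) 0 1 ltac:(lia) ltac:(lia).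
have Em1 := DE (-1) 1 0 (-1) ltac:(lia) ltac:(lia).
rewrite ?Y0 ?Y1 ?U0 ?U1 -?v'E in E00 E10 E01 E0m Em0 E11 Emm E1m Em1.
rewrite !add0r sqE in Hf0; rewrite !add0r sqE in Hc0.
exists (phi 0, phi' 0), (chi 0, chi' 0); split=> /=.
- by apply: mem3_l Hp.
- by apply: mem3_l Hq.
- exact: E00.
- split=> /=; apply: tvring_2I; apply: tvring_2I; last first.
    lc ((-2) *e Hp +e (2 * y%:b) *e EU +e (2 * u%:b) *e EY +e (-1) *e E01 +e E0m +e (-1) *e E10 +e Em0).
  apply: tvring_2I.
  lc ((-2 * (2 * v%:b - 2 * g%:b * u%:b)) *e EY +e (-2 * (z%:b - (Y (-1))%:b)) *e EU
     +e E11 +e Emm +e (-1) *e E1m +e (-1) *e Em1 +e (-1) *e Hf0 +e Hc0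
     +e (-4 * (1 - g%:b * g%:b)) *e E00).
- split=> /=; apply: tvring_2I; apply: tvring_2I; last first.
    lc ((-2) *e Hq +e (2 * y%:b) *e EU +e (2 * u%:b) *e EY +e E01 +e (-1) *e E0m +e (-1) *e E10 +e Em0).
  apply: tvring_2I.
  lc ((-2 * (2 * v'%:b - 2 * g%:b * u%:b)) *e EY +e (-2 * (z%:b - (Y (-1))%:b)) *e EU
     +e (-1) *e E11 +e (-1) *e Emm +e E1m +e Em1 +e Hf0 +e (-1) *e Hc0
     +e (-4 * (1 - g%:b * g%:b)) *e E00).
Qed.

Lemma large_order_abelian : exists A : abelianGroup, tv_isomorphic X (Xa A).
Proof.
have [||A [iota [p [_ _ [p_surj p_eq pM] /(_ erefl) iE _]]]] :=
    @reconstruction X g (-1) _ (@normalX g) _ large_order_law.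
- move=> [y z] [y' z'] /= _ _ E1 E2.
  have H x x' : (1 - g%:b * g%:b) * x%:b = (1 - g%:b * g%:b) * x'%:b :> tvring X -> x = x'.
    by move=> E; apply: (cogamma_inj normalX gamma_nB); rewrite sqE; lc (2 *e E).
  by rewrite (H _ _ E1) (H _ _ E2).
- by left.
exists A; apply: (@coset_model_iso X A _ (@iota_aM A) (@iota_aK A) p); split=> // [a b|a b].
  by rewrite p_eq iE.
by rewrite pM iE.
Qed.

End LargeOrder.

(** * All squares of order at most two *)

Section SmallOrder.
Variable X : icGroup.
Implicit Types (x y z u v w b c t m k : X) (P Q R S : X * X).
Hypothesis normalX : forall x y : X, normal_pair x y.
Hypothesis sqB : forall x : X, isB (sq x).

Notation e := (tv_one X).

Lemma sq_fix x : (sq x)%:b * x%:b = x%:b.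
Proof. exact: sq_stab. Qed.

Lemma isB_neq b c : isB b -> isB c -> b <> c -> b%:b * c%:b <> 1.
Proof.
by move=> Bb Bc bc E; apply: bc; apply: emb_inj; lc ((- b%:b) *e Bc +e c%:b *e E).
Qed.

(** By normality sq x lies in w * w', and being in B it carries w to w': products are cosets of {e,
    sq x}. *)
Lemma prod_coset w x y : mem3 w x y -> 2 * (x%:b * y%:b) = (1 + (sq x)%:b) * w%:b.
Proof.
case=> w' E; have w'E : w'%:b = (sq x)%:b * w%:b.
  by apply: sq_memB => //; exists (sq y); apply: normalX E.
by rewrite E w'E; ring.
Qed.

Lemma prod_cosetr w x y : mem3 w x y -> 2 * (x%:b * y%:b) = (1 + (sq y)%:b) * w%:b.
Proof. by rewrite (mulrC x%:b) => /mem3C; apply: prod_coset. Qed.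

Lemma prod_sq w x y : mem3 w x y -> (sq w)%:b = (sq x)%:b * (sq y)%:b.
Proof.
case=> w' E; have := normal_pair_sq (@normalX x y) E.
rewrite -(actE (sq y) (sqB x)) => E2.
have : (act (sq x) (sq y))%:b + (act (sq x) (sq y))%:b = (sq w)%:b + (sq w')%:b.
  by rewrite -E2; ring.
by case/emb2_inj => [] [H1 H2]; [rewrite H1|rewrite H2].
Qed.

Lemma mem3_scale b w x y x' w' : isB b -> mem3 w x y ->
  x'%:b = b%:b * x%:b -> w'%:b = b%:b * w%:b -> mem3 w' x' y.
Proof.
move=> Bb [t E] xE wE; exists (act b t); rewrite actE // xE wE.
by lc (b%:b *e E).
Qed.

Lemma mem3_coset w w' x y : mem3 w x y -> mem3 w' x y ->
  w' = w \/ w'%:b = (sq x)%:b * w%:b.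
Proof.
move=> /prod_coset E H; have E' : 2 * (x%:b * y%:b) = w%:b + (act (sq x) w)%:b.
  by rewrite actE // E; ring.
by case: (mem3_in H E') => ->; [left|right; rewrite actE].
Qed.

Lemma mem3_sqx w x y w' : mem3 w x y -> w'%:b = (sq x)%:b * w%:b -> mem3 w' x y.
Proof. by move=> /prod_coset E wE; exists w; rewrite E wE; ring. Qed.

Lemma coset4 (b1 b2 b3 b4 : X) k k' : isB b1 -> isB b2 -> isB b3 -> isB b4 ->
  (1 + b1%:b) * (1 + b2%:b) * k%:b = (1 + b3%:b) * (1 + b4%:b) * k'%:b ->
  exists i j : bool, k'%:b = b1%:b ^+ i * b2%:b ^+ j * k%:b.
Proof.
move=> B1 B2 B3 B4 E.
have /esum_perm H : esum [:: k; act b1 k; act b2 k; act b1 (act b2 k)]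
    = esum [:: k'; act b3 k'; act b4 k'; act b3 (act b4 k')].
  by rewrite /esum !big_cons !big_nil !actE //; lc E.
have := perm_mem H k'; rewrite !inE eqxx /= => /or4P[] /eqP ->; rewrite ?actE //.
- by exists false, false; rewrite !expr0; ring.
- by exists true, false; rewrite expr0 expr1; ring.
- by exists false, true; rewrite expr0 expr1; ring.
- by exists true, true; rewrite !expr1; ring.
Qed.

Lemma stab_bit b k : isB b -> b%:b * k%:b = k%:b ->
  exists i : bool, b%:b = (sq k)%:b ^+ i.
Proof.
move=> Bb /(stabP Bb) [->|->]; first by exists false; rewrite expr0 emb1.
by exists true; rewrite expr1.
Qed.

(** The bracketings (y u) x and y (u x) give (1 + sq y)(1 + sq x) k = (1 + sq y)(1 + sq u) k'; so k'
    occurs in the left side. *)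
Lemma triple_coset y u x w k m k' :
  mem3 w y u -> mem3 k w x -> mem3 m u x -> mem3 k' y m ->
  exists i j : bool, k'%:b = (sq y)%:b ^+ i * (sq x)%:b ^+ j * k%:b.
Proof.
move=> /prod_coset E1 /prod_cosetr E2 /prod_coset E3 /prod_coset E4.
apply: (coset4 (sqB y) (sqB x) (sqB y) (sqB u)).
lc ((- (1 + (sq y)%:b)) *e E2 +e (-2 * x%:b) *e E1 +e (2 * y%:b) *e E3
   +e (1 + (sq u)%:b) *e E4).
Qed.

Lemma coset_stab c (bt : tvring X) k k' : isB c -> bt * bt = 1 -> k'%:b = c%:b * k%:b ->
  k'%:b = bt * k%:b -> (exists b, b%:b = bt) ->
  exists i : bool, c%:b = bt * (sq k)%:b ^+ i.
Proof.
move=> Bc b2 E1 E2 [b bE]; rewrite -bE in b2 E2 *.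
have [|i E] := stab_bit (isB_act Bc b2) (k := k).
  by rewrite actE //; lc (b%:b *e E2 +e (- b%:b) *e E1 +e k%:b *e b2).
exists i; rewrite -E actE //; lc ((- c%:b) *e b2).
Qed.

Variable g : X.
Hypothesis gnB : ~ isB g.
Local Notation gamma := (sq g).
Local Notation gam := (sq g)%:b.

Lemma gamma_neq1 : gamma <> e.
Proof. by move=> H; apply: gnB; apply/isBP. Qed.

Lemma gam_sq : gam * gam = 1. Proof. exact: sqB. Qed.

Lemma edgeE P : edge g P -> 2 * (g%:b * P.1%:b) = (1 + gam) * P.2%:b.
Proof. exact: prod_coset. Qed.

Lemma edge_sq P : edge g P -> (sq P.2)%:b = gam * (sq P.1)%:b.
Proof. exact: prod_sq. Qed.

Lemma edge_swap P : edge g P -> edge g (P.2, P.1).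
Proof. exact: mem3_sym2. Qed.

(** Let P = (y, z) and P'.1 = b y; then P'.2 is b z or gam b z. In the second case b is replaced by
    b sq y, as sq y fixes y and acts on z as gam does. *)
Lemma edge_class P P' : edge g P -> edge g P' -> sq P.1 = sq P'.1 ->
  exists2 c, isB c & P'.1%:b = c%:b * P.1%:b /\ P'.2%:b = c%:b * P.2%:b.
Proof.
move=> eP eP' /(normal_sq_eq normalX) [b Bb E1].
have E := edgeE eP; have E' := edgeE eP'.
have : (act b P.2)%:b + (act gamma (act b P.2))%:b = P'.2%:b + (act gamma P'.2)%:b.
  by rewrite !actE //; rewrite E1 in E'; lc (E' +e (- b%:b) *e E).
case/emb2_inj => [] [H1 H2]; first by exists b => //; split; rewrite // -actE // H1.
exists (act b (sq P.1)); first exact: isB_act.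
rewrite !actE //; split; first by rewrite E1; lc ((- b%:b) *e sq_fix P.1).
have z2 := sq_fix P.2; rewrite (edge_sq eP) in z2.
move/(congr1 (@emb X)): H2; rewrite !actE // => H2.
lc ((-1) *e H2 +e (- gam * b%:b) *e z2 +e (b%:b * (sq P.1)%:b * P.2%:b) *e gam_sq).
Qed.

(* [edge_law] for [sigma = s]: [fano] yields it for [s = 1] and [antifano] for
   [s = -1]. *)
Definition law (s : tvring X) P Q := exists w t,
  [/\ mem3 w P.1 Q.1, mem3 t g w,
    (1 - gam) * w%:b = (1 - gam) * (P.1%:b * Q.1%:b + s * (P.2%:b * Q.2%:b)) &
    (1 - gam) * t%:b = (1 - gam) * (P.1%:b * Q.2%:b + P.2%:b * Q.1%:b)].

(** Together with the two edges, these are the seven lines of a Fano plane on g, P.1, P.2, Q.1, Q.2,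
    w, t. *)
Definition fano P Q := exists w t,
  [/\ mem3 w P.1 Q.1, mem3 w P.2 Q.2, mem3 t P.2 Q.1, mem3 t P.1 Q.2 & mem3 t g w].

Definition antifano P Q := exists w w' t,
  [/\ [/\ mem3 w P.1 Q.1, mem3 w P.2 Q.2, mem3 t P.2 Q.1 & mem3 t P.1 Q.2],
      w'%:b = (sq P.1)%:b * w%:b & mem3 t g w'].

Lemma law_sym s P Q : law s P Q -> law s Q P.
Proof.
case=> w [t [H1 H2 H3 H4]]; exists w, t; split=> //; first exact: mem3C.
  by rewrite H3; ring.
by rewrite H4; ring.
Qed.

(** Comparing (g y)(g u) with g^2 (y u) shows that w in y * u and m in z * v differ by a product of
    powers of gam and sq y. Such a product is a power of sq y times a power of sq z = gam sq y, so
    the two cosets meet. *)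
Lemma common_prod P Q : edge g P -> edge g Q ->
  exists w, mem3 w P.1 Q.1 /\ mem3 w P.2 Q.2.
Proof.
move=> eP eQ; have [w Hw] := mem3_ex P.1 Q.1; have [m Hm] := mem3_ex P.2 Q.2.
have EP := edgeE eP; have EQ := edgeE eQ.
have Ew := prod_coset Hw; have Em := prod_coset Hm; rewrite (edge_sq eP) in Em.
have Eg := sqE g; have g2 := gam_sq.
have E : (1 + gam) * (1 + (sq P.1)%:b) * w%:b = (1 + gam) * (1 + (sq P.1)%:b) * m%:b.
  apply: tvring_2I.
  lc ((-2 * (1 + gam)) *e Ew +e (4 * P.1%:b * Q.1%:b) *e Eg +e (4 * g%:b * Q.1%:b) *e EP
    +e (2 * (1 + gam) * P.2%:b) *e EQ +e (2 * P.2%:b * Q.2%:b) *e g2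
    +e (2 * (1 + gam)) *e Em +e (2 * (sq P.1)%:b * m%:b) *e g2).
have [i [j mE]] := coset4 (sqB g) (sqB P.1) (sqB g) (sqB P.1) E.
case: i j mE => [] []; rewrite ?expr0 ?expr1 => mE.
- exists w; split=> //; apply: (mem3_sqx Hm); rewrite (edge_sq eP) mE.
  lc ((- (sq P.1)%:b * (sq P.1)%:b * w%:b) *e g2 +e (- w%:b) *e sqB P.1).
- exists (act (sq P.1) w); split.
    by apply: (mem3_sqx Hw); rewrite actE.
  apply: (mem3_sqx Hm); rewrite actE // (edge_sq eP) mE.
  lc ((- (sq P.1)%:b * w%:b) *e g2).
- exists m; split=> //; apply: (mem3_sqx Hw); rewrite mE; ring.
- exists m; split=> //; suff -> : m = w by [].
  by apply: emb_inj; rewrite mE; ring.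
Qed.

(** Only the seventh line is in doubt: t and an entry of g * w differ by powers of gam and sq P.1.
    The power of gam is absorbed by g * w; that of sq P.1 makes the distinction. *)
Lemma fano_or_antifano P Q : edge g P -> edge g Q -> fano P Q \/ antifano P Q.
Proof.
move=> eP eQ; have [w [w1 w2]] := common_prod eP eQ.
have [t [t1 t2]] := common_prod (edge_swap eP) eQ; rewrite /= in t1 t2.
have [k Hk] := mem3_ex g w; have Ek := prod_coset Hk.
have Ew := prod_coset w1; have Et := prod_coset t2; have EQ := edgeE eQ.
have E : (1 + gam) * (1 + (sq P.1)%:b) * k%:b = (1 + gam) * (1 + (sq P.1)%:b) * t%:b.
  lc ((- (1 + (sq P.1)%:b)) *e Ek +e (-2 * g%:b) *e Ew +e (2 * P.1%:b) *e EQ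
     +e (1 + gam) *e Et).
have [i [j tE]] := coset4 (sqB g) (sqB P.1) (sqB g) (sqB P.1) E.
have tk : forall k' : X, k'%:b = gam ^+ i * k%:b -> mem3 k' g w.
  case: i {tE} => k'; rewrite ?expr0 ?expr1 ?mul1r => kE; first exact: mem3_sqx Hk kE.
  by rewrite (emb_inj kE).
have [k' kE] : exists k' : X, k'%:b = gam ^+ i * k%:b.
  by case: i {tE tk}; [exists (act gamma k); rewrite expr1 actE|exists k; rewrite expr0 mul1r].
have {tk} wk := tk _ kE; case: j tE; rewrite ?expr0 ?expr1 => tE.
  right; exists w, (act (sq P.1) w), t; split=> //; first by rewrite actE.
  apply: mem3C; apply: (mem3_scale (sqB P.1) (mem3C wk)); rewrite ?actE //.
  by rewrite tE kE; ring.
left; exists w, t; split=> //; suff -> : t = k' by [].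
by apply: emb_inj; rewrite tE kE; ring.
Qed.

(** After multiplication by 1 - gam, gam acts as -1. Then 2 y u = (1 + sq y) w and 2 z v = (1 - sq
    y) w have sum 2 w, and in [antifano_law] difference 2 (sq y) w. *)
Lemma fano_law P Q : edge g P -> edge g Q -> fano P Q -> law 1 P Q.
Proof.
move=> eP eQ [w [t [w1 w2 t1 t2 wt]]]; exists w, t; split=> //.
  have E1 := prod_coset w1; have E2 := prod_coset w2; rewrite (edge_sq eP) in E2.
  apply: tvring_2I.
  lc ((gam - 1) *e E1 +e (gam - 1) *e E2 +e ((sq P.1)%:b * w%:b) *e gam_sq).
have E1 := prod_coset t2; have E2 := prod_coset t1; rewrite (edge_sq eP) in E2.
apply: tvring_2I.
lc ((gam - 1) *e E1 +e (gam - 1) *e E2 +e ((sq P.1)%:b * t%:b) *e gam_sq).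
Qed.

Lemma antifano_law P Q : edge g P -> edge g Q -> antifano P Q -> law (-1) P Q.
Proof.
move=> eP eQ [w [w' [t [[w1 w2 t1 t2] w'E wt]]]]; exists w', t; split=> //.
- exact: mem3_sqx w1 w'E.
- have E1 := prod_coset w1; have E2 := prod_coset w2; rewrite (edge_sq eP) in E2.
  apply: tvring_2I; rewrite w'E.
  lc ((gam - 1) *e E1 +e (1 - gam) *e E2 +e (- (sq P.1)%:b * w%:b) *e gam_sq).
have E1 := prod_coset t2; have E2 := prod_coset t1; rewrite (edge_sq eP) in E2.
apply: tvring_2I.
lc ((gam - 1) *e E1 +e (gam - 1) *e E2 +e ((sq P.1)%:b * t%:b) *e gam_sq).
Qed.

Lemma gam_g : gam * g%:b = g%:b. Proof. exact: sq_fix. Qed.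

Lemma edgeB P : edge g P -> isB P.1 -> P.2%:b = P.1%:b * g%:b.
Proof. by move=> eP B1; apply: mem3_actE => //; apply: mem3C. Qed.

Lemma law_deg1 s P Q : edge g P -> edge g Q -> isB P.1 -> law s P Q.
Proof.
move=> eP eQ B1; have zE := edgeB eP B1; have EQ := edgeE eQ.
exists (act P.1 Q.1), (act P.1 Q.2); split; rewrite ?actE //.
- by exists (act P.1 Q.1); rewrite actE //; ring.
- by apply: mem3C; apply: (mem3_scale B1 (mem3C eQ)); rewrite actE.
- by rewrite zE; lc ((s * P.1%:b * Q.2%:b) *e gam_g).
- by rewrite zE; lc ((P.1%:b * Q.1%:b) *e gam_g).
Qed.

Lemma edge_gamma P : edge g P -> sq P.1 = gamma ->
  isB P.2 /\ P.1%:b = P.2%:b * g%:b.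
Proof.
move=> eP sP; have B2 : isB P.2.
  by apply/isBP; apply: emb_inj; rewrite (edge_sq eP) sP gam_sq emb1.
by split=> //; apply: (edgeB (edge_swap eP)).
Qed.

Lemma law_deg2 s P Q : s = 1 \/ s = -1 -> edge g P -> edge g Q -> sq P.1 = gamma -> law s P Q.
Proof.
move=> s1 eP eQ sP; have [B2 yE] := edge_gamma eP sP.
(* As (1 - gam) gam = -(1 - gam), the sign s is realised by c = P.2 or c = gam P.2. *)
have [c [Bc cE c2]] : exists c, [/\ isB c, (1 - gam) * c%:b = (1 - gam) * (s * P.2%:b) &
    c%:b = P.2%:b \/ P.2%:b = gam * c%:b].
  case: s1 => ->; first by exists P.2; split=> //; [ring|left].
  exists (act gamma P.2); rewrite actE //; split; first exact: isB_act.
    by lc ((- P.2%:b) *e gam_sq).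
  by right; lc ((- P.2%:b) *e gam_sq).
have uv : mem3 Q.2 g Q.1 by [].
exists (act c Q.2), (act P.2 Q.1); split.
- have H : mem3 (act P.2 Q.2) P.1 Q.1 by apply: (mem3_scale B2 uv yE); rewrite actE.
  case: c2 => cE2; first by rewrite (_ : act c Q.2 = act P.2 Q.2) //; apply: emb_inj; rewrite !actE // cE2.
  by apply: (mem3_sqx H); rewrite !actE // sP cE2; lc ((- c%:b * Q.2%:b) *e gam_sq).
- have H : mem3 (act c Q.1) g (act c Q.2).
    by apply: mem3C; apply: (mem3_scale Bc (mem3C (edge_swap eQ))); rewrite actE.
  case: c2 => cE2; first by rewrite (_ : act P.2 Q.1 = act c Q.1) //; apply: emb_inj; rewrite !actE // cE2.
  by apply: (mem3_sqx H); rewrite !actE // cE2; ring.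
- by rewrite actE // yE; lc (Q.2%:b *e cE +e (P.2%:b * Q.1%:b) *e gam_g).
- by rewrite actE // yE; lc ((P.2%:b * Q.2%:b) *e gam_g).
Qed.

Lemma edge_prod P : edge g P -> 2 * (P.1%:b * P.2%:b) = (1 + (sq P.1)%:b) * g%:b.
Proof. by move=> /mem3_sym H; apply: prod_coset; apply: mem3C. Qed.

Lemma law_deg3 s P Q : s = 1 \/ s = -1 -> edge g P -> edge g Q -> sq P.1 = sq Q.1 -> law s P Q.
Proof.
move=> s1 eP eQ /(edge_class eP eQ) [b Bb [uE vE]].
have yz := edge_prod eP; have z2 := sqE P.2; rewrite (edge_sq eP) in z2.
have y2 := sqE P.1.
have [c [Bc cE c2]] : exists c, [/\ isB c,
    2 * c%:b - 2 * gam * c%:b = (1 - gam) * b%:b * (1 + (sq P.1)%:b + s * (1 - (sq P.1)%:b)) &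
    c%:b = b%:b \/ c%:b = (sq P.1)%:b * b%:b].
  case: s1 => ->; first by exists b; split=> //; [ring|left].
  exists (act b (sq P.1)); rewrite actE //; split; first exact: isB_act.
    by ring.
  by right; ring.
exists c, (act c g); split.
- have H : mem3 b P.1 Q.1.
    by exists (act b (sq P.1)); rewrite actE // uE y2; ring.
  case: c2 => cE2; first by rewrite (emb_inj cE2).
  exact: mem3_sqx H cE2.
- by exists (act c g); rewrite actE //; ring.
- apply: tvring_2I; rewrite uE vE.
  lc (cE +e ((1 - gam) * b%:b) *e y2 +e ((1 - gam) * s * b%:b) *e z2
     +e (s * b%:b * (sq P.1)%:b) *e gam_sq).
- rewrite actE // uE vE; lc ((- c%:b) *e gam_g +e ((gam - 1) * b%:b) *e yz
     +e ((1 + (sq P.1)%:b) * b%:b) *e gam_g).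
Qed.

Lemma law_deg4 s P Q : s = 1 \/ s = -1 -> edge g P -> edge g Q -> sq P.2 = sq Q.1 -> law s P Q.
Proof.
move=> s1 eP eQ /(edge_class (edge_swap eP) eQ) /= [b Bb [uE vE]].
have yz := edge_prod eP; have z2 := sqE P.2; rewrite (edge_sq eP) in z2.
have y2 := sqE P.1.
exists (act b g), b; split.
- exists (act b (act (sq P.1) g)); rewrite !actE // uE; lc (b%:b *e yz).
- exists (act b gamma); rewrite !actE //; have := sqE g => E; lc ((- b%:b) *e E).
- apply: tvring_2I; rewrite actE // uE vE.
  lc ((- 2 * b%:b) *e gam_g +e ((gam - 1) * b%:b * (1 + s)) *e yz
     +e ((1 + (sq P.1)%:b) * b%:b * (1 + s)) *e gam_g).
- apply: tvring_2I; rewrite uE vE.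
  lc (((1 - gam) * b%:b) *e y2 +e ((1 - gam) * b%:b) *e z2
    +e (b%:b * (sq P.1)%:b) *e gam_sq).
Qed.

(* Pairs of classes which, together with that of [g], are independent. *)
Definition generic P Q :=
  [/\ sq P.1 <> e, sq P.1 <> gamma, sq Q.1 <> e, sq Q.1 <> gamma &
      sq Q.1 <> sq P.1 /\ sq Q.1 <> sq P.2].

(** Degenerate pairs obey the law with either sign, so the sign is decided by generic pairs
    alone. *)
Lemma law_nongeneric s P Q : s = 1 \/ s = -1 -> edge g P -> edge g Q ->
  ~ generic P Q -> law s P Q.
Proof.
move=> s1 eP eQ ng.
have [/isBP H|n1] := pselect (sq P.1 = e); first exact: law_deg1.
have [H|n2] := pselect (sq P.1 = gamma); first exact: law_deg2.
have [/isBP H|n3] := pselect (sq Q.1 = e); first by apply/law_sym/law_deg1.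
have [H|n4] := pselect (sq Q.1 = gamma); first by apply/law_sym/law_deg2.
have [H|n5] := pselect (sq Q.1 = sq P.1); first exact: law_deg3.
have [H|n6] := pselect (sq Q.1 = sq P.2); first exact: law_deg4.
by case: ng.
Qed.

Lemma sq_prod_eq x y : (sq x)%:b * (sq y)%:b = 1 -> sq x = sq y.
Proof.
by move=> E; apply: contrapT => H; apply: (isB_neq (sqB x) (sqB y) H).
Qed.

Lemma generic_sym P Q : edge g P -> edge g Q -> generic P Q -> generic Q P.
Proof.
move=> eP eQ [n1 n2 n3 n4 [n5 n6]]; split=> //; split; first by move=> H; apply: n5.
move=> H; apply: n6; apply: emb_inj; rewrite (edge_sq eP) H (edge_sq eQ).
by lc ((- (sq Q.1)%:b) *e gam_sq).
Qed.

Lemma fano_sym P Q : fano P Q -> fano Q P.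
Proof.
by case=> w [t [w1 w2 t1 t2 wt]]; exists w, t; split=> //; apply: mem3C.
Qed.

Lemma fano_shift P Q : fano P Q -> fano P (Q.2, Q.1).
Proof.
by case=> w [t [w1 w2 t1 t2 wt]]; exists t, w; split=> //; apply: mem3_sym2.
Qed.

Lemma fano_third P Q : edge g Q -> fano P Q -> exists R,
  [/\ edge g R, (sq R.1)%:b = (sq P.1)%:b * (sq Q.1)%:b & fano P R].
Proof.
move=> eQ [w [t [w1 w2 t1 t2 wt]]]; exists (w, t); split=> //; first exact: prod_sq.
by exists Q.1, Q.2; split=> //; apply: mem3_sym2.
Qed.

Lemma fano_scale P Q Q' : edge g Q -> edge g Q' -> sq Q.1 = sq Q'.1 ->
  fano P Q -> fano P Q'.
Proof.
move=> eQ eQ' /(edge_class eQ eQ') [c Bc [E1 E2]] [w [t [w1 w2 t1 t2 wt]]].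
exists (act c w), (act c t); split.
- by apply: mem3C; apply: (mem3_scale Bc (mem3C w1) E1); rewrite actE.
- by apply: mem3C; apply: (mem3_scale Bc (mem3C w2) E2); rewrite actE.
- by apply: mem3C; apply: (mem3_scale Bc (mem3C t1) E1); rewrite actE.
- by apply: mem3C; apply: (mem3_scale Bc (mem3C t2) E2); rewrite actE.
- by apply: mem3C; apply: (mem3_scale Bc (mem3C wt)); rewrite actE.
Qed.

Lemma edge_prod_ex P Q : edge g P -> edge g Q -> exists R,
  [/\ edge g R, mem3 R.1 P.1 Q.1, mem3 R.2 P.2 Q.1 & mem3 R.2 P.1 Q.2].
Proof.
move=> eP eQ; case: (fano_or_antifano eP eQ) => [[w [t [w1 w2 t1 t2 wt]]]|].
  by exists (w, t); split.
case=> w [w' [t [[w1 w2 t1 t2] w'E wt]]]; exists (w', t); split=> //.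
exact: mem3_sqx w1 w'E.
Qed.

Definition bool_mono (a b c d : tvring X) (i j k l : bool) := a ^+ i * b ^+ j * c ^+ k * d ^+ l.

(** * Fano configurations under four independent squares *)

Section Rank4.
Variables (P Q R S : X * X).
Hypotheses (eP : edge g P) (eQ : edge g Q) (eR : edge g R).
Local Notation q := (sq P.1)%:b.
Local Notation r := (sq Q.1)%:b.
Local Notation h := (sq R.1)%:b.
Local Notation mono := (bool_mono gam q r h).
Hypothesis indep : forall i j k l : bool, mono i j k l = 1 -> [&& ~~ i, ~~ j, ~~ k & ~~ l].

Lemma mono_mul (i j k l i' j' k' l' : bool) :
  mono i j k l * mono i' j' k' l' = mono (i (+) i') (j (+) j') (k (+) k') (l (+) l').
Proof.
have E x (b b' : bool) : isB x -> x%:b ^+ b * x%:b ^+ b' = x%:b ^+ (b (+) b').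
  by move=> Bx; case: b b' => [] [] //=; rewrite ?expr0 ?expr1 ?mulr1 ?mul1r.
by rewrite /bool_mono -!E //; ring.
Qed.

Lemma mono_inj (i j k l i' j' k' l' : bool) :
  mono i j k l = mono i' j' k' l' -> [&& i == i', j == j', k == k' & l == l'].
Proof.
move=> E; have : mono i j k l * mono i' j' k' l' = 1.
  by rewrite E mono_mul !addbb /bool_mono !expr0 !mulr1.
rewrite mono_mul => /indep.
by case: i {E}; case: i'; case: j; case: j'; case: k; case: k'; case: l; case: l'.
Qed.

Lemma coset_bits (y x k k' c : X) (i j : bool) : isB c -> k'%:b = c%:b * k%:b ->
  k'%:b = (sq y)%:b ^+ i * (sq x)%:b ^+ j * k%:b ->
  exists l : bool, c%:b = (sq y)%:b ^+ i * (sq x)%:b ^+ j * (sq k)%:b ^+ l.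
Proof.
move=> Bc E1 E2; apply: (coset_stab Bc _ E1 E2).
  by case: i {E2}; case: j; rewrite ?expr0 ?expr1;
    [lc (((sq x)%:b * (sq x)%:b) *e sqB y +e sqB x)|lc (sqB y)|lc (sqB x)|ring].
case: i {E2}; case: j; rewrite ?expr0 ?expr1.
- by exists (act (sq y) (sq x)); rewrite actE.
- by exists (sq y); rewrite mulr1.
- by exists (sq x); rewrite mul1r.
- by exists e; rewrite emb1 mulr1.
Qed.

Hypotheses (eS : edge g S) (S1 : mem3 S.1 Q.1 R.1) (S2 : mem3 S.2 Q.2 R.1)
  (S3 : mem3 S.2 Q.1 R.2).

(** The edges (P Q) R and P S differ by some c in B. Four bracketings express c as monomials in gam,
    q, r, h of different shapes, and by independence only c = 1 fits all of them. *)
Lemma fano_mul : fano P Q -> fano P S.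
Proof.
case=> w [w1 [wyu wzv w1zu w1yv ww1]].
have eW : edge g (w, w1) by [].
have [[k k1] /= [eK kwx k1w1x k1wx1]] := edge_prod_ex eW eR.
have [[k' k1'] /= [eK' k'ym k1'zm k1'ym1]] := edge_prod_ex eP eS.
have sk : (sq k)%:b = q * r * h by rewrite (prod_sq kwx) (prod_sq wyu).
have sk' : sq k = sq k'.
  by apply: emb_inj; rewrite sk (prod_sq k'ym) (prod_sq S1) mulrA.
have sk1 : (sq k1)%:b = gam * (q * r * h) by rewrite -sk; apply: (edge_sq eK).
have [c Bc /= [E1 E2]] := edge_class eK eK' sk'.
have [i1 [j1 /(coset_bits Bc E1) [l1 C1]]] := triple_coset wyu kwx S1 k'ym.
have [i2 [j2 /(coset_bits Bc E2) [l2 C2]]] := triple_coset wyu k1wx1 S3 k1'ym1.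
have [i3 [j3 /(coset_bits Bc E2) [l3 C3]]] := triple_coset w1yv k1w1x S2 k1'ym1.
have [i4 [j4 /(coset_bits Bc E2) [l4 C4]]] := triple_coset w1zu k1w1x S1 k1'zm.
have expE (x y : tvring X) (b : bool) : (x * y) ^+ b = x ^+ b * y ^+ b.
  by case: b; rewrite ?expr0 ?expr1 ?mulr1.
have mq (b : bool) : q ^+ b = mono false b false false by rewrite /bool_mono !expr0; ring.
have mr (b : bool) : r ^+ b = mono false false b false by rewrite /bool_mono !expr0; ring.
have mh (b : bool) : h ^+ b = mono false false false b by rewrite /bool_mono !expr0; ring.
have mg (b : bool) : gam ^+ b = mono b false false false by rewrite /bool_mono !expr0; ring.
rewrite sk !expE !mq !mr !mh !mono_mul !(addbF, addFb) in C1.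
rewrite sk1 (edge_sq eR) !expE !mq !mr !mh !mg !mono_mul !(addbF, addFb) in C2.
rewrite sk1 !expE !mq !mr !mh !mg !mono_mul !(addbF, addFb) in C3.
rewrite sk1 (edge_sq eP) !expE !mq !mr !mh !mg !mono_mul !(addbF, addFb) in C4.
have c1 : c%:b = 1.
  have C12 := C1; rewrite C2 in C12; have C13 := C1; rewrite C3 in C13.
  have C14 := C1; rewrite C4 in C14; rewrite C1.
  case/mono_inj/and4P: C13 => /eqP b3 _ /eqP b31 _.
  case/mono_inj/and4P: C12 => /eqP b2 _ _ /eqP b21.
  case/mono_inj/and4P: C14 => /eqP b4 /eqP b41 _ _.
  by rewrite -b41 b4 -b21 b2 -b31 b3 /bool_mono !expr0 !mulr1.
have kk' : k' = k by apply: emb_inj; rewrite E1 c1 mul1r.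
have [t [t1 t2]] := common_prod eP eS.
have kym : mem3 k P.1 S.1 by rewrite -kk'.
have gk : mem3 k1' g k by rewrite -kk'.
exists k, k1'; split=> //.
(* Otherwise t = q k; the bracketings of P.2, Q.2, R.1 would then write q as a monomial of an
   impossible shape. *)
have [<-//|tE] := mem3_coset kym t1; exfalso.
have [i5 [j5 E5]] := triple_coset wzv kwx S2 t2.
have [l5 C5] := coset_bits (sqB P.1) tE E5.
rewrite sk (edge_sq eP) !expE !mq !mr !mh !mg !mono_mul !(addbF, addFb) in C5.
have C6 : mono false true false false = mono i5 (i5 (+) l5) l5 (j5 (+) l5).
  by rewrite -C5 /bool_mono !expr0 expr1; ring.
by case/mono_inj/and4P: C6 => /eqP <- /eqP H /eqP l0; rewrite -l0 in H.
Qed.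

End Rank4.

Lemma generic_neq P Q : edge g P -> generic P Q ->
  forall i j : bool, gam ^+ i * (sq P.1)%:b ^+ j * (sq Q.1)%:b <> 1.
Proof.
move=> eP [n1 n2 n3 n4 [n5 n6]] i j; case: i; case: j; rewrite ?expr0 ?expr1 ?mul1r ?mulr1.
- by rewrite -(edge_sq eP) => /sq_prod_eq H; apply: n6.
- by move/sq_prod_eq => H; apply: n4.
- by move/sq_prod_eq => H; apply: n5.
- by move=> H; apply: n3; apply: emb_inj; rewrite H emb1.
Qed.

Lemma generic_neq0 P Q : edge g P -> generic P Q ->
  forall i j : bool, gam ^+ i * (sq P.1)%:b ^+ j = 1 -> ~~ i /\ ~~ j.
Proof.
move=> eP [n1 n2 _ _ _] i j; case: i; case: j; rewrite ?expr0 ?expr1 ?mul1r ?mulr1 // => H.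
- by case: n2; apply/esym/sq_prod_eq.
- by case: gamma_neq1; apply: emb_inj; rewrite H emb1.
- by case: n1; apply: emb_inj; rewrite H emb1.
Qed.

(** If sq Q'.1 differs from sq Q.1 only by gam and sq P.1, the symmetries of the Fano plane suffice;
    otherwise the four squares are independent and [fano_mul] applies. *)
Lemma fano_step P Q Q' : edge g P -> edge g Q -> edge g Q' ->
  generic P Q -> generic P Q' -> fano P Q -> fano P Q'.
Proof.
move=> eP eQ eQ' gQ gQ' F.
have [H|n1] := pselect (sq Q.1 = sq Q'.1); first exact: fano_scale H F.
have [H|n2] := pselect (sq Q.2 = sq Q'.1).
  by apply: (fano_scale (Q := (Q.2, Q.1)) (edge_swap eQ) eQ' H); apply: fano_shift.
have [R [eR R1 F3]] := fano_third eQ F.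
have [H|n3] := pselect (sq R.1 = sq Q'.1); first exact: fano_scale H F3.
have [H|n4] := pselect (sq R.2 = sq Q'.1).
  by apply: (fano_scale (Q := (R.2, R.1)) (edge_swap eR) eQ' H); apply: fano_shift.
have indep (i j k l : bool) :
    bool_mono gam (sq P.1)%:b (sq Q.1)%:b (sq Q'.1)%:b i j k l = 1 ->
    [&& ~~ i, ~~ j, ~~ k & ~~ l].
  rewrite /bool_mono; case: k; case: l; rewrite ?expr0 ?expr1 ?mulr1 => E.
  - exfalso; case: i E; case: j; rewrite ?expr0 ?expr1 ?mulr1 ?mul1r => E.
    + by apply: n4; apply: sq_prod_eq; rewrite (edge_sq eR) R1 -E; ring.
    + by apply: n2; apply: sq_prod_eq; rewrite (edge_sq eQ) -E; ring.
    + by apply: n3; apply: sq_prod_eq; rewrite R1 -E; ring.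
    + by apply: n1; apply: sq_prod_eq.
  - by case: (generic_neq eP gQ E).
  - by case: (generic_neq eP gQ' E).
  - by have [-> ->] := generic_neq0 eP gQ E.
(* The product S of Q with the edge (x, x1) over Q Q' has the square of Q', so it may replace Q'. *)
have [x Hx] := mem3_ex Q.1 Q'.1; have [x1 Hx1] := mem3_ex g x.
have eT : edge g (x, x1) by [].
have [S [eS S1 S2 S3]] := edge_prod_ex eQ eT.
have xE : (sq x)%:b = (sq Q.1)%:b * (sq Q'.1)%:b by apply: prod_sq.
apply: (fano_scale eS eQ').
  apply: emb_inj; rewrite (prod_sq S1) /= xE.
  by lc ((sq Q'.1)%:b *e sqB Q.1).
apply: (fano_mul eP eT _ eS S1 S2 S3 F) => i j k l /= E.
have /indep/and4P[ni nj nkl nl] : bool_mono gam (sq P.1)%:b (sq Q.1)%:b (sq Q'.1)%:b i j (k (+) l) l = 1.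
  rewrite -E /bool_mono xE; case: k {E}; case: l; rewrite ?expr0 ?expr1 /= ?expr0 ?expr1; try ring.
  by lc ((- gam ^+ i * (sq P.1)%:b ^+ j * (sq Q'.1)%:b) *e sqB Q.1).
by rewrite ni nj nl; move: nkl; rewrite (negbTE nl) addbF => ->.
Qed.

(** Edges are replaced one at a time by [fano_step]. If (P, P') is not generic, sq P'.1 is sq P.1 or
    gam sq P.1, so (P, Q') is generic and serves as intermediate pair. *)
Lemma fano_const P Q P' Q' : edge g P -> edge g Q -> edge g P' -> edge g Q' ->
  generic P Q -> generic P' Q' -> fano P Q -> fano P' Q'.
Proof.
move=> eP eQ eP' eQ' gPQ gPQ' F; case: (gPQ) => n1 n2 _ _ _; case: (gPQ') => m1 m2 m3 m4 [m5 m6].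
have [gPP'|ngPP'] := pselect (generic P P').
  have F1 := fano_sym (fano_step eP eQ eP' gPQ gPP' F).
  exact: fano_step (generic_sym eP eP' gPP') gPQ' F1.
have PP' : sq P'.1 = sq P.1 \/ sq P'.1 = sq P.2.
  have [|k1] := pselect (sq P'.1 = sq P.1); first by left.
  have [|k2] := pselect (sq P'.1 = sq P.2); first by right.
  by case: ngPP'.
have gPQ2 : generic P Q'.
  case: PP' => H; first by split=> //; split; rewrite -?H // => E; apply: m6;
    apply: emb_inj; rewrite E (edge_sq eP) (edge_sq eP') H.
  have H2 : sq P'.2 = sq P.1.
    apply: emb_inj; rewrite (edge_sq eP') H (edge_sq eP).
    by lc ((sq P.1)%:b *e gam_sq).
  by split=> //; split; rewrite -?H2 // -H.
have F1 := fano_sym (fano_step eP eQ eQ' gPQ gPQ2 F).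
exact: fano_sym (fano_step eQ' eP eP' (generic_sym eP eQ' gPQ2) (generic_sym eP' eQ' gPQ') F1).
Qed.

Lemma edge_law_of_law (s : tvring X) P Q Q' : edge g P -> edge g Q -> edge g Q' ->
  Q'.1 = Q.1 -> 2 * (g%:b * Q.1%:b) = Q.2%:b + Q'.2%:b -> law s P Q ->
  exists R R', [/\ edge g R, edge g R', 2 * (P.1%:b * Q.1%:b) = R.1%:b + R'.1%:b,
    edge_law g s P Q R & edge_law g s P Q' R'].
Proof.
case: Q' => [u' v'] /= eP eQ eQ' uu' vv' [w [t [wyu wt Ew Et]]].
have EP := edgeE eP; have EQ := edgeE eQ; have ER := prod_coset wt.
have v'E : v'%:b = gam * Q.2%:b by rewrite EQ in vv'; lc ((-1) *e vv').
have g2 := sqE g.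
pose w' := act (sq P.1) w; pose t' := act gamma (act (sq P.1) t).
have w'E : w'%:b = (sq P.1)%:b * w%:b by rewrite actE.
have t'E : t'%:b = gam * ((sq P.1)%:b * t%:b) by rewrite !actE.
exists (w, t), (w', t'); split=> //=.
- have H : mem3 (act (sq P.1) t) g w'.
    by apply: mem3C; apply: (mem3_scale (sqB P.1) (mem3C wt)); rewrite actE.
  by apply: (mem3_sqx H); rewrite t'E actE.
- by rewrite (prod_coset wyu) w'E; ring.
- split=> /=.
    do 2!apply: tvring_2I.
    lc ((2 * w%:b - 2 * P.1%:b * Q.1%:b) *e g2 +e (s * (2 * Q.2%:b - 2 * g%:b * Q.1%:b)) *e EP
      +e (s * (1 - gam) * P.2%:b) *e EQ +e 2 *e Ew +e (- s * P.2%:b * Q.2%:b) *e gam_sq).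
  apply: tvring_2I.
  lc (Et +e (-1) *e ER +e P.1%:b *e EQ +e Q.1%:b *e EP).
have Eyu := prod_coset wyu.
have fy := sq_fix P.1; have fz := sq_fix P.2; rewrite (edge_sq eP) in fz.
split=> /=; rewrite uu' ?w'E ?t'E v'E.
  do 2!apply: tvring_2I.
  lc ((2 * (sq P.1)%:b * w%:b - 2 * P.1%:b * Q.1%:b) *e g2
    +e (s * (2 * gam * Q.2%:b - 2 * g%:b * Q.1%:b)) *e EP
    +e (s * (1 - gam) * P.2%:b) *e EQ +e (-2) *e Ew +e (-2 * (1 - gam)) *e Eyu
    +e (s * P.2%:b * Q.2%:b) *e gam_sq).
apply: tvring_2I.
lc ((- (sq P.1)%:b) *e ER +e P.1%:b *e EQ +e Q.1%:b *e EP +e (- (sq P.1)%:b) *e Et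
  +e (- (1 - gam) * Q.2%:b) *e fy +e (- (1 - gam) * Q.1%:b * gam) *e fz
  +e (Q.1%:b * P.2%:b + (1 - gam) * Q.1%:b * (sq P.1)%:b * P.2%:b) *e gam_sq).
Qed.

(** Cancelling 1 - gam fails only between elements of square gam. As sq z = gam sq y, this cannot
    affect both coordinates; if it affects one, the other is in B and determines it. *)
Lemma small_edge_inj P Q : edge g P -> edge g Q ->
  (1 - g%:b * g%:b) * P.1%:b = (1 - g%:b * g%:b) * Q.1%:b ->
  (1 - g%:b * g%:b) * P.2%:b = (1 - g%:b * g%:b) * Q.2%:b -> P = Q.
Proof.
have H x x' : (1 - g%:b * g%:b) * x%:b = (1 - g%:b * g%:b) * x'%:b ->
    x = x' \/ sq x = gamma /\ sq x' = gamma.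
  have fixP t : act gamma t = t -> sq t = gamma.
    move/(congr1 (@emb X)); rewrite actE // => /(stabP (sqB g)) [|->//].
    by move=> E; case: gamma_neq1.
  move=> E; have : x%:b + (act gamma x')%:b = x'%:b + (act gamma x)%:b.
    by rewrite !actE // sqE; lc (2 *e E).
  case/emb2_inj => [] [H1 H2]; first by left.
  by right; split; apply: fixP.
move=> eP eQ /H HP /H HQ.
case: P Q eP eQ HP HQ => [y z] [y' z'] /= eP eQ [E|[sy sy']].
  subst y' => [] [->//|[sz _]].
  have By : isB y.
    apply/isBP; apply: emb_inj; have := edge_sq eP; rewrite /= sz emb1 => E.
    by lc ((- gam) *e E +e (1 - (sq y)%:b) *e gam_sq).
  by congr pair; apply: emb_inj; rewrite (edgeB eP By) (edgeB eQ By).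
case=> [E|[sz _]].
- subst z'; have [/= Bz yE] := edge_gamma eP sy; have [_ /= y'E] := edge_gamma eQ sy'.
  by congr pair; apply: emb_inj; rewrite yE y'E.
- have [/= /isBP Bz _] := edge_gamma eP sy.
  by case: gamma_neq1; rewrite -sz Bz.
Qed.

Lemma small_order_coset : exists (s : tvring X) (A : abelianGroup) (iota : A -> A) (p : A -> X),
  [/\ {morph iota : a b / (a * b)%g}, involutive iota, coset_model iota p &
    (forall a : A, iota a = (a^-1)%g) \/
    (forall a : A, (a * a = 1)%g) /\ exists x y z : X,
      forall i j k : bool,
        (sq x)%:b ^+ i * (sq y)%:b ^+ j * (sq z)%:b ^+ k = 1 -> [&& ~~ i, ~~ j & ~~ k]].
Proof.
have [[P [Q [eP eQ gPQ F]]]|NF] :=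
    pselect (exists P Q, [/\ edge g P, edge g Q, generic P Q & fano P Q]).
- have L P' Q' : edge g P' -> edge g Q' -> law 1 P' Q'.
    move=> eP' eQ'; have [G|nG] := pselect (generic P' Q').
      apply: fano_law => //; exact: fano_const gPQ G F.
    by apply: law_nongeneric => //; left.
  (* With P' = (y, z): 2 y z = (1 + sq y) g is fixed by gam, while 2 g y^2 = (1 + gam) y z. *)
  have Z P' : edge g P' -> P'.1%:b * (P'.2%:b - g%:b * P'.1%:b) = 0.
    move=> eP'; have E1 := edge_prod eP'; have E2 := edgeE eP'.
    apply: tvring_2I; apply: tvring_2I.
    lc ((-2 * P'.1%:b) *e E2 +e (1 - gam) *e E1 +e (- (1 + (sq P'.1)%:b)) *e gam_g).
  have [||A [iota [p [iM iK cm _ H]]]] :=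
      @reconstruction X g 1 small_edge_inj (@normalX g).
  + by right; split.
  + by move=> P1 Q1 Q1' eP1 eQ1 eQ1' E1 E2; apply: edge_law_of_law => //; apply: L.
  exists 1, A, iota, p; split=> //; right; split.
    apply: H => E; have : (1 : tvring X) = 0 by apply: tvring_2I; lc E.
    by apply/eqP; exact: oner_neq0.
  exists g, P.1, Q.1 => i j k; case: k; rewrite ?expr0 ?expr1 ?mulr1 => E.
    by case: (generic_neq eP gPQ E).
  by have [-> ->] := generic_neq0 eP gPQ E.
have L P' Q' : edge g P' -> edge g Q' -> law (-1) P' Q'.
  move=> eP' eQ'; have [G|nG] := pselect (generic P' Q').
    apply: antifano_law => //; case: (fano_or_antifano eP' eQ') => // F.
    by case: NF; exists P', Q'.
  by apply: law_nongeneric => //; right.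
have [||A [iota [p [iM iK cm H _]]]] :=
    @reconstruction X g (-1) small_edge_inj (@normalX g).
- by left.
- by move=> P1 Q1 Q1' eP1 eQ1 eQ1' E1 E2; apply: edge_law_of_law => //; apply: L.
exists (-1), A, iota, p; split=> //; left; exact: H.
Qed.

End SmallOrder.

Local Open Scope group_scope.

(** * Boolean groups *)

Section BooleanGroups.
Variable V : booleanGroup.
Implicit Types (a b c v : V) (H K : set V) (s : seq V).

Lemma bool_mulK a b : a * (a * b) = b.
Proof. by rewrite mulgA bool_mulaa mul1g. Qed.

Lemma bool_mulCA a b v : a * (b * v) = b * (a * v).
Proof. by rewrite !mulgA (bool_mulC a). Qed.

Lemma bool_mulACA3 a b c a' b' c' :
  a * (b * c) * (a' * (b' * c')) = a * a' * (b * b' * (c * c')).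
Proof.
rewrite -!mulgA; congr (_ * _).
by rewrite (bool_mulCA c a') (bool_mulCA b a') (bool_mulCA c b').
Qed.

Lemma bool_mul_eq1 a b : a * b = 1 -> a = b.
Proof. by move=> E; rewrite -[RHS](bool_mulK a) bool_mulC (bool_mulC a) bool_mulC (bool_mulC b) E mulg1. Qed.

Definition bool_subgroup H := H 1 /\ forall a b, H a -> H b -> H (a * b).

Lemma sub_boolean H : bool_subgroup H -> exists (W : booleanGroup) (i : W -> V),
  [/\ injective i, {morph i : a b / a * b} & forall v, H v <-> exists w, i w = v].
Proof.
case=> H1 HM; pose T : choiceType := {v : V | `[< H v >]}.
have HT (t : T) : H (val t) by apply/asboolP; case: t.
pose op (t u : T) : T := exist _ (val t * val u) (asboolT (HM _ _ (HT t) (HT u))).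
pose one : T := exist _ 1 (asboolT H1).
have opA : associative op by move=> t u w; apply: val_inj; rewrite /= mulgA.
have opC : commutative op by move=> t u; apply: val_inj; rewrite /= bool_mulC.
have op1 : left_id one op by move=> t; apply: val_inj; rewrite /= mul1g.
have opV : left_inverse one id op by move=> t; apply: val_inj; rewrite /= bool_mulaa.
pose A := abelian_of (AbelianData opA opC op1 opV).
have A2 (x : A) : x ^+ 2 = 1 by rewrite expgS expg1; exact: opV.
exists (BooleanGroup A2), (fun t : T => val t); split=> //.
move=> v; split=> [Hv|[t <-]]; last exact: HT.
by exists (exist _ v (asboolT Hv)).
Qed.

Lemma bool_complement H : bool_subgroup H -> exists K, [/\ bool_subgroup K,
  forall v, H v -> K v -> v = 1 &
  forall v, exists h k, [/\ H h, K k & v = h * k]].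
Proof.
(* The empty chain has empty union, so P has to contain the empty set; that 1 lies in K is recovered
   from maximality. *)
case=> H1 HM; pose P : set (set V) := [set K |
  (forall a b, K a -> K b -> K (a * b)) /\ forall v, H v -> K v -> v = 1]%classic.
have [F FP tF|K [[KM KH] Kmax]] := @Zorn_bigcup V P.
  split=> [a b [A FA Aa] [B FB Bb]|v Hv [A FA Av]]; last by case: (FP _ FA) => _; apply.
  case: (tF _ _ FA FB) => AB.
    by exists B => //; case: (FP _ FB) => M _; apply: M => //; apply: AB.
  by exists A => //; case: (FP _ FA) => M _; apply: M => //; apply: AB.
have K1 : K 1.
  apply: contrapT => nK1; apply: (Kmax [set v | K v \/ v = 1]%classic).
    split; first by move=> v; left.
    by move=> /(_ 1) KK; apply: nK1; apply: KK; right.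
  split=> [a b [Ka|->] [Kb|->]|v Hv [Kv|//]].
  - by left; apply: KM.
  - by left; rewrite mulg1.
  - by left; rewrite mul1g.
  - by right; rewrite mul1g.
  - exact: KH.
exists K; split=> // v; apply: contrapT => nv.
apply: (Kmax [set u | K u \/ K (v * u)]%classic).
  split; first by move=> u; left.
  move=> /(_ v) KK; apply: nv; exists 1, v; rewrite mul1g; split=> //.
  by apply: KK; right; rewrite bool_mulaa.
split=> [a b [Ka|Ka] [Kb|Kb]|u Hu [Ku|Ku]].
- by left; apply: KM.
- by right; rewrite bool_mulCA; apply: KM.
- by right; rewrite mulgA; apply: KM.
- left; have := KM _ _ Ka Kb.
  by rewrite -mulgA (bool_mulCA a) bool_mulK.
- exact: KH.
- case: nv; exists u, (v * u); split=> //.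
  by rewrite bool_mulCA bool_mulaa mulg1.
Qed.

Definition bprod s : V := \prod_(a <- s) a.

Lemma bprod_cons a s : bprod (a :: s) = a * bprod s.
Proof. exact: big_cons. Qed.

Lemma bprod_rem a s : a \in s -> bprod s = a * bprod (rem a s).
Proof.
elim: s => [//|b s IH] /=; rewrite inE eq_sym; case: eqVneq => [<-|ne] //=.
  by rewrite bprod_cons.
by move=> /IH E; rewrite !bprod_cons E bool_mulCA.
Qed.

Lemma bprod_perm s1 s2 : perm_eq s1 s2 -> bprod s1 = bprod s2.
Proof.
elim: s1 s2 => [|a s1 IH] s2 P; first by move: P; rewrite perm_sym => /perm_nilP ->.
have as2 : a \in s2 by rewrite -(perm_mem P) inE eqxx.
rewrite (bprod_rem as2) bprod_cons (IH (rem a s2)) //.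
by rewrite -(perm_cons a) (permPl P); apply: perm_to_rem.
Qed.

Lemma F2_combE s (c : V -> 'F_2) : F2_comb s c = bprod [seq a <- s | c a != 0%R].
Proof.
rewrite /F2_comb /bprod big_filter [RHS]big_mkcond; apply: eq_bigr => a _.
have [->|] := eqVneq (c a) 0%R; first by rewrite expg0.
by case: (c a) => [[|[|]]] //= _ _; rewrite expg1.
Qed.

Definition bool_indep (B : set V) := forall s, uniq s -> {in s, forall a, B a} ->
  bprod s = 1 -> s = [::].

Lemma F2_basisP (B : set V) : F2_basis B <->
  bool_indep B /\ forall v, exists s, {in s, forall a, B a} /\ v = bprod s.
Proof.
have f1 s : [seq a <- s | ((fun=> 1%R) a : 'F_2) != 0%R] = s by apply/all_filterP/allP.
split=> [[I S]|[I S]]; split.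
- move=> s us sB s1; have := I s (fun=> 1%R) us sB; rewrite F2_combE f1 => /(_ s1).
  by case: s {us sB s1} => [//|a s] /(_ a); rewrite inE eqxx => /(_ isT).
- move=> v; have [s [c [sB ->]]] := S v; rewrite F2_combE.
  by exists [seq a <- s | c a != 0%R]; split=> // a; rewrite mem_filter => /andP[_ /sB].
- move=> s c us sB; rewrite F2_combE => /(I _ (filter_uniq _ us)) E a as_.
  apply/eqP; apply/negPn/negP => ca.
  have : a \in [seq a <- s | c a != 0%R] by rewrite mem_filter ca.
  by rewrite E // => b; rewrite mem_filter => /andP[_ /sB].
- move=> v; have [s [sB ->]] := S v; exists s, (fun=> 1%R); split=> //.
Qed.

Lemma bool_basis_ext (S : set V) : bool_indep S -> exists2 B, F2_basis B & (S `<=` B)%classic.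
Proof.
(* Adjoining S inside the predicate covers the empty chain and makes the final basis contain S. *)
move=> iS; pose P : set (set V) := [set B | bool_indep (B `|` S)]%classic.
have [F FP tF|B [iB Bmax]] := @Zorn_bigcup V P.
  move=> s us sB.
  have [sS|[X [FX sX]]] : {in s, forall a, S a} \/
      exists X, F X /\ {in s, forall a, (X `|` S)%classic a}.
    elim: s {us} sB => [|a s IH] sB; first by left.
    have {}IH : {in s, forall a, S a} \/
        exists X, F X /\ {in s, forall a, (X `|` S)%classic a}.
      by apply: IH => b bs; apply: sB; rewrite inE bs orbT.
    have [[A FA Aa]|Sa] := sB a (mem_head a s).
      right; case: IH => [sS|[X [FX sX]]].
        exists A; split=> // b; rewrite inE => /orP[/eqP->|/sS]; [by left|by right].
      case: (tF _ _ FA FX) => AX.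
        exists X; split=> // b; rewrite inE => /orP[/eqP->|/sX//].
        by left; apply: AX.
      exists A; split=> // b; rewrite inE => /orP[/eqP->|/sX[Xb|Sb]].
      - by left.
      - by left; apply: AX.
      - by right.
    case: IH => [sS|[X [FX sX]]]; [left|right].
      by move=> b; rewrite inE => /orP[/eqP->|/sS].
    by exists X; split=> // b; rewrite inE => /orP[/eqP->|/sX]; [right|].
  - exact: iS.
  - exact: FP FX s us sX.
exists (B `|` S)%classic; last by move=> v; right.
apply/F2_basisP; split=> // v; apply: contrapT => nv.
apply: (Bmax [set u | B u \/ u = v]%classic).
  split; first by move=> u; left.
  move=> /(_ v) BB; apply: nv; exists [:: v]; split; last by rewrite bprod_cons /bprod big_nil mulg1.
  by move=> u; rewrite inE => /eqP ->; left; apply: BB; right.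
move=> s us sB s1; have [vs|vs] := boolP (v \in s).
  case: nv; exists (rem v s); split.
    move=> a; rewrite mem_rem_uniq // !inE => /andP[av] /sB [[Ba|av']|Sa]; [by left| |by right].
    by rewrite av' eqxx in av.
  by apply: bool_mul_eq1; rewrite -bprod_rem.
apply: iB => // a as_; have [[Ba|av]|Sa] := sB a as_; [by left| |by right].
by rewrite -av as_ in vs.
Qed.

Definition bool_bits n (f : nat -> V) (c : nat -> bool) : V :=
  bprod [seq f i | i <- iota 0 n & c i].

Lemma F2_dim_geP n : F2_dim_ge V n <->
  exists f : nat -> V, forall c : nat -> bool, bool_bits n f c = 1 ->
    forall i, (i < n)%N -> ~~ c i.
Proof.
split=> [[B [/F2_basisP[iB _] /card_leP[f0]]]|[f fI]].
  pose f i := match pselect (`I_n i) with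
    left p => set_val (f0 (SigSub (mem_set p))) | right _ => 1 end.
  have fB i : (i < n)%N -> B (f i).
    by move=> lin; rewrite /f; case: pselect => // p; apply: set_valP.
  have fI i j : (i < n)%N -> (j < n)%N -> f i = f j -> i = j.
    move=> lin ljn; rewrite /f; case: pselect => // p; case: pselect => // q.
    move=> /val_inj E; have H : {in [set: `I_n] &, injective f0}%classic := 'inj_f0.
    by have := H _ _ (mem_set I) (mem_set I) E; case.
  exists f => c E i lin; apply/negP => ci.
  have inI j : j \in [seq i <- iota 0 n | c i] -> (j < n)%N.
    by rewrite mem_filter mem_iota /= => /andP[_].
  have := iB [seq f i | i <- iota 0 n & c i].
  rewrite map_inj_in_uniq ?filter_uniq ?iota_uniq //; last first.
    by move=> x y /inI xI /inI yI; apply: fI.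
  move=> /(_ isT) H; have {}H : [seq f i | i <- iota 0 n & c i] = [::].
    by apply: H => // a /mapP[j /inI] jI ->; apply: fB.
  have : f i \in [seq f i | i <- iota 0 n & c i].
    by apply: map_f; rewrite mem_filter ci mem_iota.
  by rewrite H.
have fb (c : nat -> bool) : bprod [seq f i | i <- iota 0 n & c i] = 1 ->
    forall i, (i < n)%N -> ~~ c i by exact: fI.
have finj : {in `I_n &, injective f}.
  move=> i j; rewrite !inE /= => lin ljn E; apply: contrapT => nij.
  suff E1 : bprod [seq f k | k <- iota 0 n & (k == i) || (k == j)] = 1.
    by have := fb _ E1 i lin; rewrite eqxx.
  have P : perm_eq [seq k <- iota 0 n | (k == i) || (k == j)] [:: i; j].
    apply: uniq_perm; rewrite ?filter_uniq ?iota_uniq //= ?inE ?andbT; first by apply/eqP.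
    move=> k; rewrite mem_filter mem_iota !inE /=.
    by case: eqP => [->|_] /=; [rewrite lin|case: eqP => [->|]].
  rewrite (bprod_perm (perm_map f P)) /= !bprod_cons E /bprod big_nil mulg1.
  exact: bool_mulaa.
have [|B bB SB] := @bool_basis_ext [set f i | i in `I_n]%classic.
  move=> s us sS s1.
  have E : perm_eq s [seq f i | i <- iota 0 n & f i \in s].
    apply: uniq_perm => //.
      rewrite map_inj_in_uniq ?filter_uniq ?iota_uniq // => x y.
      rewrite !mem_filter !mem_iota /= => /andP[_ xI] /andP[_ yI].
      by apply: finj; rewrite inE.
    move=> v; apply/idP/mapP => [vs|[i]]; last by rewrite mem_filter => /andP[H _] ->.
    have [i iI fv] := sS v vs; exists i => //.
    by rewrite mem_filter fv vs mem_iota.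
  rewrite (bprod_perm E) in s1; have H := fb _ s1.
  case: s {us s1 E} sS H => [//|v s] sS H; have [i iI fv] := sS v (mem_head v s).
  by have := H i iI; rewrite fv inE eqxx.
exists B; split=> //.
have E := inj_card_eq finj.
by rewrite -(card_le_eql E); apply: subset_card_le.
Qed.

Lemma F2_dim_ge3P : F2_dim_ge V 3 <-> exists a b v, forall i j k : bool,
  a ^+ i * (b ^+ j * v ^+ k) = 1 -> [&& ~~ i, ~~ j & ~~ k].
Proof.
have E (f : nat -> V) (c : nat -> bool) :
    bool_bits 3 f c = f 0%N ^+ c 0%N * (f 1%N ^+ c 1%N * f 2%N ^+ c 2%N).
  rewrite /bool_bits /=; case: (c 0%N); case: (c 1%N); case: (c 2%N);
    by rewrite /= ?bprod_cons /bprod ?big_nil ?expg1 ?expg0 ?mul1g ?mulg1.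
rewrite F2_dim_geP; split=> [[f fI]|[a [b [v H]]]].
  exists (f 0%N), (f 1%N), (f 2%N) => i j k; pose c n := nth false [:: i; j; k] n.
  have := fI c; rewrite E => H /H {}H.
  by rewrite (H 0%N) ?(H 1%N) ?(H 2%N).
exists (fun n => nth 1%g [:: a; b; v] n) => c; rewrite E /= => /H /and3P[c0 c1 c2].
by case=> [|[|[|]]].
Qed.

Lemma F2_dim_ge2P : F2_dim_ge V 2 <-> exists a b : V, [/\ a <> 1, b <> 1 & a <> b].
Proof.
have E (f : nat -> V) (c : nat -> bool) : bool_bits 2 f c = f 0%N ^+ c 0%N * f 1%N ^+ c 1%N.
  rewrite /bool_bits /=; case: (c 0%N); case: (c 1%N);
    by rewrite /= ?bprod_cons /bprod ?big_nil ?expg1 ?expg0 ?mul1g ?mulg1.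
rewrite F2_dim_geP; split=> [[f fI]|[a [b [a1 b1 ab]]]].
  have N (c : nat -> bool) := fI c; exists (f 0%N), (f 1%N); split=> H.
  - by have := N (fun n => n == 0%N); rewrite E expg1 mulg1 => /(_ H 0%N isT).
  - by have := N (fun n => n == 1%N); rewrite E expg1 mul1g => /(_ H 1%N isT).
  - by have := N (fun _ => true); rewrite E !expg1 H bool_mulaa => /(_ erefl 0%N isT).
exists (fun n => nth 1%g [:: a; b] n) => c; rewrite E /=.
case c0: (c 0%N); case c1: (c 1%N); rewrite ?expg1 ?expg0 ?mul1g ?mulg1 //.
  by move/bool_mul_eq1.
by move=> _ [|[|]] //; rewrite ?c0 ?c1.
Qed.

End BooleanGroups.

Lemma bijective_of (T U : Type) (f : T -> U) :
  injective f -> (forall u, exists t, f t = u) -> bijective f.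
Proof.
move=> fI fS; pose h u := sval (cid (fS u)).
have hK u : f (h u) = u by exact: svalP (cid (fS u)).
by exists h => // t; apply: fI; rewrite hK.
Qed.

Lemma tv_iso_inv (X Y : twoValuedGroup) (f : X -> Y) (g : Y -> X) :
  cancel f g -> cancel g f ->
  (forall x y z1 z2, tv_mul x y = [mset z1; z2] -> tv_mul (f x) (f y) = [mset f z1; f z2]) ->
  forall x y z1 z2, tv_mul x y = [mset z1; z2] -> tv_mul (g x) (g y) = [mset g z1; g z2].
Proof.
move=> fK gK fM x y z1 z2 E; have [u1 [u2 Eu]] := mset2P (tv_mul_size (g x) (g y)).
have := fM _ _ _ _ Eu; rewrite !gK E Eu => /mset2_inj[] [-> ->]; rewrite !fK //.
exact: mset2C.
Qed.

Lemma tv_isomorphic_sym (X Y : twoValuedGroup) : tv_isomorphic X Y -> tv_isomorphic Y X.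
Proof.
case=> f [[g fK gK] fM]; exists g; split; first by exists f.
exact: tv_iso_inv fK gK fM.
Qed.

(** * Boolean groups with an involution *)

Section XuDecomposition.
Variables (X : icGroup) (A : abelianGroup) (iota : A -> A) (p : A -> X).
Hypotheses (iotaM : {morph iota : a b / a * b}) (iotaK : involutive iota)
  (pX : coset_model iota p) (A2 : forall a : A, a * a = 1).

Let bool_A (a : A) : a ^+ 2 = 1. Proof. by rewrite expgS expg1. Qed.
Let G : booleanGroup := BooleanGroup bool_A.
Let n (a : G) : G := a * iota a.

Let iota1_ : iota 1 = 1. Proof. by apply: (mulgI (iota 1)); rewrite -iotaM !mulg1. Qed.
Let nM : {morph n : a b / a * b}.
Proof. by move=> a b; rewrite /n iotaM -!mulgA; congr (_ * _); apply: (@bool_mulCA G). Qed.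
Let n1 : n 1 = 1. Proof. by rewrite /n iota1_ mulg1. Qed.
Let iota_n a : iota (n a) = n a.
Proof. by rewrite /n iotaM iotaK; apply: (@bool_mulC G). Qed.
Let nn a : n (n a) = 1. Proof. by rewrite {1}/n iota_n (@bool_mulaa G). Qed.
Let iotaE a : iota a = a * n a. Proof. by rewrite /n (@bool_mulK G). Qed.

Let K : set G := [set a | n a = 1]%classic.
Let Im : set G := [set a | exists b, a = n b]%classic.
Let K_sub : bool_subgroup K.
Proof. by split=> [|a b]; rewrite /K /= ?n1 // nM => -> ->; rewrite mulg1. Qed.
Let Im_sub : bool_subgroup Im.
Proof.
split; first by exists 1; rewrite n1.
by move=> _ _ [a ->] [b ->]; exists (a * b); rewrite nM.
Qed.

(** Jordan form of a unipotent involution over F_2. With n = iota - 1 in additive terms, G is the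
    sum of a complement C of ker n, of n(C) = im n, and of a complement of im n in ker n. V indexes
    the blocks of size two, W the trivial ones. *)
Lemma Xu_parametrization : exists (V W : booleanGroup) (Phi : V -> V -> W -> G),
  [/\ forall a b w a' b' w', Phi a b w * Phi a' b' w' = Phi (a * a') (b * b') (w * w'),
      forall a b w, iota (Phi a b w) = Phi a (a * b) w,
      forall a b w, Phi a b w = 1 -> [/\ a = 1, b = 1 & w = 1],
      forall g, exists a b w, g = Phi a b w &
      forall a b w, n (Phi a b w) = Phi 1 a 1].
Proof.
have [C [C_sub KC GC]] := bool_complement K_sub.
have [D [D_sub ImD GD]] := bool_complement Im_sub.
have DK_sub : bool_subgroup [set a | D a /\ K a]%classic.
  case: D_sub K_sub => D1 DM [K1 KM]; split=> // a b [Da Ka] [Db Kb].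
  by split; [apply: DM|apply: KM].
have [V [i [iI iM iC]]] := sub_boolean C_sub.
have [W [j [jI jM jD]]] := sub_boolean DK_sub.
have iCP v : C (i v) by apply/iC; exists v.
have jDP w : D (j w) /\ K (j w) by apply/jD; exists w.
have i1 : i 1 = 1 by apply: (mulgI (i 1)); rewrite -iM !mulg1.
have j1 : j 1 = 1 by apply: (mulgI (j 1)); rewrite -jM !mulg1.
have KM : forall x y, K x -> K y -> K (x * y) by case: K_sub.
have Kn a : K (n a) by exact: nn.
pose Phi a b w : G := i a * (n (i b) * j w); exists V, W, Phi; split.
- by move=> a b w a' b' w'; rewrite /Phi bool_mulACA3 !iM nM jM.
- move=> a b w; rewrite iotaE /Phi iM (nM (i a)) (nM (n (i b))) nn (jDP w).2 !mulg1 nM.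
  rewrite -[LHS]mulgA; congr (_ * _); rewrite -[RHS]mulgA; exact: (@bool_mulC G).
- move=> a b w; rewrite /Phi => E.
  have ia : i a = n (i b) * j w by apply: bool_mul_eq1.
  have Ka : K (i a) by rewrite ia; apply: KM => //; apply: (jDP w).2.
  have ia1 := KC _ Ka (iCP a).
  have nj : n (i b) = j w by apply: bool_mul_eq1; rewrite -ia.
  have j_1 : n (i b) = 1 by apply: ImD; [exists (i b)|rewrite nj; apply: (jDP w).1].
  have ib1 := KC _ j_1 (iCP b).
  by split; [apply: iI|apply: iI|apply: jI]; rewrite ?i1 ?j1 // -nj.
- move=> g; have [k [c [Kk Cc ->]]] := GC g; have [a <-] := (iC c).1 Cc.
  have [h [d [[g' ->] Dd kE]]] := GD k.
  have [k' [c' [Kk' Cc' g'E]]] := GC g'; have [b bE] := (iC c').1 Cc'.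
  have ng' : n g' = n (i b) by rewrite g'E nM Kk' mul1g bE.
  have Kd : K d.
    have -> : d = n g' * k by rewrite kE bool_mulK.
    by apply: KM.
  have [w wE] := (jD d).1 (conj Dd Kd).
  by exists a, b, w; rewrite /Phi wE -ng' -kE bool_mulC.
- by move=> a b w; rewrite /Phi (nM (i a)) (nM (n (i b))) nn (jDP w).2 i1 j1 !mulg1 mul1g.
Qed.

Lemma coset_model_one : p 1 = tv_one X.
Proof.
case: pX => p_surj p_eq pM; have [g pg] := p_surj (tv_one X).
have := pM 1 g; rewrite pg tv_mulx1 !mul1g pg.
have -> : p (iota g) = p g by apply/esym/p_eq; right.
by rewrite pg => /mset2_inj[] [].
Qed.

Lemma coset_model_sq a : sq (p a) = p (n a).
Proof.
case: pX => p_surj p_eq pM; have := sq_mset (p a).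
rewrite (pM a a) A2 coset_model_one => /mset2_inj[] [E1 E2]; first by rewrite -E2.
by rewrite -E1 E2.
Qed.

Lemma coset_model_fixM a b : iota a = a -> ((p b)%:b * (p a)%:b = (p (b * a))%:b)%R.
Proof.
case: pX => p_surj p_eq pM ia; apply: tvring_2I.
by rewrite (mul_emb (pM b a)) ia; ring.
Qed.

Lemma coset_model_Xu x y z :
  (forall i j k : bool,
    ((sq x)%:b ^+ i * (sq y)%:b ^+ j * (sq z)%:b ^+ k = 1 :> tvring X)%R ->
    [&& ~~ i, ~~ j & ~~ k]) ->
  exists V W : booleanGroup, F2_dim_ge V 3 /\ tv_isomorphic X (prodTV (Xu V) W).
Proof.
move=> indep; have [V [W [Phi [PhiM Phi_iota Phi_inj Phi_surj Phi_n]]]] := Xu_parametrization.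
case: (pX) => p_surj p_eq pM; exists V, W; split.
  apply/F2_dim_ge3P.
  (* The square of p (Phi a b w) is p (Phi 1 a 1), so independent squares have independent
     V-components. *)
  have [g1 x1] := p_surj x; have [g2 y1] := p_surj y; have [g3 z1] := p_surj z.
  have [a1 [b1 [w1 E1]]] := Phi_surj g1; have [a2 [b2 [w2 E2]]] := Phi_surj g2.
  have [a3 [b3 [w3 E3]]] := Phi_surj g3; exists a1, a2, a3 => i j k E.
  have Phi1 : Phi 1 1 1 = 1.
    by apply: (mulgI (Phi 1 1 1)); rewrite PhiM !mulg1.
  have fixP (a : V) (b : bool) : iota (Phi 1 (a ^+ b) 1) = Phi 1 (a ^+ b) 1.
    by rewrite Phi_iota mul1g.
  have H (a : V) (b : bool) : ((p (Phi 1 a 1)%g)%:b ^+ b = (p (Phi 1 (a ^+ b) 1)%g)%:b :> tvring X)%R.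
    case: b; rewrite ?GRing.expr1 ?GRing.expr0 ?expg1 ?expg0 //.
    by rewrite Phi1 coset_model_one emb1.
  apply: indep; rewrite -x1 -y1 -z1 !coset_model_sq E1 E2 E3 !Phi_n !H.
  rewrite !coset_model_fixM ?fixP // !PhiM !mulg1 -mulgA E Phi1.
  by rewrite coset_model_one emb1.
apply: tv_isomorphic_sym.
pose f (q : prodTV (Xu V) W) : X := p (Phi (orbit_repr q.1).1 (orbit_repr q.1).2 q.2).
pose pi (ab : V * V) : Xu V := orbit_proj (@iota_uK V) ab.
have fE ab w : f (pi ab, w) = p (Phi ab.1 ab.2 w).
  rewrite /f /=; case: (orbit_reprP (@iota_uK V) ab) => -> //.
  by apply/esym/p_eq; right; rewrite Phi_iota.
have piP (o : Xu V) : exists ab, pi ab = o by exists (orbit_repr o); apply: orbit_reprK.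
exists f; split.
  apply: bijective_of => [[o w] [o' w']|u].
    have [[a b] <-] := piP o; have [[a' b'] <-] := piP o'; rewrite !fE /=.
    have PI c d v c' d' v' : Phi c d v = Phi c' d' v' -> [/\ c = c', d = d' & v = v'].
      move=> E; have : Phi c d v * Phi c' d' v' = 1 by rewrite E (@bool_mulaa G).
      by rewrite PhiM => /Phi_inj[] /bool_mul_eq1 -> /bool_mul_eq1 -> /bool_mul_eq1 ->.
    case/p_eq => [/PI[-> -> ->] //|]; rewrite Phi_iota => /PI[-> -> ->].
    by congr pair; apply/orbit_projP; right.
  have [g <-] := p_surj u; have [a [b [w ->]]] := Phi_surj g.
  by exists (pi (a, b), w); rewrite fE.
move=> [o w] [o' w'] [o1 v1] [o2 v2].
have [[a b] <-] := piP o; have [[a' b'] <-] := piP o'.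
have E0 : tv_mul (pi (a, b)) (pi (a', b')) =
    [mset pi ((a, b) * (a', b')); pi ((a, b) * iota_u (a', b'))].
  exact: (coset_mulE (@iota_uM V) (@iota_uK V)).
rewrite /= (prod_mulE w w' E0).
rewrite !fE /= pM PhiM Phi_iota PhiM => /mset2_inj H.
have E1 : f (pi ((a, b) * (a', b')), w * w') = p (Phi (a * a') (b * b') (w * w')) by rewrite fE.
have E2 : f (pi ((a, b) * iota_u (a', b')), w * w') = p (Phi (a * a') (b * (a' * b')) (w * w')).
  by rewrite fE.
by case: H => [] [<- <-]; rewrite -E1 -E2 // mset2C.
Qed.

End XuDecomposition.

Local Open Scope ring_scope.

(** * Products with Y and the classification *)

Section YDecomposition.
Variable X : icGroup.
Implicit Types (x y z b : X).
Notation e := (tv_one X).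

Lemma bool_part_ex : exists (BB : booleanGroup) (i : BB -> X),
  [/\ injective i, forall a c : BB, (i (a * c)%g)%:b = (i a)%:b * (i c)%:b &
      forall x, isB x <-> exists a, i a = x].
Proof.
pose T : choiceType := {b : X | `[< isB b >]}.
have BT (t : T) : isB (val t) by apply/asboolP; case: t.
pose op (t u : T) : T := exist _ (act (val t) (val u)) (asboolT (isB_act (BT t) (BT u))).
pose one : T := exist _ e (asboolT (isB1 X)).
have opE (t u : T) : (val (op t u))%:b = (val t)%:b * (val u)%:b by apply: actE; apply: BT.
have I (t u : T) : (val t)%:b = (val u)%:b -> t = u by move=> E; apply: val_inj; apply: emb_inj.
have opA : associative op by move=> t u w; apply: I; rewrite !opE mulrA.
have opC : commutative op by move=> t u; apply: I; rewrite !opE mulrC.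
have op1 : left_id one op by move=> t; apply: I; rewrite opE emb1 mul1r.
have opV : left_inverse one id op by move=> t; apply: I; rewrite opE emb1 (BT t).
pose A := abelian_of (AbelianData opA opC op1 opV).
have A2 (x : A) : (x ^+ 2 = 1)%g by rewrite expgS expg1; exact: opV.
exists (BooleanGroup A2), (fun t : T => val t); split=> //.
move=> v; split=> [Hv|[t <-]]; last exact: BT.
by exists (exist _ v (asboolT Hv)).
Qed.

Variable t : X.
Hypotheses (Bt : isB t) (t1 : t <> e).
Hypothesis sq_t : forall x, sq x = e \/ sq x = t.
Local Notation T1 := (1 + t%:b).

Lemma sqT x : ~ isB x -> sq x = t.
Proof. by move=> nB; case: (sq_t x) => // /isBP. Qed.

Lemma t_fix x : ~ isB x -> t%:b * x%:b = x%:b.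
Proof. by move=> nB; rewrite -(sqT nB) sq_stab ?sqT. Qed.

Lemma T1_fix x : ~ isB x -> T1 * x%:b = 2 * x%:b.
Proof. by move=> /t_fix H; lc H. Qed.

Lemma nB_prod x y : ~ isB x -> ~ isB y ->
  (exists2 b, isB b & 2 * (x%:b * y%:b) = T1 * b%:b) \/
  (exists2 z, ~ isB z & x%:b * y%:b = z%:b).
Proof.
move=> nx ny; have sx := sqT nx; have sy := sqT ny.
case: (sq_eqP (u := x) (v := y)) => [|[b Bb yE]|[_ _ [z xyz sz]]]; first by rewrite sx.
  left; exists b => //; rewrite yE; have := sqE x; rewrite sx => E; lc ((- b%:b) *e E).
by right; exists z => // /isBP Bz; apply: t1; rewrite -sx -sz.
Qed.

Lemma T1_prod x y : exists z, T1 * (x%:b * y%:b) = T1 * z%:b.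
Proof.
have [Bx|nx] := pselect (isB x); first by exists (act x y); rewrite actE.
have [By|ny] := pselect (isB y).
  by exists (act y x); rewrite actE // (mulrC x%:b).
case: (nB_prod nx ny) => [[b Bb E]|[z _ E]]; last by exists z; rewrite E.
by exists b; apply: tvring_2I; lc (T1 *e E +e b%:b *e Bt).
Qed.

(** Multiplication by 1 + t identifies x with t x and makes products single-valued, so X modulo t is
    a Boolean group H. Its part from B is W, a complement is V, and t itself returns as the extra
    element s. *)
Lemma YTV_classification :
  (exists x y, [/\ ~ isB x, ~ isB y & forall b, isB b -> y%:b <> b%:b * x%:b]) ->
  exists V W : booleanGroup, F2_dim_ge V 2 /\ tv_isomorphic X (prodTV (YTV V) W).
Proof.
move=> xy; have [BB [i [iI iM iP]]] := bool_part_ex.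
have iB a : isB (i a) by apply/iP; exists a.
have i1 : i 1%g = e.
  apply: emb_inj; have := iM 1%g 1%g; rewrite mulg1 emb1 => E.
  by lc ((- (i 1%g)%:b) *e E +e (1 - (i 1%g)%:b) *e iB 1%g).
have [tt ttE] := (iP t).1 Bt.
have Tsub : bool_subgroup [set a : BB | a = 1%g \/ a = tt]%classic.
  split=> [|a c]; first by left.
  by case=> -> [] ->; rewrite ?mulg1 ?mul1g ?bool_mulaa; [left|right|right|left].
have [K [[K1 KM] KT KG]] := bool_complement Tsub.
(* Representatives modulo t: elements outside B are fixed by t, and in B the complement K of {1, t}
   keeps representatives closed under products. *)
pose S x := ~ isB x \/ exists2 a, K a & i a = x.
have S_norm x : exists2 z, S z & T1 * x%:b = T1 * z%:b.
  have [/iP[a <-]|nx] := pselect (isB x); last by exists x; first by left.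
  have [h [k [[->|->] Kk ->]]] := KG a; exists (i k); try by [right; exists k].
    by rewrite mul1g.
  by rewrite iM ttE; lc ((i k)%:b *e Bt).
have S_inj x y : S x -> S y -> T1 * x%:b = T1 * y%:b -> x = y.
  move=> Sx Sy E; have : x%:b + (act t x)%:b = y%:b + (act t y)%:b.
    by rewrite !actE //; lc E.
  case/emb2_inj => [] [xt yt]; first exact: xt.
  have xE : x%:b = t%:b * y%:b by rewrite xt actE.
  have [By|ny] := pselect (isB y); last by apply: emb_inj; rewrite xE t_fix.
  have Bx : isB x by apply: (isBM Bt By).
  case: Sx => // -[a Ka aE]; case: Sy => // -[c Kc cE].
  exfalso; apply: t1; rewrite -ttE; suff -> : tt = 1%g by [].
  apply: KT; first by right.
  suff -> : tt = (a * c)%g by apply: KM.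
  by apply: iI; apply: emb_inj; rewrite iM ttE aE cE xE; lc ((- t%:b) *e By).
have S_prod x y : exists2 z, S z & T1 * (x%:b * y%:b) = T1 * z%:b.
  by have [u ->] := T1_prod x y; apply: S_norm.
pose ST : choiceType := {x : X | `[< S x >]}.
have SP (a : ST) : S (val a) by apply/asboolP; case: a.
have [op opE] : exists op : ST -> ST -> ST, forall a b : ST,
    T1 * ((val a)%:b * (val b)%:b) = T1 * (val (op a b))%:b.
  have H (a b : ST) : exists c : ST, T1 * ((val a)%:b * (val b)%:b) = T1 * (val c)%:b.
    by have [z Sz E] := S_prod (val a) (val b); exists (exist _ z (asboolT Sz)).
  by exists (fun a b : ST => sval (cid (H a b))) => a b; apply: svalP (cid (H a b)).
have I (a b : ST) : T1 * (val a)%:b = T1 * (val b)%:b -> a = b.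
  by move=> E; apply: val_inj; apply: S_inj.
have Se : S e by right; exists 1%g.
pose one : ST := exist _ e (asboolT Se).
have opA : associative op.
  move=> a b c; apply: I; rewrite -!opE.
  by lc ((- (val a)%:b) *e opE b c +e (val c)%:b *e opE a b).
have opC : commutative op by move=> a b; apply: I; rewrite -!opE mulrC (mulrC (val b)%:b) mulrC.
have op1 : left_id one op by move=> a; apply: I; rewrite -opE emb1 mul1r.
have opV : left_inverse one id op.
  move=> a; apply: I; rewrite -opE emb1 mulr1.
  have [Ba|na] := pselect (isB (val a)); first by rewrite Ba mulr1.
  by have := sqE (val a); rewrite sqT // => E; apply: tvring_2I; lc ((- T1) *e E +e Bt).
pose A := abelian_of (AbelianData opA opC op1 opV).
have A2 (x : A) : (x ^+ 2 = 1)%g by rewrite expgS expg1; exact: opV.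
pose H : booleanGroup := BooleanGroup A2.
pose vl (h : H) : X := val (h : ST).
have vlM (a c : H) : T1 * ((vl a)%:b * (vl c)%:b) = T1 * (vl (a * c)%g)%:b by exact: opE.
have vl1 : vl 1%g = e by [].
have vlI (a c : H) : vl a = vl c -> a = c by move=> E; apply: val_inj.
have vlS x : S x -> exists a : H, vl a = x by move=> Sx; exists (exist _ x (asboolT Sx)).
have vlBM (a c : H) : isB (vl a) -> isB (vl c) -> (vl (a * c)%g)%:b = (vl a)%:b * (vl c)%:b.
  move=> Ba Bc; rewrite -actE //; congr _%:b; apply: S_inj.
  - exact: SP.
  - right; case: (SP (a : ST)) => // -[a' Ka aE]; case: (SP (c : ST)) => // -[c' Kc cE].
    exists (a' * c')%g; first exact: KM.
    by apply: emb_inj; rewrite iM actE // aE cE.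
  - by rewrite actE // vlM.
have KW_sub : bool_subgroup [set a : H | isB (vl a)]%classic.
  split=> [|a c Ba Bc]; first exact: isB1.
  by apply: (isBM Ba Bc); apply: vlBM.
have [C [C_sub CKW GC]] := bool_complement KW_sub.
have [V [iV [iVI iVM iVP]]] := sub_boolean C_sub.
have [W [iW [iWI iWM iWP]]] := sub_boolean KW_sub.
have CV a : C (iV a) by apply/iVP; exists a.
have BW w : isB (vl (iW w)) by apply/iWP; exists w.
have iV1 : iV 1%g = 1%g by apply: (mulgI (iV 1%g)); rewrite -iVM !mulg1.
have iW1 : iW 1%g = 1%g by apply: (mulgI (iW 1%g)); rewrite -iWM !mulg1.
pose phi (a : V) (w : W) : X := vl (iW w * iV a)%g.
have phiM a w a' w' : T1 * ((phi a w)%:b * (phi a' w')%:b) = T1 * (phi (a * a')%g (w * w')%g)%:b.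
  rewrite vlM /phi iVM iWM; congr (T1 * (vl _)%:b).
  by rewrite -!mulgA; congr (_ * _)%g; rewrite bool_mulCA.
have phi1B w : isB (phi 1%g w) by rewrite /phi iV1 mulg1.
have phiB a w : isB (phi a w) -> a = 1%g.
  move=> B; apply: iVI; rewrite iV1; apply: CKW => //.
  have -> : iV a = (iW w * (iW w * iV a))%g by rewrite bool_mulK.
  by case: KW_sub => _ KWM; apply: KWM; [apply: BW|].
have phinB a w : a <> 1%g -> ~ isB (phi a w) by move=> a1 /phiB.
have phi_inj a w a' w' : phi a w = phi a' w' -> a = a' /\ w = w'.
  move=> /vlI E; have E2 : (iW w * iW w' = iV a * iV a')%g.
    apply: bool_mul_eq1; rewrite -mulgA (bool_mulCA (iW w')) mulgA E.
    exact: bool_mulaa.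
  have E3 : (iV a * iV a' = 1)%g.
    apply: CKW; last by rewrite -iVM; apply: CV.
    by rewrite -E2 -iWM; apply: BW.
  split; first by apply: iVI; apply: bool_mul_eq1.
  by apply: iWI; apply: bool_mul_eq1; rewrite E2.
have phi_surj x : S x -> exists a w, phi a w = x.
  move=> /vlS [h <-]; have [k [c [Bk Cc ->]]] := GC h.
  by have [a <-] := (iVP c).1 Cc; have [w <-] := (iWP k).1 Bk; exists a, w.
(* Outside B the factor 1 + t acts as 2, so a product modulo t is a true product. *)
have single a w a' w' : ~ isB (phi a w) -> ~ isB (phi (a * a')%g (w * w')%g) ->
    (phi a w)%:b * (phi a' w')%:b = (phi (a * a')%g (w * w')%g)%:b.
  move=> n1 n2; apply: tvring_2I; rewrite -T1_fix // -phiM.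
  by rewrite !mulrA T1_fix.
pose f (q : prodTV (YTV V) W) : X :=
  if q.1 is Some a then phi a q.2 else act t (phi 1%g q.2).
exists V, W; split.
  apply/F2_dim_ge2P; case: xy => x [y [nx ny nxy]].
  have [a [w xE]] := phi_surj x (or_introl nx).
  have [a' [w' yE]] := phi_surj y (or_introl ny).
  exists a, a'; split=> [a1|a1|aa'].
  - by apply: nx; rewrite -xE a1.
  - by apply: ny; rewrite -yE a1.
  - have Bww : isB (phi 1%g (w' * w)%g) by [].
    apply: (nxy _ Bww); apply: tvring_2I; rewrite -T1_fix // -xE -yE -aa'.
    have := phiM 1%g (w' * w)%g a w; rewrite mul1g -mulgA bool_mulaa mulg1 => <-.
    by rewrite xE mulrCA T1_fix // mulrCA.
have noT a w w' : phi a w <> act t (phi 1%g w').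
  move=> E; have a1 : a = 1%g by apply: (phiB a w); rewrite E; apply: isB_act.
  have E2 : T1 * (phi 1%g w)%:b = T1 * (phi 1%g w')%:b.
    by move: E; rewrite a1 => E; rewrite E actE //; lc ((phi 1%g w')%:b *e Bt).
  have E3 : phi 1%g w = phi 1%g w' by exact: (S_inj _ _ (SP _) (SP _) E2).
  move: E; rewrite a1 E3 => /(congr1 (@emb X)); rewrite actE // => E.
  apply: t1; apply: emb_inj; rewrite emb1; have Bw := phi1B w'.
  by lc ((- (phi 1%g w')%:b) *e E +e (1 - t%:b) *e Bw).
have actI x y : act t x = act t y -> x = y.
  move/(congr1 (@emb X)); rewrite !actE // => E; apply: emb_inj.
  by lc (t%:b *e E +e (y%:b - x%:b) *e Bt).
have phi11 w w' : (phi 1%g w)%:b * (phi 1%g w')%:b = (phi 1%g (w * w')%g)%:b.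
  by rewrite /phi iV1 !mulg1 iWM vlBM.
have phiE a w a' w' : a <> a' ->
    (phi a w)%:b * (phi a' w')%:b = (phi (a * a')%g (w * w')%g)%:b.
  move=> aa'; have n2 : ~ isB (phi (a * a')%g (w * w')%g).
    by apply: phinB => /bool_mul_eq1.
  have [a1|a1] := pselect (a = 1%g); last by apply: single => //; apply: phinB.
  rewrite mulrC bool_mulC (bool_mulC w) in n2 *; apply: single => //.
  by apply: phinB => a'1; apply: aa'; rewrite a1.
apply: tv_isomorphic_sym; exists f; split.
  apply: bijective_of => [[[a|] w] [[a'|] w']|x]; rewrite /f /=.
  - by case/phi_inj => -> ->.
  - by move/noT.
  - by move/esym/noT.
  - by move/actI/phi_inj => [_ ->].
  - have [z Sz E] := S_norm x; have [a [w zE]] := phi_surj z Sz.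
    have : x%:b + (act t x)%:b = z%:b + (act t z)%:b by rewrite !actE //; lc E.
    case/emb2_inj => [] [E1 E2]; first by exists (Some a, w); rewrite /f /= zE.
    have [Bz|nz] := pselect (isB z).
      have a1 : a = 1%g by apply: (phiB a w); rewrite zE.
      by exists (None, w); rewrite /f /= -a1 zE.
    exists (Some a, w); rewrite /f /= zE; apply: emb_inj.
    by rewrite E1 actE // t_fix.
have fN w : (f (None, w))%:b = t%:b * (phi 1%g w)%:b by rewrite /f /= actE.
have fS a w : f (Some a, w) = phi a w by [].
move=> [q w] [q' w'] z1 z2.
suff [o1 [o2 [Eo Ef]]] : exists o1 o2, tv_mul (q : YTV V) q' = [mset o1; o2] /\
    2 * ((f (q, w))%:b * (f (q', w'))%:b) = (f (o1, (w * w')%g))%:b + (f (o2, (w * w')%g))%:b.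
  rewrite /= (prod_mulE w w' Eo) => /mset2_inj E; apply: embM_mset; rewrite Ef.
  by case: E => [] [<- <-] //; rewrite addrC.
rewrite /= /Y_mul; case: q q' => [a|] [b|].
- case: eqP => [<-|ab] /=; last first.
    by exists (Some (a * b)%g), (Some (a * b)%g); split=> //; rewrite !fS phiE //; ring.
  case: eqP => [->|a1] /=.
    by exists (Some 1%g), (Some 1%g); split=> //; rewrite !fS phi11; ring.
  exists (Some 1%g), None; split=> //; rewrite fN !fS.
  rewrite mulrA -T1_fix; last exact: phinB.
  by rewrite -mulrA phiM bool_mulaa; ring.
- case: eqP => [->|a1] /=.
    by exists None, None; split=> //; rewrite !fN fS -phi11; ring.
  exists (Some a), (Some a); split=> //; rewrite fN !fS.
  have -> : phi a (w * w')%g = phi (a * 1)%g (w * w')%g by rewrite mulg1.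
  rewrite -phiE //; have E := t_fix (phinB a w a1).
  by lc ((2 * (phi 1%g w')%:b) *e E).
- case: eqP => [->|b1] /=.
    by exists None, None; split=> //; rewrite !fN fS -phi11; ring.
  exists (Some b), (Some b); split=> //; rewrite fN !fS.
  have -> : phi b (w * w')%g = phi (1 * b)%g (w * w')%g by rewrite mul1g.
  rewrite -phiE; last by move=> H1; apply: b1.
  have E := t_fix (phinB b w' b1).
  by lc ((2 * (phi 1%g w)%:b) *e E).
- exists (Some 1%g), (Some 1%g); split=> //; rewrite !fN !fS -phi11.
  by lc ((2 * (phi 1%g w)%:b * (phi 1%g w')%:b) *e Bt).
Qed.

End YDecomposition.

Lemma bool_invE (V : booleanGroup) (a : V) : (a^-1 = a)%g.
Proof. exact/mulg1_eq/bool_mulaa. Qed.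

Lemma boolean_classification (X : icGroup) : (forall x : X, isB x) ->
  exists A : abelianGroup, tv_isomorphic X (Xa A).
Proof.
move=> allB; have [V [i [iI iM iP]]] := bool_part_ex X.
exists (AbelianGroup (@bool_mulC V)); apply: (@coset_model_iso X _ _ _ _ i).
split=> [x|a b|a b]; first by apply/iP.
- rewrite /iota_a bool_invE; split=> [/iI ->|]; first by left.
  by case=> ->.
- by rewrite /iota_a bool_invE; apply: embM_mset; rewrite iM; ring.
Qed.

Lemma quat_classification (X : icGroup) (x y z t : X) : quat_triple x y z t ->
  exists V W : booleanGroup, F2_dim_ge V 2 /\ tv_isomorphic X (prodTV (YTV V) W).
Proof.
move=> Q; have sq_t := quat_sq Q; case: Q => [xy [sx sy sz] Bt tn].
have nB u : sq u = t -> ~ isB u by move=> su /isBP; rewrite su.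
apply: (YTV_classification Bt tn sq_t); exists x, y; split; try exact: nB.
(* If y = b x, then x * y = [b, b t] consists of elements of B, and z would be one of them. *)
move=> b Bb yE; apply: (nB z sz).
have : z%:b + z%:b = b%:b + (act b t)%:b.
  by rewrite actE // -sx sqE -xy yE; ring.
by case/emb2_inj => [] [-> _] //; apply: isB_act.
Qed.

Lemma ic_classification (X : icGroup) :
  (exists A : abelianGroup, tv_isomorphic X (Xa A)) \/
  (exists V W : booleanGroup, F2_dim_ge V 3 /\ tv_isomorphic X (prodTV (Xu V) W)) \/
  (exists V W : booleanGroup, F2_dim_ge V 2 /\ tv_isomorphic X (prodTV (YTV V) W)).
Proof.
have [normalX|] := pselect (forall x y : X, normal_pair x y); last first.
  move=> /existsNP[x /existsNP[y nN]]; right; right.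
  by case: (normal_or_quat x y) => [//|[z Q]]; apply: quat_classification Q.
have [sqB|/existsNP[g gnB]] := pselect (forall x : X, isB (sq x)); last first.
  by left; apply: large_order_abelian gnB.
have [allB|/existsNP[g gnB]] := pselect (forall x : X, isB x).
  by left; apply: boolean_classification.
have [s [A [iota [p [iotaM iotaK pX]]]]] := small_order_coset normalX sqB gnB.
case=> [iE|[A2 [x [y [z indep]]]]]; last first.
  by right; left; apply: (coset_model_Xu iotaM iotaK pX A2 indep).
left; exists A; apply: (@coset_model_iso X A _ (@iota_aM A) (@iota_aK A) p).
case: pX => p_surj p_eq pM; split=> // [a b|a b]; first by rewrite p_eq iE.
by rewrite pM iE.
Qed.

Local Open Scope group_scope.

(** * Uniqueness *)

Definition tv_order2 (X : twoValuedGroup) (x : X) := tv_mul x x = [mset tv_one X; tv_one X].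

Section Isomorphism.
Variables (X Y : twoValuedGroup) (f : X -> Y).
Hypotheses (f_bij : bijective f)
  (fM : forall x y z1 z2, tv_mul x y = [mset z1; z2] -> tv_mul (f x) (f y) = [mset f z1; f z2]).

Lemma tv_iso_mem x y z : z \in tv_mul x y -> f z \in tv_mul (f x) (f y).
Proof.
have [a [b E]] := mset2P (tv_mul_size x y); rewrite (fM E) E !in_mset2.
by case/orP => /eqP ->; rewrite eqxx ?orbT.
Qed.

Lemma tv_iso_one : f (tv_one X) = tv_one Y.
Proof.
case: f_bij => g fK gK; have := fM (tv_mulx1 (g (tv_one Y))); rewrite gK tv_mul1x.
by case/mset2_inj => [] [].
Qed.

Lemma tv_iso_order2 x : tv_order2 x <-> tv_order2 (f x).
Proof.
rewrite /tv_order2 -tv_iso_one; split=> [/fM //|].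
have [a [b E]] := mset2P (tv_mul_size x x); rewrite (fM E) E.
by case/mset2_inj => [] [/(bij_inj f_bij) -> /(bij_inj f_bij) ->].
Qed.

End Isomorphism.

Lemma mul_mem_ex (X : twoValuedGroup) (x y : X) : exists z, z \in tv_mul x y.
Proof. by have [a [b ->]] := mset2P (tv_mul_size x y); exists a; rewrite in_mset2 eqxx. Qed.

(** * Recovering V and W from invariant predicates *)

Section Quotients.
Implicit Types (X Y : twoValuedGroup) (V : booleanGroup).

(** Presents V as D/N. When D and N are preserved by isomorphisms, so is V up to isomorphism. *)
Definition bool_quotient X V (D N : X -> Prop) (psi : X -> V) :=
  [/\ forall x y z, D x -> D y -> z \in tv_mul x y -> D z /\ psi z = psi x * psi y,
      forall x, D x -> (psi x = 1 <-> N x) &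
      forall a, exists2 x, D x & psi x = a].

(** If psi x = psi y, the entries of x * y lie in N and their images in N', so psi' (f x) = psi' (f
    y) and f descends. *)
Lemma bool_quotient_map X Y V V' D N D' N' (psi : X -> V) (psi' : Y -> V') (f : X -> Y) :
  bool_quotient D N psi -> bool_quotient D' N' psi' ->
  (forall x y z, z \in tv_mul x y -> f z \in tv_mul (f x) (f y)) ->
  (forall x, D x -> D' (f x)) -> (forall x, N x -> N' (f x)) ->
  exists2 phi : V -> V', {morph phi : a b / a * b} & forall x, D x -> phi (psi x) = psi' (f x).
Proof.
move=> [psiM psi1 psi_surj] [psiM' psi1' _] fM fD fN.
have wd x y : D x -> D y -> psi x = psi y -> psi' (f x) = psi' (f y).
  move=> Dx Dy E; have [u uxy] := mul_mem_ex x y.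
  have [Du uE] := psiM _ _ _ Dx Dy uxy; rewrite E bool_mulaa in uE.
  have [_ E'] := psiM' _ _ _ (fD _ Dx) (fD _ Dy) (fM _ _ _ uxy).
  apply: bool_mul_eq1; rewrite -E'; apply/psi1'; first exact: fD.
  exact/fN/psi1.
have kP a : exists x, D x /\ psi x = a by have [x Dx E] := psi_surj a; exists x.
pose k a := sval (cid (kP a)).
have kE a : D (k a) /\ psi (k a) = a by exact: svalP (cid (kP a)).
exists (fun a => psi' (f (k a))) => [a b|x Dx]; last first.
  by have [? ?] := kE (psi x); apply: wd.
have [z zab] := mul_mem_ex (k a) (k b); have [[Da Ea] [Db Eb]] := (kE a, kE b).
have [Dz zE] := psiM _ _ _ Da Db zab.
have [_ <-] := psiM' _ _ _ (fD _ Da) (fD _ Db) (fM _ _ _ zab).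
by have [? E] := kE (a * b); apply: wd => //; rewrite E zE Ea Eb.
Qed.

Lemma bool_quotient_iso X Y V V' D N D' N' (psi : X -> V) (psi' : Y -> V')
    (f : X -> Y) (g : Y -> X) :
  bool_quotient D N psi -> bool_quotient D' N' psi' -> cancel f g -> cancel g f ->
  (forall x y z, z \in tv_mul x y -> f z \in tv_mul (f x) (f y)) ->
  (forall x y z, z \in tv_mul x y -> g z \in tv_mul (g x) (g y)) ->
  (forall x, D x -> D' (f x)) -> (forall x, N x -> N' (f x)) ->
  (forall x, D' x -> D (g x)) -> (forall x, N' x -> N (g x)) ->
  group_isomorphic V V'.
Proof.
move=> Q Q' fK gK fM gM fD fN gD gN.
have [phi phiM phiE] := bool_quotient_map Q Q' fM fD fN.
have [chi chiM chiE] := bool_quotient_map Q' Q gM gD gN.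
exists phi; split=> //; exists chi => a.
- by case: Q => _ _ /(_ a)[x Dx <-]; rewrite phiE // chiE ?fK //; apply: fD.
- by case: Q' => _ _ /(_ a)[x Dx <-]; rewrite chiE // phiE ?gK //; apply: gD.
Qed.

(* Such a map exists on both [Xu V] and [YTV V]; it makes [V] and [W]
   recoverable from the product with [W]. *)
Definition order2_quotient X V (psi : X -> V) :=
  bool_quotient (fun=> True) (@tv_order2 X) psi /\
  forall z : X, tv_order2 z -> exists y, z \in tv_mul y y.

Lemma prod_order2 X (W : booleanGroup) (p : prodTV X W) :
  tv_order2 p <-> tv_order2 p.1.
Proof.
case: p => x w; have [a [b E]] := mset2P (tv_mul_size x x).
rewrite /tv_order2 /= (prod_mulE _ _ E) E bool_mulaa; split.
  by case/mset2_inj => [] [[->] [->]].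
by case/mset2_inj => [] [-> ->].
Qed.

Lemma in_prodTV X (W : booleanGroup) (p q r : prodTV X W) :
  r \in tv_mul p q <-> r.1 \in tv_mul p.1 q.1 /\ r.2 = p.2 * q.2.
Proof.
case: p q r => [x u] [y v] [z w]; rewrite /= in_prod_mul; split.
  by case/andP => ? /eqP.
by case=> -> ->; rewrite eqxx.
Qed.

Lemma prod_bool_quotient1 X V (W : booleanGroup) (psi : X -> V) : order2_quotient psi ->
  bool_quotient (fun=> True) (@tv_order2 (prodTV X W)) (fun p => psi p.1).
Proof.
case=> [[psiM psi1 psi_surj] _]; split=> [p q r _ _ /in_prodTV[rpq _]|p _|a].
- by split=> //; case: (psiM _ _ _ I I rpq).
- by rewrite prod_order2; apply: psi1.
- by have [x _ <-] := psi_surj a; exists (x, 1).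
Qed.

(** Second components of squares are trivial, and every order-two element of X is an entry of a
    square; modulo such entries, only W is left. *)
Lemma prod_bool_quotient2 X V (W : booleanGroup) (psi : X -> V) : order2_quotient psi ->
  bool_quotient (@tv_order2 (prodTV X W)) (fun p => exists q, p \in tv_mul q q)
    (fun p : prodTV X W => p.2).
Proof.
case=> [[psiM psi1 _] sqX]; split=> [p q r|[z w]|w].
- move=> /prod_order2/psi1 p1 /prod_order2/psi1 q1 /in_prodTV[rpq ->]; split=> //.
  apply/prod_order2/psi1 => //; have [_ ->] := psiM _ _ _ I I rpq.
  by rewrite p1 // q1 // mulg1.
- move=> /prod_order2/= z2; split=> [->|[q /in_prodTV[_ /= ->]]]; last exact: bool_mulaa.
  by have [y zy] := sqX z z2; exists (y, 1); apply/in_prodTV; rewrite mulg1.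
- exists (tv_one X, w) => //; apply/prod_order2; exact: tv_mul1x.
Qed.

Lemma order2_quotient_uniq X Y V V' (W W' : booleanGroup) (psi : X -> V) (psi' : Y -> V') :
  order2_quotient psi -> order2_quotient psi' ->
  tv_isomorphic (prodTV X W) (prodTV Y W') ->
  group_isomorphic V V' /\ group_isomorphic W W'.
Proof.
move=> Q Q' fXY; have [f [[g fK gK] fM]] := fXY.
have f_bij : bijective f by exists g.
have g_bij : bijective g by exists f.
have fm := tv_iso_mem fM.
have gM := tv_iso_inv fK gK fM.
have gm := tv_iso_mem gM.
split.
  apply: (bool_quotient_iso (prod_bool_quotient1 W Q) (prod_bool_quotient1 W' Q') fK gK) => //.
    by move=> x /(tv_iso_order2 f_bij fM).
  by move=> x /(tv_iso_order2 g_bij gM).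
apply: (bool_quotient_iso (prod_bool_quotient2 W Q) (prod_bool_quotient2 W' Q') fK gK) => //.
- by move=> x /(tv_iso_order2 f_bij fM).
- by move=> x [y xy]; exists (f y); apply: fm.
- by move=> x /(tv_iso_order2 g_bij gM).
- by move=> x [y xy]; exists (g y); apply: gm.
Qed.

End Quotients.

Section ExplicitModels.
Variable V : booleanGroup.
Implicit Types (a b c d v : V).

Definition Xu_proj a b : Xu V := orbit_proj (@iota_uK V) (a, b).

Lemma Xu_projP a b c d : Xu_proj a b = Xu_proj c d <-> c = a /\ (d = b \/ d = a * b).
Proof.
rewrite /Xu_proj; split=> [/orbit_projP[[-> ->]|[-> ->]]|[-> H]]; [by auto|by auto|].
by apply/orbit_projP; case: H => ->; [left|right].
Qed.

Lemma Xu_projE (x : Xu V) : exists a b, x = Xu_proj a b.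
Proof. by exists (orbit_repr x).1, (orbit_repr x).2; rewrite /Xu_proj -surjective_pairing orbit_reprK. Qed.

Lemma Xu_mulE a b c d :
  tv_mul (Xu_proj a b) (Xu_proj c d) = [mset Xu_proj (a * c) (b * d); Xu_proj (a * c) (b * (c * d))].
Proof. exact: (coset_mulE (@iota_uM V) (@iota_uK V)). Qed.

Lemma Xu_order2 a b : tv_order2 (Xu_proj a b) <-> a = 1.
Proof.
have O : tv_one (Xu V) = Xu_proj 1 1 by [].
rewrite /tv_order2 Xu_mulE bool_mulCA !bool_mulaa mulg1 -O; split=> [|->] //.
by case/mset2_inj => [] [] E E'; move/Xu_projP: (E) => [_]; move/Xu_projP: (E') => [_];
   rewrite !mul1g; do 2!case.
Qed.

Lemma Xu_order2_quotient : order2_quotient (fun x : Xu V => (orbit_repr x).1).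
Proof.
have E a b : (orbit_repr (Xu_proj a b)).1 = a.
  by rewrite /Xu_proj; case: (orbit_reprP (@iota_uK V) (a, b)) => ->.
split; first split=> [x y z _ _|x _|a].
- have [[a [b ->]] [c [d ->]]] := (Xu_projE x, Xu_projE y).
  by rewrite Xu_mulE in_mset2 => /orP[] /eqP ->; rewrite !E.
- by have [a [b ->]] := Xu_projE x; rewrite E Xu_order2.
- by exists (Xu_proj a 1).
move=> z; have [a [b ->]] := Xu_projE z => /Xu_order2 ->; exists (Xu_proj b 1).
by rewrite Xu_mulE !bool_mulaa mulg1 mul1g in_mset2 eqxx orbT.
Qed.

Lemma YTV_order2_quotient : F2_dim_ge V 2 -> order2_quotient (fun x : YTV V => odflt 1 x).
Proof.
(* A nontrivial a0 is needed to find s in a square: s is an entry of a0 * a0. *)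
move=> /F2_dim_ge2P[a0 [_ [a01 _ _]]].
have S1 a : (Some a == Some 1 :> option V) = (a == 1) by [].
split; first split=> [x y z _ _|x _|a].
- case: x y => [a|] [b|] /=; rewrite ?in_mset2 ?orbb.
  + case: eqP => [->|_] /=; last by rewrite in_mset2 orbb => /eqP ->.
    by rewrite bool_mulaa; case: eqP => _ /=; rewrite in_mset2 => /orP[] /eqP ->.
  + by rewrite mulg1; case: eqP => [->|_] /=; rewrite in_mset2 orbb => /eqP ->.
  + by rewrite mul1g; case: eqP => [->|_] /=; rewrite in_mset2 orbb => /eqP ->.
  + by rewrite mulg1 => /eqP ->.
- rewrite /tv_order2; case: x => [a|] //=; rewrite eqxx /=.
  by case: eqP => [->|a1] //=; split=> // /mset2_inj[] [].
- by exists (Some a).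
case=> [a|]; rewrite /tv_order2 /=; last first.
  move=> _; exists (Some a0); rewrite /= eqxx /=.
  by move/eqP: a01 => -> /=; rewrite in_mset2 eqxx orbT.
rewrite eqxx /=; case: eqP => [->|a1] /=; last by case/mset2_inj => [] [].
by move=> _; exists (Some 1); rewrite /= !eqxx /= in_mset2 eqxx.
Qed.

End ExplicitModels.

Section Functoriality.
Variables (V V' : booleanGroup).

Lemma prod_isomorphic (X Y : twoValuedGroup) :
  tv_isomorphic X Y -> group_isomorphic V V' -> tv_isomorphic (prodTV X V) (prodTV Y V').
Proof.
move=> [f [[g fK gK] fM]] [h [[k hK kK] hM]].
exists (fun p => (f p.1, h p.2)); split.
  by exists (fun p => (g p.1, k p.2)) => [] [x w]; rewrite /= ?fK ?hK ?gK ?kK.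
move=> [x v] [y w] [z1 u1] [z2 u2] /=.
have [a [b E]] := mset2P (tv_mul_size x y).
rewrite (prod_mulE _ _ E) (prod_mulE _ _ (fM _ _ _ _ E)) -hM.
by case/mset2_inj => [] [[<- <-] [<- <-]] //; rewrite mset2C.
Qed.

Lemma Xu_isomorphic : group_isomorphic V V' -> tv_isomorphic (Xu V) (Xu V').
Proof.
case=> h [[k hK kK] hM]; have kM : {morph k : a b / a * b}.
  by move=> a b; rewrite -{1}[a]kK -{1}[b]kK -hM hK.
have kI := can_inj kK.
apply: (@coset_model_iso _ _ _ _ _ (fun p : V' * V' => Xu_proj (k p.1) (k p.2))).
split=> [x|[a b] [c d]|[a b] [c d]].
- by have [a [b ->]] := Xu_projE x; exists (h a, h b); rewrite /= !hK.
- split=> [/Xu_projP[/= /kI -> []]|[[-> ->]|[-> ->]]] /=.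
  + by move/kI => ->; left.
  + by rewrite -kM => /kI ->; right.
  + by [].
  + by apply/Xu_projP; split=> //; right; rewrite kM.
- by rewrite Xu_mulE /= !kM.
Qed.

Lemma YTV_isomorphic : group_isomorphic V V' -> tv_isomorphic (YTV V) (YTV V').
Proof.
case=> h [[k hK kK] hM]; have h1 : h 1 = 1 by apply: (mulgI (h 1)); rewrite -hM !mulg1.
have hI := can_inj hK; exists (omap h); split.
  by exists (omap k) => [] [a|] //=; rewrite ?hK ?kK.
move=> x y z1 z2; suff H (a b : YTV V) :
    exists u v, tv_mul a b = [mset u; v] /\ tv_mul (omap h a : YTV V') (omap h b) = [mset omap h u; omap h v].
  have [u [v [-> ->]]] := H x y.
  by case/mset2_inj => [] [-> ->] //; rewrite mset2C.
have E1 c : (h c == 1) = (c == 1) by rewrite -h1 (inj_eq hI).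
case: a b => [a|] [b|] /=.
- rewrite (inj_eq hI) E1; case: eqP => [_|_] /=; last first.
    by exists (Some (a * b)), (Some (a * b)); rewrite /= hM.
  case: eqP => _ /=; [exists (Some 1), (Some 1)|exists (Some 1), None];
    by rewrite /= h1.
- by rewrite E1; case: eqP => _ /=; [exists None, None|exists (Some a), (Some a)].
- by rewrite E1; case: eqP => _ /=; [exists None, None|exists (Some b), (Some b)].
- by exists (Some 1), (Some 1); rewrite /= h1.
Qed.

End Functoriality.

(** * Separating the three series *)

(* The invariant separating the series (1) and (2) from the series (3). *)
Definition double_product_order2 (X : twoValuedGroup) :=
  forall x y z : X, tv_mul x y = [mset z; z] -> tv_order2 x \/ tv_order2 y.

Lemma double_product_iso (X Y : twoValuedGroup) :
  tv_isomorphic X Y -> double_product_order2 X -> double_product_order2 Y.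
Proof.
move=> /tv_isomorphic_sym[f [f_bij fM]] PX x y z /fM/PX.
by rewrite -!(tv_iso_order2 f_bij fM).
Qed.

Lemma YTV_double_product (V W : booleanGroup) :
  F2_dim_ge V 2 -> ~ double_product_order2 (prodTV (YTV V) W).
Proof.
move=> /F2_dim_ge2P[a [b [a1 b1 ab]]] P.
have E : tv_mul (Some a : YTV V) (Some b) = [mset Some (a * b); Some (a * b)].
  by rewrite /=; move/eqP: ab => ->.
have N c : c <> 1 -> ~ tv_order2 (Some c : YTV V).
  move/eqP => c1; rewrite /tv_order2 /= eqxx c1 => /mset2_inj[] [] //.
by case: (P (Some a, 1) (Some b, 1) _ (prod_mulE 1 1 E)) => /prod_order2 /N.
Qed.

Lemma Xu_double_product (V W : booleanGroup) : double_product_order2 (prodTV (Xu V) W).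
Proof.
move=> [x u] [y v] [z w]; rewrite !prod_order2 /=.
have [[a [b ->]] [c [d ->]]] := (Xu_projE x, Xu_projE y).
rewrite (prod_mulE _ _ (Xu_mulE _ _ _ _)) !Xu_order2 => /mset2_inj H.
have {H} [E1 E2] : Xu_proj (a * c) (b * d) = z /\ Xu_proj (a * c) (b * (c * d)) = z.
  by case: H => [] [[-> _] [-> _]].
move: E2; rewrite -E1 => /Xu_projP[_]; rewrite bool_mulCA.
case=> E; [right|left].
  by apply: (mulIg (b * d)); rewrite mul1g.
by apply: (mulIg (b * d)); rewrite mul1g {2}E -mulgA bool_mulK.
Qed.

Section AbelianSeries.
Variable A : abelianGroup.
Implicit Types a b c : A.

Definition Xa_proj a : Xa A := orbit_proj (@iota_aK A) a.

Lemma Xa_projP a b : Xa_proj a = Xa_proj b <-> b = a \/ b = a^-1.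
Proof. exact: orbit_projP. Qed.

Lemma Xa_projE (x : Xa A) : exists a, x = Xa_proj a.
Proof. by exists (orbit_repr x); rewrite /Xa_proj orbit_reprK. Qed.

Lemma Xa_mulE a b : tv_mul (Xa_proj a) (Xa_proj b) = [mset Xa_proj (a * b); Xa_proj (a * b^-1)].
Proof. exact: (coset_mulE (@iota_aM A) (@iota_aK A)). Qed.

Lemma ab_mulCA a b c : a * (b * c) = b * (a * c).
Proof. by rewrite !mulgA (ab_mulC a). Qed.

Lemma Xa_order2 a : tv_order2 (Xa_proj a) <-> a * a = 1.
Proof.
have O : tv_one (Xa A) = Xa_proj 1 by [].
rewrite /tv_order2 Xa_mulE mulgV -O; split=> [|-> //].
by case/mset2_inj => [] [+ _]; rewrite O => /esym/Xa_projP; rewrite invg1; case.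
Qed.

Lemma Xa_proj_divE a b : Xa_proj (a * b) = Xa_proj (a * b^-1) -> a * a = 1 \/ b * b = 1.
Proof.
case/Xa_projP => [/mulgI E|E]; [right|left].
  by rewrite -{1}E mulVg.
have : a * b^-1 * b = (a * b)^-1 * b by rewrite E.
rewrite mulgVK invgM (ab_mulC b^-1) mulgVK => E2.
by rewrite {1}E2 mulVg.
Qed.

Lemma Xa_double_product : double_product_order2 (Xa A).
Proof.
move=> x y z; have [[a ->] [b ->]] := (Xa_projE x, Xa_projE y).
rewrite Xa_mulE !Xa_order2 => /mset2_inj H; apply: Xa_proj_divE.
by case: H => [] [-> ->].
Qed.

End AbelianSeries.

(* The lines of the Fano plane, with base point [g]. *)
Definition fano_config (X : twoValuedGroup) (g y z u v w t : X) :=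
  [/\ z \in tv_mul g y, v \in tv_mul g u, w \in tv_mul y u &
   [/\ w \in tv_mul z v, t \in tv_mul z u, t \in tv_mul y v & t \in tv_mul g w]].

(** The condition on y * y excludes degenerate configurations: if A has order 3, the class x other
    than e satisfies x * x = [e, x], and all seven points could be x. *)
Definition has_fano (X : twoValuedGroup) := exists g y z u v w t : X,
  [/\ fano_config g y z u v w t,
      forall x, x \in [:: g; y; z; u; v; w; t] -> ~ tv_order2 x &
      exists2 s, tv_mul y y = [mset tv_one X; s] & tv_order2 s].

Lemma has_fano_iso (X Y : twoValuedGroup) :
  tv_isomorphic X Y -> has_fano X -> has_fano Y.
Proof.
case=> f [f_bij fM] [g [y [z [u [v [w [t [[L1 L2 L3 [L4 L5 L6 L7]] N [s ys s2]]]]]]]]].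
have fm := tv_iso_mem fM.
exists (f g), (f y), (f z), (f u), (f v), (f w), (f t); split.
- by split; [exact: fm|exact: fm|exact: fm|split; exact: fm].
- move=> x; rewrite -[[:: f g, f y & _]]/(map f [:: g; y; z; u; v; w; t]).
  by case/mapP => x0 /N Nx0 -> /(tv_iso_order2 f_bij fM).
- exists (f s); last by apply/(tv_iso_order2 f_bij fM).
  by rewrite (fM _ _ _ _ ys) (tv_iso_one f_bij fM).
Qed.

Lemma Xa_no_fano (A : abelianGroup) : ~ has_fano (Xa A).
Proof.
case=> g [y [z [u [v [w [t [[L1 L2 L3 [L4 L5 L6 L7]] N [s ys s2]]]]]]]].
have pV (a : A) : Xa_proj a^-1 = Xa_proj a by apply/Xa_projP; right; rewrite invgK.
have third (x x' : Xa A) c : x \in tv_mul (Xa_proj c) x' ->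
    exists2 a, x' = Xa_proj a & x = Xa_proj (c * a).
  have [a ->] := Xa_projE x'; rewrite Xa_mulE in_mset2 => /orP[] /eqP ->; first by exists a.
  by exists a^-1; rewrite ?pV.
have [c gE] := Xa_projE g; rewrite gE in L1 L2 L7 N.
have [a yE zE] := third _ _ _ L1; have [b uE vE] := third _ _ _ L2.
subst g y z u v.
have n1 (d : A) : Xa_proj d \in [:: Xa_proj c; Xa_proj a; Xa_proj (c * a); Xa_proj b; Xa_proj (c * b); w; t] ->
    d * d <> 1 by move=> /N Nd /Xa_order2.
have nc : c * c <> 1 by apply: n1; rewrite !inE eqxx.
have na : a * a <> 1 by apply: n1; rewrite !inE eqxx !orbT.
have nca : (c * a) * (c * a) <> 1 by apply: n1; rewrite !inE eqxx !orbT.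
have nb : b * b <> 1 by apply: n1; rewrite !inE eqxx !orbT.
have ncb : (c * b) * (c * b) <> 1 by apply: n1; rewrite !inE eqxx !orbT.
have nw d : w = Xa_proj d -> d * d <> 1 by move=> wE; apply: n1; rewrite -wE !inE eqxx !orbT.
have nt d : t = Xa_proj d -> d * d <> 1 by move=> tE; apply: n1; rewrite -tE !inE eqxx !orbT.
have zv1 : Xa_proj (c * a * (c * b)^-1) = Xa_proj (a * b^-1).
  by rewrite invgM (ab_mulC b^-1) (ab_mulC c) !mulgA mulgK.
have yv1 : Xa_proj (a * (c * b)^-1) = Xa_proj (c * (a * b^-1)^-1).
  by rewrite -pV !invgM !invgK -mulgA ab_mulCA; congr Xa_proj; rewrite !mulgA (ab_mulC b).
have yv2 : a * (c * b) = c * (a * b) by rewrite ab_mulCA.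
move: L3 L4 L5 L6; rewrite !Xa_mulE zv1 yv1 yv2 !in_mset2 -!mulgA.
(* If w = [a b^-1], the lines z u t and y v t force t = [c a b], which is not in g * w. *)
have [wE _ _|_] := eqVneq w (Xa_proj (a * b^-1)).
  have nab := nw _ wE.
  move=> L5 L6; have {L5 L6} tE : t = Xa_proj (c * (a * b)).
    case/orP: L5 => /eqP // tE; case/orP: L6 => /eqP // tE'.
    by move: tE'; rewrite tE => /Xa_proj_divE[].
  have := nt _ tE; rewrite tE in L7 * => nE.
  move: L7; rewrite wE Xa_mulE in_mset2 => /orP[] /eqP.
    by rewrite !mulgA => /Xa_proj_divE[].
  rewrite invgM invgK (ab_mulCA c a) => E.
  case: (@Xa_proj_divE A (c * b) a) => //.
  by rewrite -mulgA (ab_mulC b) (ab_mulCA c a) E -mulgA.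
(* Now w = [a b] = [c^2 a b] gives (c a b)^2 = 1. So t = [c a b^-1] = [c a^-1 b], whence a^2 = b^2,
   and a^4 = 1 from the condition on y * y leaves c^2 = 1. *)
rewrite !orbF => /eqP wE /eqP wE'.
have nab := nw _ wE.
have tn : (c * (a * b)) * (c * (a * b)) = 1.
  case: (@Xa_proj_divE A (c * (a * b)) c) => //.
  rewrite (ab_mulC _ c^-1) mulKg -wE wE'; congr Xa_proj.
  by rewrite (ab_mulC _ c) (ab_mulCA a c).
have nt' : t != Xa_proj (c * (a * b)) by apply/eqP => /nt.
rewrite (negbTE nt') /= => /eqP -> /eqP /Xa_proj_divE[] // E.
have aabb : a * a = b * b.
  apply: (mulIg (b^-1 * b^-1)); rewrite -[RHS]mulgA (mulgA b b^-1) mulgV mul1g mulgV.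
  by rewrite -E -!mulgA; congr (_ * _); rewrite !mulgA (ab_mulC a).
apply: nc; have a4 : (a * a) * (a * a) = 1.
  move: s2; have -> : s = Xa_proj (a * a).
    move: ys; rewrite Xa_mulE mulgV => /mset2_inj[] [E1 E2]; last by rewrite E1.
    by rewrite E1 -E2.
  by move/Xa_order2.
have : c * c * (a * a * (b * b)) = 1.
  by rewrite -tn -!mulgA (ab_mulCA b c) (ab_mulCA a c) (ab_mulCA b a).
by rewrite -aabb a4 mulg1.
Qed.

Lemma Xu_has_fano (V W : booleanGroup) : F2_dim_ge V 3 -> has_fano (prodTV (Xu V) W).
Proof.
move=> /F2_dim_ge3P[a [b [c indep]]].
have nz i j k : [|| i, j | k] -> a ^+ (i : bool) * (b ^+ (j : bool) * c ^+ (k : bool)) <> 1.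
  by move=> H /indep; case: i j k H => [] [] [].
pose q (d : V) : prodTV (Xu V) W := (Xu_proj d 1, 1).
have qM d d' : q (d * d') \in tv_mul (q d) (q d').
  by apply/in_prodTV; rewrite Xu_mulE !mulg1 in_mset2 eqxx.
exists (q a), (q b), (q (a * b)), (q c), (q (a * c)), (q (b * c)), (q (a * (b * c))); split.
- split; [exact: qM|exact: qM|exact: qM|split=> //].
  + have -> : b * c = a * b * (a * c) by rewrite -mulgA (bool_mulCA b) bool_mulK.
    exact: qM.
  + by rewrite mulgA qM.
  + by rewrite bool_mulCA qM.
- move=> x H /prod_order2; move: H; rewrite !inE.
  do 6?[case/orP]; move/eqP => -> /Xu_order2; rewrite -/(_ <> _).
  + by have := nz true false false isT; rewrite ?expg0 ?expg1 ?mulg1 ?mul1g.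
  + by have := nz false true false isT; rewrite ?expg0 ?expg1 ?mulg1 ?mul1g.
  + by have := nz true true false isT; rewrite ?expg0 ?expg1 ?mulg1 ?mul1g.
  + by have := nz false false true isT; rewrite ?expg0 ?expg1 ?mulg1 ?mul1g.
  + by have := nz true false true isT; rewrite ?expg0 ?expg1 ?mulg1 ?mul1g.
  + by have := nz false true true isT; rewrite ?expg0 ?expg1 ?mulg1 ?mul1g.
  + by have := nz true true true isT; rewrite ?expg0 ?expg1 ?mulg1 ?mul1g.
- exists (Xu_proj 1 b, 1); last by apply/prod_order2/Xu_order2.
  by rewrite [LHS](prod_mulE _ _ (Xu_mulE _ _ _ _)) !bool_mulaa !mulg1 mul1g.
Qed.

Theorem theorem13p1 :
  (forall X : twoValuedGroup, tv_commutative X -> tv_involutive X ->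
     (exists A : abelianGroup, tv_isomorphic X (Xa A)) \/
     (exists V W : booleanGroup,
        F2_dim_ge V 3 /\ tv_isomorphic X (prodTV (Xu V) W)) \/
     (exists V W : booleanGroup,
        F2_dim_ge V 2 /\ tv_isomorphic X (prodTV (YTV V) W))) /\
  (forall (A : abelianGroup) (V W : booleanGroup), F2_dim_ge V 3 ->
     ~ tv_isomorphic (Xa A) (prodTV (Xu V) W)) /\
  (forall (A : abelianGroup) (V W : booleanGroup), F2_dim_ge V 2 ->
     ~ tv_isomorphic (Xa A) (prodTV (YTV V) W)) /\
  (forall V W V' W' : booleanGroup, F2_dim_ge V 3 -> F2_dim_ge V' 2 ->
     ~ tv_isomorphic (prodTV (Xu V) W) (prodTV (YTV V') W')) /\
  (forall V W V' W' : booleanGroup, F2_dim_ge V 3 -> F2_dim_ge V' 3 ->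
     tv_isomorphic (prodTV (Xu V) W) (prodTV (Xu V') W') <->
     group_isomorphic V V' /\ group_isomorphic W W') /\
  (forall V W V' W' : booleanGroup, F2_dim_ge V 2 -> F2_dim_ge V' 2 ->
     tv_isomorphic (prodTV (YTV V) W) (prodTV (YTV V') W') <->
     group_isomorphic V V' /\ group_isomorphic W W').
Proof.
split; last split; last split; last split; last split.
- by move=> X XC XV; apply: (ic_classification (ICGroup XC XV)).
- move=> A V W dV /tv_isomorphic_sym iso.
  by apply: (@Xa_no_fano A); apply: has_fano_iso iso (Xu_has_fano W dV).
- move=> A V W dV iso; apply: (YTV_double_product dV).
  exact: double_product_iso iso (@Xa_double_product A).
- move=> V W V' W' _ dV' iso; apply: (YTV_double_product dV').
  exact: double_product_iso iso (@Xu_double_product V W).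
- move=> V W V' W' _ _; split; first exact: order2_quotient_uniq (Xu_order2_quotient V) (Xu_order2_quotient V').
  by case=> iV iW; apply: prod_isomorphic iW; apply: Xu_isomorphic.
- move=> V W V' W' dV dV'; split.
    exact: order2_quotient_uniq (YTV_order2_quotient dV) (YTV_order2_quotient dV').
  by case=> iV iW; apply: prod_isomorphic iW; apply: YTV_isomorphic.
Qed.
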